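(* For $\lambda>0$ let $\varphi_\lambda(x):=e^{\lambda|x|^2}$, $x\in\mathbb R^d$. Assume that, for any $\lambda>0$, there exist $R=R(\lambda)>0$ and a convex increasing function $h_\lambda:[0,+\infty)\to\mathbb R$ such that $1/h_\lambda\in L^1(c,+\infty)$ for large $c=c(\lambda)$ and $$(\mathcal A(t)\varphi_\lambda)(x)\le-h_\lambda(\varphi_\lambda(x)),\qquad t\in I,\ |x|\ge R.$$ Then $G(t,s)$ is ultrabounded and it maps $L^p(\mathbb R^d,\mu_s)$ into $C_b(\mathbb R^d)$ for every $p>1$ (and every $s<t$ in $I$).
   Context: Setting. $I$ is an open right halfline, and for $t\in I$, $(\mathcal A(t)\zeta)(x)=\mathrm{Tr}(Q(t)D^2\zeta(x))+\langle b(t,x),\nabla\zeta(x)\rangle$, $x\in\mathbb R^d$, where $Q=[q_{ij}]$ and $b=(b_1,\dots,b_d)$. Standing assumptions: (i) for some $\theta\in(0,1)$, $q_{ij}\in C^{\theta/2}_{\rm loc}(I)$ and $b_i\in C^{\theta/2,\theta}_{\rm loc}(I\times\mathbb R^d)$ (locally parabolic H\''older); (ii) $Q(t)$ is symmetric and there are $0<\eta_0<\Lambda$ with $\eta_0|\xi|^2\le\langle Q(t)\xi,\xi\rangle\le\Lambda|\xi|^2$ for all $t\in I$, $\xi\in\mathbb R^d$; (iii) there are a positive $\varphi\in C^2(\mathbb R^d)$ with $\varphi(x)\to+\infty$ as $|x|\to+\infty$ and constants $a,\gamma>0$ with $(\mathcal A(t)\varphi)(x)\le a-\gamma\varphi(x)$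 for all $(t,x)\in I\times\mathbb R^d$; (iv) the first order spatial derivatives of $b_i$ exist and belong to $C^{\theta/2,\theta}_{\rm loc}(I\times\mathbb R^d)$, and there is $r_0<0$ with $\langle\nabla_xb(t,x)\xi,\xi\rangle\le r_0|\xi|^2$ for all $(t,x)\in I\times\mathbb R^d$, $\xi\in\mathbb R^d$. For $s\in I$ and $f\in C_b(\mathbb R^d)$, $G(\cdot,s)f\in C_b([s,+\infty)\times\mathbb R^d)\cap C^{1+\theta/2,2+\theta}_{\rm loc}((s,+\infty)\times\mathbb R^d)$ denotes the unique bounded classical solution of $D_tu=\mathcal A(t)u$ in $(s,+\infty)\times\mathbb R^d$, $u(s,\cdot)=f$. Under these assumptions there is a unique family $\{\mu_t:t\in I\}$ of Borel probability measures which is tight (for every $\varepsilon>0$ there is $R>0$ with $\mu_t(B(0,R))\ge1-\varepsilon$ for all $t\in I$) and satisfies $\int G(t,s)f\,d\mu_t=\int f\,d\mu_s$ for all $t>s$ in $I$, $f\in C_b(\mathbb R^d)$ (the tight evolution system of measures). $G(t,s)$ extends to a contraction from $L^p(\mathbb R^d,\mu_s)$ to $L^p(\mathbb R^d,\mu_t)$ for every $p\in[1,+\infty)$, still denoted $G(t,s)$. $\|G(t,s)\|_{p\to\infty}$ is the operator norm from $L^p(\mathbb R^d,\mu_s)$ to $L^\infty(\mathbb R^d)$. $G(t,s)$ is called ultrabounded if it maps $L^p(\mathbb R^d,\mu_s)$ into $L^\infty(\mathbb R^d)$ for every $p>1$ and $t>s$ in $I$, and (for each such $p$) there is a decreasing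 function $C_{p,\infty}:(0,+\infty)\to(0,+\infty)$ with $\lim_{r\to0^+}C_{p,\infty}(r)=+\infty$ and $\|G(t,s)\|_{p\to\infty}\le C_{p,\infty}(t-s)$ for all $s<t$ in $I$. *)

(* Defs.v *)
From HB Require Import structures.
From mathcomp Require Import all_boot all_order all_algebra.
From mathcomp Require Import all_classical all_reals all_analysis.

Set Implicit Arguments.
Unset Strict Implicit.
Unset Printing Implicit Defensive.

Import Order.TTheory GRing.Theory Num.Theory.
Import numFieldNormedType.Exports.

Local Open Scope classical_set_scope.
Local Open Scope ring_scope.

Section Euclidean.
Context {R : realType} {d : nat}.
Implicit Types (x y : 'rV[R]_d) (g : 'rV[R]_d -> R).

Definition dot x y : R := \sum_(i < d) x 0 i * y 0 i.

(* The library norm `|x| on 'rV[R]_d is the sup norm; it induces the same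
   topology, but |x| in the mathematics is always the Euclidean norm. *)
Definition enorm x : R := Num.sqrt (dot x x).

(* Points are row vectors: [mxapp M x] is (the transpose of) M x. *)
Definition mxapp (M : 'M[R]_d) x : 'rV[R]_d := x *m M^T.

Definition partial (i : 'I_d) g x : R := 'D_(delta_mx 0 i) g x.

Definition grad g x : 'rV[R]_d := \row_i partial i g x.

Definition hessian g x : 'M[R]_d := \matrix_(i, j) partial j (partial i g) x.

Definition jacob (v : 'rV[R]_d -> 'rV[R]_d) x : 'M[R]_d :=
  \matrix_(i, j) partial j (fun y => v y 0 i) x.

Definition has_partials g : Prop :=
  forall i x, derivable g x (delta_mx 0 i).

Definition class_C2 g : Prop :=
  [/\ has_partials g,
      forall i, has_partials (partial i g),
      continuous g,
      forall i, continuous (partial i g) &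
      forall i j, continuous (partial j (partial i g))].

Definition class_Cb g : Prop :=
  continuous g /\ exists M : R, forall x, `|g x| <= M.

Definition tends_to_infty g : Prop :=
  forall M : R, exists rho : R, forall x, rho <= enorm x -> M <= g x.

End Euclidean.

Section Hoelder.
Context {R : realType} {d : nat}.

(* C^{alpha}_loc(I): Hoelder on every compact subinterval of I *)
Definition hoelder_loc (alpha : R) (I : set R) (q : R -> R) : Prop :=
  forall t1 t2 : R, `[t1, t2] `<=` I ->
  exists C : R, {in `[t1, t2] &, forall t s,
    `|q t - q s| <= C * `|t - s| `^ alpha}.

(* C^{theta/2,theta}_loc(I x R^d): parabolic Hoelder on every
   [t1, t2] x closed ball with [t1, t2] contained in I *)
Definition parabolic_hoelder_loc (theta : R) (I : set R)
    (u : R -> 'rV[R]_d -> R) : Prop :=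
  forall t1 t2 rho : R, `[t1, t2] `<=` I ->
  exists C : R, forall t s, t \in `[t1, t2] -> s \in `[t1, t2] ->
  forall x y, enorm x <= rho -> enorm y <= rho ->
    `|u t x - u s y| <= C * (`|t - s| `^ (theta / 2) + enorm (x - y) `^ theta).

(* C^{1+theta/2,2+theta}_loc(I x R^d), for open I *)
Definition parabolic_hoelder2_loc (theta : R) (I : set R)
    (u : R -> 'rV[R]_d -> R) : Prop :=
  [/\ forall t x, I t -> derivable (u^~ x) t 1,
      forall t, I t -> has_partials (u t) /\
                       forall i, has_partials (partial i (u t)),
      parabolic_hoelder_loc theta I u
        /\ parabolic_hoelder_loc theta I (fun t x => derive1 (u^~ x) t),
      forall i, parabolic_hoelder_loc theta I (fun t => partial i (u t)) &
      forall i j,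
        parabolic_hoelder_loc theta I (fun t => partial j (partial i (u t)))].

End Hoelder.

Section Kolmogorov.
Context {R : realType} {d : nat}.
Variables (I : set R) (Q : R -> 'M[R]_d) (b : R -> 'rV[R]_d -> 'rV[R]_d).

(* (A(t) zeta)(x) = Tr (Q(t) D^2 zeta(x)) + <b(t,x), grad zeta(x)> *)
Definition opA (t : R) (zeta : 'rV[R]_d -> R) (x : 'rV[R]_d) : R :=
  \tr (Q t *m hessian zeta x) + dot (b t x) (grad zeta x).

Definition regular_coefficients (theta : R) : Prop :=
  (forall i j, hoelder_loc (theta / 2) I (fun t => Q t i j)) /\
  (forall i, parabolic_hoelder_loc theta I (fun t x => b t x 0 i)).

Definition uniformly_elliptic : Prop :=
  (forall t, I t -> (Q t)^T = Q t) /\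
  exists eta0 Lambda : R, [/\ 0 < eta0, eta0 < Lambda &
    forall t, I t -> forall xi : 'rV[R]_d,
      eta0 * enorm xi ^+ 2 <= dot (mxapp (Q t) xi) xi <= Lambda * enorm xi ^+ 2].

Definition has_lyapunov_function : Prop :=
  exists (phi : 'rV[R]_d -> R) (a gamma : R),
    [/\ class_C2 phi, forall x, 0 < phi x, tends_to_infty phi,
        0 < a /\ 0 < gamma &
        forall t, I t -> forall x, opA t phi x <= a - gamma * phi x].

Definition dissipative_drift (theta : R) : Prop :=
  [/\ forall t, I t -> forall i, has_partials (fun x => b t x 0 i),
      forall i j,
        parabolic_hoelder_loc theta I (fun t => partial j (fun x => b t x 0 i)) &
      exists r0 : R, r0 < 0 /\
        forall t, I t -> forall x xi : 'rV[R]_d,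
          dot (mxapp (jacob (b t) x) xi) xi <= r0 * enorm xi ^+ 2].

Definition standing_assumptions (theta : R) : Prop :=
  [/\ 0 < theta < 1, regular_coefficients theta, uniformly_elliptic,
      has_lyapunov_function & dissipative_drift theta].

(* u in C_b([s,+oo) x R^d) cap C^{1+theta/2,2+theta}_loc((s,+oo) x R^d)
   solves D_t u = A(t) u for t > s, with u(s,.) = f; the values of u at
   times t < s are irrelevant. *)
Definition bounded_classical_solution (theta s : R) (f : 'rV[R]_d -> R)
    (u : R -> 'rV[R]_d -> R) : Prop :=
  [/\ {within [set z : R * 'rV[R]_d | s <= z.1],
         continuous (fun z : R * 'rV[R]_d => u z.1 z.2)},
      exists M : R, forall t x, s <= t -> `|u t x| <= M,
      parabolic_hoelder2_loc theta `]s, +oo[ u,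
      forall t x, s < t -> derive1 (u^~ x) t = opA t (u t) x &
      forall x, u s x = f x].

(* G t s f is G(t,s)f. *)
Definition evolution_operator (theta : R)
    (G : R -> R -> ('rV[R]_d -> R) -> 'rV[R]_d -> R) : Prop :=
  forall s f, I s -> class_Cb f ->
    bounded_classical_solution theta s f (fun t => G t s f).

End Kolmogorov.

(* R^d with its Borel sigma-algebra *)
Definition borelRd (R : realType) (d : nat) :=
  g_sigma_algebraType (@open 'rV[R]_d).

Section Measures.
Context {R : realType} {d : nat}.
Variables (I : set R) (G : R -> R -> ('rV[R]_d -> R) -> 'rV[R]_d -> R).
Variable mu : R -> probability (borelRd R d) R.

Definition tight_family : Prop :=
  forall eps : R, 0 < eps -> exists rho : R, 0 < rho /\
    forall t, I t -> ((1 - eps)%:E <= mu t [set x : 'rV[R]_d | (enorm x < rho)%R])%E.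

Definition evolution_system_of_measures : Prop :=
  forall t s, I t -> I s -> s < t -> forall f : 'rV[R]_d -> R, class_Cb f ->
    (\int[mu t]_x (G t s f x)%:E = \int[mu s]_x (f x)%:E)%E.

(* g is a representative of G(t,s)f, where f is in L^p(mu_s) and
   G(t,s) : L^p(mu_s) -> L^p(mu_t) is the continuous extension from C_b: the
   graph of the extension is the closure of the graph of G(t,s) on C_b. *)
Definition Lp_extension (p t s : R) (f g : 'rV[R]_d -> R) : Prop :=
  [/\ f \in Lfun (mu s) p%:E, g \in Lfun (mu t) p%:E &
      exists F : nat -> 'rV[R]_d -> R,
        [/\ forall n, class_Cb (F n),
            Lnorm (mu s) p%:E (EFin \o (F n \- f)) @[n --> \oo] --> 0%E &
            Lnorm (mu t) p%:E (EFin \o (G t s (F n) \- g)) @[n --> \oo] --> 0%E]].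

Definition maps_Lp_into (p t s : R) (E : set ('rV[R]_d -> R)) : Prop :=
  forall f, f \in Lfun (mu s) p%:E -> exists2 g, E g & Lp_extension p t s f g.

(* L^oo(R^d). A function G(t,s)f is a class modulo mu_t-null sets; mu_t has the
   same null sets as the Lebesgue measure, so that the essential supremum is
   taken with respect to mu_t. *)
Definition Linfty (t : R) : set ('rV[R]_d -> R) :=
  [set g | g \in Lfun (mu t) +oo%E].

(* the operator norm of G(t,s) : L^p(mu_s) -> L^oo(R^d) *)
Definition opnorm_p_infty (p t s : R) : \bar R :=
  ereal_sup [set N | exists f g, [/\ Lp_extension p t s f g,
    (Lnorm (mu s) p%:E (EFin \o f) <= 1)%E & N = Lnorm (mu t) +oo%E (EFin \o g) ]].

Definition ultrabounded : Prop :=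
  forall p : R, 1 < p ->
    (forall t s, I t -> I s -> s < t -> maps_Lp_into p t s (Linfty t)) /\
    exists C : R -> R,
      [/\ forall r, 0 < r -> 0 < C r,
          forall r1 r2, 0 < r1 -> r1 < r2 -> C r2 < C r1,
          C r @[r --> 0^'+] --> +oo &
          forall t s, I t -> I s -> s < t ->
            (opnorm_p_infty p t s <= (C (t - s))%:E)%E].

End Measures.

Definition phi_exp {R : realType} {d : nat} (lambda : R) (x : 'rV[R]_d) : R :=
  expR (lambda * enorm x ^+ 2).

(* h : [0,+oo) -> R is convex and increasing, and 1/h is in L^1(c,+oo) for
   some c >= 0 (hence for every larger one). Since 0^-1 = 0 here, 1/h must be
   required to be well defined on (c,+oo). *)
Definition admissible_h {R : realType} (h : R -> R) : Prop :=
  [/\ convex_function (`[0, +oo[ : set R^o) (h : R^o -> R^o),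
      {in `[0, +oo[ &, {homo h : y z / y <= z}} &
      exists c : R, [/\ 0 <= c, forall y, c < y -> h y != 0 &
        (@lebesgue_measure R).-integrable `]c, +oo[
          (fun y => ((h y)^-1)%:E)]].

(* Main.v *)
Require Import Defs.
From HB Require Import structures.
From mathcomp Require Import all_boot all_order all_algebra.
From mathcomp Require Import all_classical all_reals all_analysis.
From mathcomp Require Import measurable_realfun ess_sup_inf ring lra.

Set Implicit Arguments.
Unset Strict Implicit.
Unset Printing Implicit Defensive.

Import Order.TTheory GRing.Theory Num.Theory.
Import numFieldNormedType.Exports.

Local Open Scope classical_set_scope.
Local Open Scope ring_scope.

(** The operators A(t) smooth in two stages, and the elapsed time t - s is
split into halves accordingly.

First half. The diffusion matrix does not depend on x and the drift is
dissipative, so two copies of the diffusion driven by the same noise do not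
move apart. In analytic terms this is a doubling of variables: for solutions
u and v with |u(s)|^p <= v(s), the function
u(t,x) v(t,y)^(-1/p) exp(- c(t) |x-y|^2 / p) cannot reach a new maximum when
c' = - 4 kappa c^2 with kappa = (1 - 1/p) eta0, because second derivatives
taken in the directions (v,v) do not see |x-y|^2 and the ellipticity then
dominates the terms left over ([coupled_generator_le], [harnack_strict]).
Hence the Harnack inequality
u(t,x)^p <= v(t,y) exp(|x-y|^2 / (4 kappa (t-s)))   ([harnack]).
With v the solution started from |u(s)|^p, integrate in y against mu_t over a
ball that carries at least half of the mass of every mu_t, which exists by tightness:
the integral of v(t) is that of |u(s)|^p against mu_s, because (mu_t) is an
evolution system. This gives
u(t,x) <= K |u(s)|_p exp(lambda |x|^2), where lambda and K depend only on p
and on a lower bound of t - s ([integrated_harnack]).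

Second half. For psi = exp(lambda |x|^2) the hypothesis reads
A(t) psi <= - h(psi) far away, with 1/h integrable at infinity; the solutions
of y' = - h(y) come down from infinity in finite time, and by comparison a
solution dominated by a multiple of psi becomes bounded within any given
time. The comparison functions are affine in psi: by convexity
h(y) >= m (y - Z), where m is essentially h(Z) / Z, for each level Z = 2^n Z0,
and during a time tau_n = ln 3 / m_n the coefficient of psi is divided by 3
while the constant grows by a term of order (2/3)^n. The tau_n are bounded by
integrals of 1/h over dyadic intervals, so they can be made to fit in the
given time, and in the limit the coefficient of psi vanishes
([admissible_h_schedule], [decay_bound]).

Together the two stages bound |G(t,s) f| uniformly by C(t-s) |f|_p for f in
C_b ([ultracontractive_estimate]). As C_b is dense in L^p ([Cb_dense_Lfun])
and the bound applies to differences, G(t,s) f_n is uniformly Cauchy when f_n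
tends to f in L^p; so the extension takes its values in C_b and obeys the same
bound. In every comparison, a small multiple of the Lyapunov function confines
the maxima to a compact set ([max_principle], [harnack_penalized]). *)

(** * Directional derivatives *)

Section Line.
Context {R : realType} {d : nat}.
Implicit Types (x y v xi : 'rV[R]_d) (g : 'rV[R]_d -> R).

Lemma is_derive_line g x v s D :
  is_derive (x + s *: v) v g D <-> is_derive s (1:R) (fun r => g (x + r *: v)) D.
Proof.
have E : (fun h => h^-1 *: ((g \o shift (x + s *: v)) (h *: v) - g (x + s *: v)))
  = (fun h : R => h^-1 *: (((fun r => g (x + r *: v)) \o shift s) (h *: 1)
       - g (x + s *: v))).
  apply/funext => h /=; congr (_ *: (g _ - _)).
  by rewrite [h *: 1]mulr1 scalerDl addrCA.
by split=> -[dg eg]; apply: DeriveDef;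
  rewrite /derivable /derive ?E -?E //; rewrite -?eg /derive -?E ?E.
Qed.

Lemma is_derive_line0 g x v D :
  is_derive x v g D <-> is_derive (0:R) (1:R) (fun r => g (x + r *: v)) D.
Proof. by rewrite -is_derive_line scale0r addr0. Qed.

Lemma partial_mean g i y (r : R) : (forall z, derivable g z (delta_mx 0 i)) ->
  exists2 c, `|c| <= `|r| &
    g (y + r *: delta_mx 0 i) - g y = r * partial i g (y + c *: delta_mx 0 i).
Proof.
move=> dg.
have dF s : is_derive s (1:R) (fun s => g (y + s *: delta_mx 0 i))
    (partial i g (y + s *: delta_mx 0 i)).
  by apply/is_derive_line; exact: derivableP.
have cF : continuous (fun s : R => g (y + s *: delta_mx 0 i)).
  by move=> s; apply/differentiable_continuous/derivable1_diffP/ex_derive.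
have [r0|r0] := leP 0 r.
  have [c] := MVT_segment r0 (fun s _ => dF s) (continuous_subspaceT cF).
  rewrite in_itv/= => /andP[c0 cr]; rewrite scale0r addr0 subr0 mulrC => E.
  by exists c => //; rewrite !ger0_norm.
have [c] := MVT_segment (ltW r0) (fun s _ => dF s) (continuous_subspaceT cF).
rewrite in_itv/= => /andP[c0 cr]; rewrite scale0r addr0 sub0r mulrN => E.
by exists c; [rewrite !ler0_norm ?lerN2// ltW|rewrite -opprB E opprK mulrC].
Qed.

(** The increment along eta + a e_i is the increment along eta followed by
one along the i-th axis; the mean value theorem turns the latter into a value
of the i-th partial at a nearby point, so that continuity of this one partial
suffices. *)
Lemma is_derive_add_coord g i x eta a D :
  (forall z, derivable g z (delta_mx 0 i)) -> {for x, continuous (partial i g)} ->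
  is_derive x eta g D ->
  is_derive x (eta + a *: delta_mx 0 i) g (D + a * partial i g x).
Proof.
move=> dg cg [De DE].
set e := delta_mx 0 i.
have cv1 : h^-1 *: (g (h *: eta + x) - g x) @[h --> 0^'] --> D.
  by rewrite -DE; exact: De.
have cv2 : h^-1 *: (g (h *: (eta + a *: e) + x) - g (h *: eta + x)) @[h --> 0^']
    --> a * partial i g x.
  apply/cvgrPdist_le => /= eps eps0.
  have e1 : 0 < eps / (`|a| + 1) by rewrite divr_gt0// ltr_wpDl.
  move/cvgrPdist_le : cg => /(_ _ e1) /nbhs_ballP[dl /= dl0 Hdl].
  have K0 : 0 < `|eta| + `|a| * `|e| + 1 by rewrite ltr_wpDl.
  near=> h.
  have h0 : h != 0 by near: h; exact: nbhs_dnbhs_neq.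
  have hs : `|h| < dl / (`|eta| + `|a| * `|e| + 1).
    near: h; apply: dnbhs0_lt; exact: divr_gt0.
  have [c hc E] := partial_mean (h *: eta + x) (h * a) dg.
  have -> : h *: (eta + a *: e) + x = h *: eta + x + (h * a) *: e.
    by rewrite scalerDr scalerA addrAC.
  rewrite E [_ *: _]mulrA [in h^-1 * _]mulrA mulVf// mul1r -mulrBr normrM.
  have -> : eps = eps / (`|a| + 1) * (`|a| + 1) by rewrite divfK// gt_eqF// ltr_wpDl.
  rewrite mulrC ler_pM//; last by rewrite lerDl.
  apply: Hdl; rewrite -ball_normE /ball_/= [h *: eta + x]addrC -addrA opprD addrA subrr sub0r normrN.
  apply: (le_lt_trans (ler_normD _ _)); rewrite !normrZ.
  move: hs; rewrite ltr_pdivlMr//; apply: le_lt_trans.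
  rewrite mulrDr mulrDr mulr1 -addrA lerD2l.
  apply: (@le_trans _ _ (`|h| * (`|a| * `|e|))); last by rewrite lerDl.
  by rewrite mulrA -normrM ler_wpM2r.
have cv : h^-1 *: (g (h *: (eta + a *: e) + x) - g x) @[h --> 0^']
    --> D + a * partial i g x.
  apply: (cvg_trans _ (cvgD cv1 cv2)); apply: near_eq_cvg; near=> h => /=.
  by rewrite fctE -scalerDr [X in _ *: X]addrC addrA subrK.
by apply: DeriveDef; [apply/cvg_ex; eexists; exact: cv|exact/cvg_lim].
Unshelve. all: by end_near. Qed.

Lemma is_derive_grad g x v : has_partials g ->
  (forall i, {for x, continuous (partial i g)}) ->
  is_derive x v g (dot (grad g x) v).
Proof.
move=> dg cg.
have -> : dot (grad g x) v = \sum_(i < d) v 0 i * partial i g x.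
  by apply: eq_bigr => i _; rewrite mxE mulrC.
rewrite [X in is_derive _ X](row_sum_delta v).
elim: (index_enum _) => [|i r IH]; first by rewrite !big_nil; exact: is_derive0.
by rewrite !big_cons addrC [X in is_derive _ _ _ X]addrC; exact: is_derive_add_coord.
Qed.

Lemma class_C2_line g x v s : class_C2 g ->
  is_derive s (1:R) (fun r => g (x + r *: v)) (dot (grad g (x + s *: v)) v).
Proof.
by case=> g1 g2 c0 c1 c2; apply/is_derive_line/is_derive_grad => // i; exact: c1.
Qed.

Lemma class_C2_line2 g x v s : class_C2 g ->
  is_derive s (1:R) (fun r => dot (grad g (x + r *: v)) v)
    (dot (mxapp (hessian g (x + s *: v)) v) v).
Proof.
case=> g1 g2 c0 c1 c2.
have -> : (fun r => dot (grad g (x + r *: v)) v) =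
    \sum_(i < d) (fun r : R => v 0 i *: partial i g (x + r *: v)).
  rewrite fct_sumE; apply/funext => r; apply: eq_bigr => i _.
  by rewrite mxE mulrC.
have -> : dot (mxapp (hessian g (x + s *: v)) v) v =
    \sum_(i < d) v 0 i *: dot (grad (partial i g) (x + s *: v)) v.
  apply: eq_bigr => i _; rewrite !mxE mulrC; congr (_ * _).
  by apply: eq_bigr => j _; rewrite !mxE mulrC.
apply: is_derive_sum => i; apply: is_deriveZ.
by apply/is_derive_line/is_derive_grad => // j; exact: c2.
Qed.
End Line.

(** * Maxima of functions of one variable *)

Section Dim1.
Context {R : realType}.
Implicit Types f k : R -> R.

Lemma is_derive_max0 k k' : (forall s, is_derive s (1:R) k (k' s)) ->
  (forall s, k s <= k 0) -> k' 0 = 0.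
Proof.
move=> dk km.
have in0 : (0 : R) \in `](-1), 1[%R by rewrite in_itv/=; lra.
have le11 : -1 <= 1 :> R by lra.
have [_ <-] := dk 0.
by have [_ ->] := @derive1_at_max _ k _ _ 0 le11 (fun t _ => @ex_derive _ _ _ _ _ _ _ (dk t)) in0 (fun t _ => km t).
Qed.

(** One-sided, because a maximum over a time interval may sit at its final
time. *)
Lemma left_max_derive_ge0 f (s t D : R) : s < t -> is_derive t (1:R) f D ->
  (forall r, s < r -> r <= t -> f r <= f t) -> 0 <= D.
Proof.
move=> st [df <-] ft.
rewrite ['D_1 f t]cvg_at_leftE//.
apply: limr_ge.
  by rewrite -(cvg_at_leftE (fun h => h^-1 *: ((f \o shift t) (h *: 1) - f t)))//;
    apply: cvg_trans df; apply: cvg_app; move=> A [e egt0 Ae]; exists e => // x xe xgt0;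
    apply: Ae => //; exact/ltr0_neq0.
near=> h.
have h0 : h < 0 by [].
have sh : s - t < h by near: h; apply: nbhs_left_gt; rewrite subr_lt0.
apply: mulr_le0; first by rewrite invr_le0 ltW.
rewrite subr_le0/= [_%:A]mulr1; apply: ft; first by rewrite -ltrBlDr.
by rewrite gerDr ltW.
Unshelve. all: by end_near. Qed.

(** Were c positive, k' would be positive to the right of 0 and k would
increase beyond its maximum. *)
Lemma second_derive_max k k' (c : R) :
  (forall s, is_derive s (1:R) k (k' s)) -> is_derive (0:R) (1:R) k' c ->
  (forall s, k s <= k 0) -> c <= 0.
Proof.
move=> dk [dk' ck'] km; rewrite leNgt; apply/negP => c0.
have k'0 : k' 0 = 0 by exact: is_derive_max0 dk km.
have : h^-1 *: (k' (h *: 1 + 0) - k' 0) @[h --> 0^'] --> c.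
  by rewrite -ck'; exact: dk'.
move=> /cvgrPdist_lt/(_ _ c0)/nbhs_ballP[dl /= dl0 Hdl].
have d20 : 0 < dl / 2 by rewrite divr_gt0.
have ck : continuous k.
  by move=> s; apply/differentiable_continuous/derivable1_diffP/ex_derive.
have [x] := MVT d20 (fun s _ => dk s) (continuous_subspaceT ck).
rewrite in_itv/= => /andP[x0 xd] E.
have : ball 0 dl x.
  rewrite -ball_normE /ball_/= sub0r normrN gtr0_norm//; lra.
move=> /Hdl /(_ (lt0r_neq0 x0)); rewrite k'0 subr0 addr0 [_ *: 1]mulr1 => H.
have kx : 0 < k' x.
  rewrite ltNge; apply/negP => kx; move: H; rewrite gtr0_norm; last first.
    by rewrite subr_gt0; apply: (le_lt_trans _ c0); rewrite mulr_ge0_le0// invr_ge0 ltW.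
  by rewrite ltrBlDr ltrDl ltNge mulr_ge0_le0// invr_ge0 ltW.
have := km (dl / 2); rewrite -subr_le0 E leNgt => /negP; apply.
by rewrite subr0 mulr_gt0.
Qed.
End Dim1.

(** * Trace of the product of two forms of opposite sign *)

Section Trace.
Context {R : realType}.

Local Notation qf Q u := ((u *m Q *m u^T) 0 0).

(** By induction on the size, through the Schur complement: if al is the upper
left entry of Q, the trace of Q M is 1/al times the form M at the first row of
Q, plus the trace of the product of the Schur complement of al in Q, which is
again positive definite, with the lower right block of M. *)
Lemma trace_posdef_mul_le0 n (Q M : 'M[R]_n) : Q^T = Q ->
  (forall u : 'rV[R]_n, u != 0 -> 0 < qf Q u) ->
  (forall u : 'rV[R]_n, qf M u <= 0) ->
  \tr (Q *m M) <= 0.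
Proof.
elim: n Q M => [|n IH] Q M; first by rewrite /mxtrace big_ord0.
rewrite -[n.+1]/(1 + n)%N in Q M *.
rewrite -(submxK Q) -(submxK M) tr_block_mx => /eq_block_mx[_ vE _ BE].
set B := drsubmx Q in BE *.
set v := ursubmx Q in vE *.
have -> : dlsubmx Q = v^T by rewrite -vE trmxK.
have : ulsubmx Q = (ulsubmx Q 0 0)%:M by exact: mx11_scalar.
move: (ulsubmx Q 0 0) => al ->.
set m := ulsubmx M; set m12 := ursubmx M; set m21 := dlsubmx M; set N := drsubmx M.
move=> Qpos Mneg.
have al0 : 0 < al.
  have := Qpos (row_mx 1%:M 0); rewrite tr_row_mx mul_row_block mul_row_col.
  rewrite !(mul1mx, mul0mx, addr0, trmx1, mulmx1, trmx0, mulmx0) mxE eqxx mulr1n; apply.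
  apply/eqP => /(congr1 lsubmx); rewrite row_mxKl lsubmx_const.
  by move/matrixP/(_ 0 0); rewrite !mxE eqxx => /eqP; rewrite oner_eq0.
pose S := B - al^-1 *: (v^T *m v).
have SS : S^T = S.
  by rewrite /S linearB/= linearZ/= trmx_mul trmxK BE.
have Spos (u : 'rV[R]_n) : u != 0 -> 0 < qf S u.
  move=> u0; have := Qpos (row_mx (- al^-1 *: (u *m v^T)) u).
  have -> : qf (block_mx al%:M v v^T B) (row_mx (- al^-1 *: (u *m v^T)) u) = qf S u.
    rewrite tr_row_mx mul_row_block mul_row_col; congr (fun_of_matrix _ 0 0).
    rewrite mul_mx_scalar scalerA mulrN divff ?gt_eqF// scaleN1r addNr mul0mx add0r.
    rewrite /S mulmxBr -!scalemxAl -scalemxAr scaleNr addrC mulmxBl.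
    by rewrite mulmxBl -!scalemxAl !mulmxA.
  apply; apply: contra u0 => /eqP/(congr1 rsubmx).
  by rewrite row_mxKr rsubmx_const => ->.
have Nneg (u : 'rV[R]_n) : qf N u <= 0.
  have := Mneg (row_mx 0 u); rewrite tr_row_mx mul_row_block mul_row_col.
  by rewrite !(mul0mx, trmx0, mulmx0, add0r).
have Sle := IH S N SS Spos Nneg.
pose F : 'M[R]_1 :=
  row_mx al%:M v *m block_mx m m12 m21 N *m (row_mx al%:M v)^T.
have F0 : F 0 0 <= 0 by exact: Mneg.
suff -> : \tr (block_mx al%:M v v^T B *m block_mx m m12 m21 N) =
    al^-1 * F 0 0 + \tr (S *m N).
  by rewrite -[leRHS]addr0 lerD// mulr_ge0_le0// invr_ge0 ltW.
have -> : F 0 0 = \tr F by rewrite /mxtrace big_ord1.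
have EF : al^-1 *: F = al *: m + m12 *m v^T + v *m m21 + al^-1 *: (v *m N *m v^T).
  rewrite /F tr_row_mx mul_row_block mul_row_col.
  rewrite tr_scalar_mx mul_mx_scalar !mul_scalar_mx !mulmxDl -!scalemxAl !scalerDr !scalerA.
  rewrite mulVf ?gt_eqF// !scale1r.
  by rewrite mul1r addrACA !addrA.
rewrite -mxtraceZ EF mulmx_block mxtrace_block mul_scalar_mx.
rewrite /S mulmxBl -scalemxAl !mxtraceD !mxtraceZ [\tr (- _)]linearN/= mxtraceZ.
rewrite -(mulmxA v^T) (mxtrace_mulC v^T (v *m N)) (mxtrace_mulC v^T m12).
by rewrite -!addrA; congr (_ + _); rewrite addrCA; congr (_ + _); congr (_ + _);
  rewrite [RHS]addrCA addrN addr0.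
Qed.

End Trace.

(** * Euclidean geometry and the maximum principle *)

Section Euclid.
Context {R : realType} {d : nat}.
Implicit Types x y z : 'rV[R]_d.

Lemma dotC x y : dot x y = dot y x.
Proof. by apply: eq_bigr => i _; rewrite mulrC. Qed.

Lemma dotDl x y z : dot (x + y) z = dot x z + dot y z.
Proof. by rewrite /dot -big_split; apply: eq_bigr => i _; rewrite mxE mulrDl. Qed.

Lemma dotZl a x y : dot (a *: x) y = a * dot x y.
Proof. by rewrite /dot mulr_sumr; apply: eq_bigr => i _; rewrite mxE mulrA. Qed.

Lemma dotDr x y z : dot z (x + y) = dot z x + dot z y.
Proof. by rewrite dotC dotDl !(dotC z). Qed.

Lemma dotZr a x y : dot x (a *: y) = a * dot x y.
Proof. by rewrite dotC dotZl (dotC y). Qed.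

Lemma dotBl x y z : dot (x - y) z = dot x z - dot y z.
Proof. by rewrite -scaleN1r dotDl dotZl mulN1r. Qed.

Lemma dotBr x y z : dot z (x - y) = dot z x - dot z y.
Proof. by rewrite dotC dotBl !(dotC z). Qed.

Lemma dot_ge0 x : 0 <= dot x x.
Proof. by apply: sumr_ge0 => i _; rewrite -expr2 sqr_ge0. Qed.

Lemma dot_eq0 x : dot x x = 0 -> x = 0.
Proof.
move=> /eqP; rewrite psumr_eq0 => [/allP H|i _]; last by rewrite -expr2 sqr_ge0.
apply/rowP => i; rewrite mxE; apply/eqP.
by have := H i (mem_index_enum _); rewrite -expr2 sqrf_eq0.
Qed.

Lemma enorm_ge0 x : 0 <= enorm x. Proof. exact: sqrtr_ge0. Qed.

Lemma enorm2 x : enorm x ^+ 2 = dot x x.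
Proof. by rewrite /enorm sqr_sqrtr// dot_ge0. Qed.

Lemma mulmx_dot x y : (x *m y^T) 0 0 = dot x y.
Proof. by rewrite !mxE; apply: eq_bigr => i _; rewrite mxE. Qed.

Lemma dot_mxapp (M : 'M[R]_d) x : dot (mxapp M x) x = (x *m M *m x^T) 0 0.
Proof.
by rewrite dotC -mulmx_dot /mxapp trmx_mul trmxK mulmxA.
Qed.

Lemma norm_le_enorm x : `|x| <= enorm x.
Proof.
rewrite [leLHS]/Num.norm/= mx_normrE; apply/bigmax_leP; split; first exact: enorm_ge0.
move=> [i j] _ /=; rewrite ord1 -(ger0_norm (enorm_ge0 x)) -ler_sqr ?nnegrE ?normr_ge0//.
rewrite !real_normK ?num_real// enorm2 /dot (bigD1 j)//= -expr2 lerDl.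
by apply: sumr_ge0 => k _; rewrite -expr2 sqr_ge0.
Qed.

Lemma continuous_dot (T : topologicalType) (f g : T -> 'rV[R]_d) :
  continuous f -> continuous g -> continuous (fun t => dot (f t) (g t)).
Proof.
move=> cf cg; rewrite /dot.
elim: (index_enum _) => [|i r IH].
  by under eq_fun do rewrite big_nil; move=> t; exact: cvg_cst.
under eq_fun do rewrite big_cons; move=> t; apply: cvgD; last exact: IH.
apply: cvgM.
  by apply: (@continuous_comp _ _ _ f (fun M : 'rV[R]_d => M 0 i));
    [exact: cf|exact: coord_continuous].
by apply: (@continuous_comp _ _ _ g (fun M : 'rV[R]_d => M 0 i));
  [exact: cg|exact: coord_continuous].
Qed.

Lemma continuous_enorm : continuous (@enorm R d).
Proof.
move=> x; apply: (@continuous_comp _ _ _ (fun x => dot x x)).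
  by apply: continuous_dot => y; exact: cvg_id.
exact: sqrt_continuous.
Qed.

Lemma compact_enorm rho : compact [set x : 'rV[R]_d | enorm x <= rho].
Proof.
apply: bounded_closed_compact.
  exists rho; split; first exact: num_real.
  by move=> M rM x /= xr; rewrite (le_trans (norm_le_enorm x))// (le_trans xr)// ltW.
apply: (@closed_comp _ _ (@enorm R d) [set y | y <= rho]); last exact: closed_le.
by move=> x _; exact: continuous_enorm.
Qed.

Lemma tends_to_infty_ball (g : 'rV[R]_d -> R) M : tends_to_infty g ->
  exists2 rho, 0 <= rho & forall x, ~ (enorm x <= rho) -> M <= g x.
Proof.
move=> /(_ M)[rho H]; exists (Num.max 0 rho); first by rewrite le_max lexx.
move=> x /negP; rewrite -ltNge => h; apply: H.
by rewrite (le_trans _ (ltW h))// le_max lexx orbT.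
Qed.

End Euclid.

Lemma continuous_pair (T U V : topologicalType) (f : T -> U) (g : T -> V) :
  continuous f -> continuous g -> continuous (fun t => (f t, g t)).
Proof. by move=> cf cg t; exact: cvg_pair (cf t) (cg t). Qed.

Section Slab.
Context {R : realType} {d : nat}.
Implicit Types (x y : 'rV[R]_d) (u w : R -> 'rV[R]_d -> R).

Lemma continuous_clamp (s : R) u :
  {within [set z : R * 'rV[R]_d | s <= z.1], continuous (fun z => u z.1 z.2)} ->
  continuous (fun z : R * 'rV[R]_d => u (Num.max s z.1) z.2).
Proof.
move=> cu z; set A := [set z : R * 'rV[R]_d | s <= z.1] in cu.
set g := fun z : R * 'rV[R]_d => (Num.max s z.1, z.2).
have Ag p : A (g p) by rewrite /A/= le_max lexx.
have cg : {for z, continuous g}.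
  apply: continuous_pair; last by move=> p; exact: cvg_snd.
  by move=> p; apply: continuous_max; [exact: cvg_cst|exact: cvg_fst].
have /subspace_continuousP/(_ _ (Ag z)) h := cu.
move=> P /h /cg H.
change (nbhs z [set p | P (u (g p).1 (g p).2)]).
have {}H : nbhs z [set p | A (g p) -> P (u (g p).1 (g p).2)] by exact: H.
by apply: filterS H => p; exact.
Qed.

(** The regularity used on [s, +oo) x R^d. Times before s are clamped to s, so
that continuity up to the initial time is continuity of a function on the
whole space rather than on a subspace. *)
Definition slab_smooth (s : R) w : Prop :=
  [/\ continuous (fun z : R * 'rV[R]_d => w (Num.max s z.1) z.2),
      forall t x, s < t -> derivable (w^~ x) t 1 &
      forall t, s < t -> class_C2 (w t)].

Lemma is_derive_lin (V : normedModType R) k al be (f g : V -> R) (z v : V) df dg :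
  is_derive z v f df -> is_derive z v g dg ->
  is_derive z v (fun z => k * f z + al + be * g z) (k * df + be * dg).
Proof.
move=> Hf Hg; rewrite -[k * df]addr0.
exact: is_deriveD (is_deriveD (is_deriveZ k Hf) (is_derive_cst al z v))
  (is_deriveZ be Hg).
Qed.

Lemma continuous_lin (T : topologicalType) k al be (f g : T -> R) :
  continuous f -> continuous g -> continuous (fun z => k * f z + al + be * g z).
Proof.
by move=> cf cg x; apply: cvgD; [apply: cvgD; [|exact: cvg_cst]|];
  apply: cvgM; [exact: cvg_cst|exact: cf|exact: cvg_cst|exact: cg].
Qed.

Lemma partial_lin i k al be (f g : 'rV[R]_d -> R) :
  has_partials f -> has_partials g ->
  partial i (fun x => k * f x + al + be * g x) =
  (fun x => k * partial i f x + 0 + be * partial i g x).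
Proof.
move=> df dg; apply/funext => x; rewrite addr0.
have [_ E] := is_derive_lin k al be (derivableP (df i x)) (derivableP (dg i x)).
exact: E.
Qed.

Lemma class_C2_lin k al be (f g : 'rV[R]_d -> R) : class_C2 f -> class_C2 g ->
  class_C2 (fun x => k * f x + al + be * g x).
Proof.
move=> [f1 f2 cf cf1 cf2] [g1 g2 cg cg1 cg2].
have lin1 (f' g' : 'rV[R]_d -> R) al' : has_partials f' -> has_partials g' ->
    has_partials (fun x => k * f' x + al' + be * g' x).
  move=> f'1 g'1 i x.
  by have [] := is_derive_lin k al' be (derivableP (f'1 i x)) (derivableP (g'1 i x)).
split.
- exact: lin1.
- by move=> i; rewrite (partial_lin i k al be f1 g1); exact: (lin1 _ _ 0 (f2 i) (g2 i)).
- exact: continuous_lin.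
- move=> i; rewrite (partial_lin i k al be f1 g1).
  exact: continuous_lin (cf1 i) (cg1 i).
- move=> i j; rewrite (partial_lin i k al be f1 g1) (partial_lin j k 0 be (f2 i) (g2 i)).
  exact: continuous_lin (cf2 i j) (cg2 i j).
Qed.

Lemma opA_lin (Q : R -> 'M[R]_d) b t k al be (f g : 'rV[R]_d -> R) x :
  class_C2 f -> class_C2 g ->
  opA Q b t (fun x => k * f x + al + be * g x) x =
  k * opA Q b t f x + be * opA Q b t g x.
Proof.
Local Opaque partial.
move=> [f1 f2 cf cf1 cf2] [g1 g2 cg cg1 cg2].
rewrite /opA.
have -> : hessian (fun x => k * f x + al + be * g x) x =
    k *: hessian f x + be *: hessian g x.
  apply/matrixP => i j; rewrite [LHS]mxE [RHS]mxE.
  rewrite [X in _ = X + _]mxE [X in _ = _ + X]mxE [X in _ = k * X + _]mxE.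
  rewrite [X in _ = _ + be * X]mxE.
  rewrite -[RHS](addr0) addrAC.
  transitivity (partial j (fun x => k * partial i f x + 0 + be * partial i g x) x).
    by congr (partial j _ x); exact: partial_lin.
  by rewrite (partial_lin j k 0 be (f2 i) (g2 i)).
have -> : grad (fun x => k * f x + al + be * g x) x = k *: grad f x + be *: grad g x.
  by apply/rowP => i; rewrite !mxE (partial_lin i k al be f1 g1) addr0.
move: (hessian f x) (hessian g x) (grad f x) (grad g x) => F2 G2 F1 G1.
rewrite mulmxDr -!scalemxAr mxtraceD !mxtraceZ dotDr !dotZr.
by rewrite !mulrDr addrACA.
Qed.
Local Transparent partial.

Lemma slab_smooth_lin s k (al be : R -> R) u (g : 'rV[R]_d -> R) :
  slab_smooth s u -> class_C2 g ->
  (forall t, derivable al t 1) -> (forall t, derivable be t 1) ->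
  slab_smooth s (fun t x => k * u t x + al t + be t * g x).
Proof.
move=> [cu du u2] g2 dal dbe.
have cont1 (f : R -> R) : (forall t, derivable f t 1) ->
    continuous (fun z : R * 'rV[R]_d => f (Num.max s z.1)).
  move=> df z.
  apply: (@continuous_comp _ _ _ (fun z : R * 'rV[R]_d => Num.max s z.1) f).
    by apply: continuous_max; [exact: cvg_cst|exact: cvg_fst].
  exact/differentiable_continuous/derivable1_diffP.
have cg : continuous (fun z : R * 'rV[R]_d => g z.2).
  move=> z; apply: (@continuous_comp _ _ _ snd g); first exact: cvg_snd.
  by case: g2 => _ _ + _ _; exact.
split.
- move=> z; apply: cvgD; first apply: cvgD.
  + by apply: cvgM; [exact: cvg_cst|exact: cu].
  + exact: cont1.
  + by apply: cvgM; [exact: cont1|exact: cg].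
- move=> t x st; apply: derivableD; last by apply: derivableM.
  by apply: derivableD => //; apply: derivableM => //; exact: du.
- by move=> t st; exact: (class_C2_lin k (al t) (be t) (u2 t st) g2).
Qed.

Lemma derive1_lin k (al be : R -> R) u (c : R) (t : R) x :
  derivable (u^~ x) t 1 -> derivable al t 1 -> derivable be t 1 ->
  derive1 (fun t => k * u t x + al t + be t * c) t =
  k * derive1 (u^~ x) t + derive1 al t + derive1 be t * c.
Proof.
move=> /derivableP du /derivableP dal /derivableP dbe.
have := is_deriveD (is_deriveD (is_deriveZ k du) dal) (is_deriveZ c dbe).
set F := (X in is_derive _ _ X _) => -[_ E]; rewrite !derive1E [_ * c]mulrC -[RHS]E.
suff -> : (fun t => k * u t x + al t + be t * c) = F by [].
by apply/funext => r; rewrite /F [be r * c]mulrC.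
Qed.

End Slab.

Section MaxPrinciple.
Context {R : realType} {d : nat}.
Variables (s : R) (Q : R -> 'M[R]_d) (b : R -> 'rV[R]_d -> 'rV[R]_d).
Hypothesis Qsym : forall t, s < t -> (Q t)^T = Q t.
Hypothesis Qpos : forall t, s < t -> forall u, u != 0 -> 0 < dot (mxapp (Q t) u) u.

(** At a maximum the gradient vanishes and the Hessian is nonpositive. *)
Lemma opA_max_le0 t (g : 'rV[R]_d -> R) x : s < t -> class_C2 g ->
  (forall y, g y <= g x) -> opA Q b t g x <= 0.
Proof.
move=> st g2 gmax.
have line v r : g (x + r *: v) <= g (x + 0 *: v) by rewrite scale0r addr0.
have grad0 v : dot (grad g x) v = 0.
  have := is_derive_max0 (fun r => class_C2_line x v r g2) (line v).
  by rewrite scale0r addr0.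
rewrite /opA dotC grad0 addr0; apply: trace_posdef_mul_le0; first exact: Qsym.
  by move=> u u0; rewrite -dot_mxapp; exact: Qpos.
move=> v; rewrite -dot_mxapp.
have := second_derive_max (fun r => class_C2_line x v r g2)
   (class_C2_line2 x v 0 g2) (line v).
by rewrite scale0r addr0.
Qed.

(** A positive maximum over the compact cylinder would be attained after the
initial time, with nonnegative time derivative and nonpositive A(t) w: this
contradicts the strict inequality. Asking for that inequality where w is
positive allows it to come from conditions valid in a part of the space only. *)
Lemma strict_max_principle (T rho : R) (w : R -> 'rV[R]_d -> R) :
  slab_smooth s w ->
  (forall t x, s <= t <= T -> ~ enorm x <= rho -> w t x <= 0) ->
  (forall x, w s x <= 0) ->
  (forall t x, s < t <= T -> 0 < w t x ->
     derive1 (w^~ x) t < opA Q b t (w t) x) ->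
  forall t x, s <= t <= T -> w t x <= 0.
Proof.
move=> [cw dw w2] wrho ws weq t1 x1 st1; rewrite leNgt; apply/negP => w1.
pose K := `[s, T]%classic `*` [set x : 'rV[R]_d | enorm x <= rho].
have cK : compact K.
  by apply: compact_setX; [exact: segment_compact|exact: compact_enorm].
have inK t x : s <= t <= T -> 0 < w t x -> K (t, x).
  move=> st wt; split; first by rewrite /= in_itv.
  by apply: contrapT => /(wrho _ _ st); rewrite leNgt wt.
have clamp t : s <= t -> Num.max s t = t by move=> st; exact/max_idPr.
have [|[t0 x0]] := compact_EVT_max _ cK (continuous_subspaceT cw).
  by exists (t1, x1); exact: inK.
rewrite inE /= => -[/=]; rewrite in_itv/= => /[dup] st0 /andP[s0 t0T] x0rho wmax.
have {}wmax t x : s <= t <= T -> 0 < w t x -> w t x <= w t0 x0.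
  move=> st wt; have := wmax (t, x); rewrite inE => /(_ (inK _ _ st wt)) /=.
  by rewrite !clamp//; case/andP: st.
have w0 : 0 < w t0 x0 by apply: lt_le_trans (wmax _ _ st1 w1).
have {}wmax t x : s <= t <= T -> w t x <= w t0 x0.
  move=> st; have [wt|wt] := ltP 0 (w t x); first exact: wmax.
  exact: le_trans wt (ltW w0).
have st0' : s < t0.
  by rewrite lt_neqAle s0 andbT; apply/eqP => E; move: w0; rewrite -E ltNge ws.
have := weq t0 x0; rewrite st0' t0T => /(_ isT w0); rewrite ltNge => /negP; apply.
apply: (@le_trans _ _ 0).
  by apply: (opA_max_le0 st0' (w2 _ st0')) => y; exact: wmax.
rewrite derive1E; apply: (left_max_derive_ge0 st0' (derivableP (dw _ x0 st0'))).
by move=> r sr rt; apply: wmax; rewrite (ltW sr)/= (le_trans rt).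
Qed.

Variables (phi : 'rV[R]_d -> R) (a : R).
Hypothesis phi2 : class_C2 phi.
Hypothesis phi_infty : tends_to_infty phi.
Hypothesis phi_ge1 : forall x, 1 <= phi x.
Hypothesis phi_le : forall t, s < t -> forall x, opA Q b t phi x <= a.

Let pen (t : R) := (a + 1) * (t - s).

Lemma derivable_pen (k t : R) : derivable (fun t => k * pen t) t 1.
Proof.
by apply: derivableM; [exact: derivable_cst|apply: derivableM => //; exact: derivableB].
Qed.

Lemma derive1_pen (k t : R) : derive1 (fun t => k * pen t) t = k * (a + 1).
Proof.
have := is_deriveZ k (is_deriveZ (a + 1) (is_deriveB (is_derive_id t 1) (is_derive_cst s t 1))).
by rewrite subr0 derive1E => -[_ E]; rewrite -[RHS]/(k * (a + 1)) -[a + 1]mulr1 -[RHS]E.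
Qed.

(** Subtracting e (phi + (a + 1) (t - s)) makes the differential inequality
strict, because A(t) phi <= a, and makes w nonpositive outside a ball, because
phi tends to infinity; then e tends to 0. *)
Lemma max_principle (T M : R) (w : R -> 'rV[R]_d -> R) : 0 < a ->
  slab_smooth s w ->
  (forall t x, s <= t <= T -> w t x <= M) ->
  (forall x, w s x <= 0) ->
  (forall t x, s < t <= T -> 0 < w t x ->
     derive1 (w^~ x) t <= opA Q b t (w t) x) ->
  forall t x, s <= t <= T -> w t x <= 0.
Proof.
move=> a0 sw wM ws weq.
have key e : 0 < e -> forall t x, s <= t <= T ->
    w t x <= e * (phi x + pen t).
  move=> e0.
  have [rho rho0 Hrho] := tends_to_infty_ball (M / e) phi_infty.
  pose we t x := 1 * w t x + (- e * pen t) + (- e) * phi x.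
  have weE t x : we t x = w t x - e * (phi x + pen t) by rewrite /we; ring.
  suff H : forall t x, s <= t <= T -> we t x <= 0.
    by move=> t x /(H _ x); rewrite weE subr_le0.
  have pen0 t : s <= t -> 0 <= pen t.
    by move=> st; rewrite mulr_ge0// ?subr_ge0// addr_ge0// ltW.
  apply: (@strict_max_principle T rho).
  - apply: (slab_smooth_lin 1 sw phi2) => t; [exact: derivable_pen|exact: derivable_cst].
  - move=> t x st xrho; rewrite weE subr_le0.
    apply: (le_trans (wM _ x st)); have := Hrho x xrho.
    rewrite ler_pdivrMr// mulrC => h; apply: (le_trans h).
    by rewrite ler_wpM2l ?(ltW e0)// lerDl pen0//; case/andP: st.
  - move=> x; rewrite weE subr_le0; apply: (le_trans (ws x)).
    rewrite mulr_ge0 ?(ltW e0)// addr_ge0// ?pen0//.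
    by rewrite (le_trans _ (phi_ge1 x)).
  - move=> t x /[dup] st /andP[st' tT]; rewrite weE subr_gt0 => h.
    case: sw => cw dw w2.
    have wpos : 0 < w t x.
      apply: le_lt_trans h; rewrite mulr_ge0 ?(ltW e0)// addr_ge0// ?pen0//.
        by rewrite (le_trans _ (phi_ge1 x)).
      exact: ltW.
    rewrite /we (opA_lin _ _ _ _ _ _ _ (w2 _ st') phi2).
    rewrite (derive1_lin 1 (phi x) (dw _ x st') (@derivable_pen (- e) t) (@derivable_cst _ _ _ (- e) t 1)).
    have := weq _ _ st wpos; have := phi_le st' x; rewrite derive1_pen derive1_cst mul0r addr0 !mul1r.
    move=> h1 h2; apply: ler_ltD => //.
    by rewrite !mulNr ltrN2 ltr_pM2l//; lra.
move=> t x st; rewrite leNgt; apply/negP => wpos.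
have P0 : 0 < phi x + pen t.
  rewrite ltr_wpDr//; last by rewrite (lt_le_trans _ (phi_ge1 x)).
  by case/andP: st => st _; rewrite mulr_ge0// ?subr_ge0// addr_ge0// ltW.
(* With this e the bound reads w t x <= w t x / 2. *)
have := key (w t x / (2 * (phi x + pen t))); rewrite divr_gt0// ?mulr_gt0// => /(_ isT t x st).
rewrite invfM mulrA mulrVK ?unitfE ?gt_eqF//; lra.
Qed.

End MaxPrinciple.

(** * Touching inequalities in one variable *)

Section Touching.
Context {R : realType}.

(** First-order condition for a function that stays below an exponential and
touches it at 0. *)
Lemma derive_touch_exp (u u' : R -> R) (al be : R) : (forall r, is_derive r (1:R) u (u' r)) ->
  (forall r, u r <= u 0 * expR (al * r + be * (r * r))) -> u' 0 = u 0 * al.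
Proof.
move=> du H.
pose k r := u r - u 0 * expR (al * r + be * (r * r)).
have dk r : is_derive r (1:R) k
    (u' r - u 0 * (expR (al * r + be * (r * r)) * (al + be * (2 * r)))).
  have de : is_derive r (1:R) (fun r => al * r + be * (r * r)) (al + be * (2 * r)).
    have d1 := is_derive_id r (1:R).
    have := is_deriveD (is_deriveZ al d1) (is_deriveZ be (is_deriveM d1 d1)).
    move=> h; apply: (is_derive_eq h).
    change (al * 1 + be * (r * 1 + r * 1) = al + be * (2 * r)); ring.
  have := is_derive1_comp (is_derive_expR _) de.
  by move=> h; exact: is_deriveB (du r) (is_deriveZ (u 0) h).
have k0 r : k r <= k 0.
  by rewrite /k !mulr0 addr0 expR0 mulr1 subrr subr_le0.
have := is_derive_max0 dk k0.
rewrite !mulr0 !addr0 expR0 mul1r => /eqP.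
by rewrite subr_eq0 => /eqP.
Qed.

(** The same condition seen from the second factor of a maximal product. *)
Lemma derive_touch_ln (v v' : R -> R) (al be : R) : (forall r, is_derive r (1:R) v (v' r)) ->
  (forall r, 0 < v r) ->
  (forall r, ln (v 0) <= ln (v r) + (al * r + be * (r * r))) -> v' 0 = - (v 0 * al).
Proof.
move=> dv v0 H.
have := @derive_touch_exp (fun r => - v r) (fun r => - v' r) (- al) (- be).
move=> /(_ (fun r => is_deriveN (dv r))) h.
apply: oppr_inj; rewrite opprK h ?mulrNN// => r.
rewrite !mulNr lerN2 -opprD expRN -ler_pdivlMr ?invr_gt0 ?expR_gt0// invrK.
rewrite -[v 0]lnK ?posrE// -[v r]lnK ?posrE// -expRD ler_expR.
exact: H.
Qed.

(** The right-hand side is the second derivative at 0 of u(0) (v/v(0))^(1/p),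
which touches u from above. *)
Lemma derive2_touch_powR (u u' v v' : R -> R) (u'' v'' p : R) : 0 < p ->
  (forall r, is_derive r (1:R) u (u' r)) -> is_derive (0:R) (1:R) u' u'' ->
  (forall r, is_derive r (1:R) v (v' r)) -> is_derive (0:R) (1:R) v' v'' ->
  (forall r, 0 < v r) ->
  (forall r, u r <= u 0 * expR (p^-1 * (ln (v r) - ln (v 0)))) ->
  u'' <= u 0 * ((p^-1 * (v' 0 / v 0)) ^+ 2 +
    p^-1 * (v'' / v 0 - (v' 0 / v 0) ^+ 2)).
Proof.
move=> p0 du du' dv dv' v0 H.
pose e r := p^-1 * (ln (v r) - ln (v 0)).
pose e' r := p^-1 * (v' r / v r).
pose k r := u r - u 0 * expR (e r).
have de r : is_derive r (1:R) e (e' r).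
  have h := is_derive1_comp (is_derive1_ln (v0 r)) (dv r).
  have h2 := is_deriveZ p^-1 (is_deriveB h (is_derive_cst (ln (v 0)) r 1)).
  by apply: (is_derive_eq h2); rewrite subr0 /e' [_ / v r]mulrC.
have dE r : is_derive r (1:R) (fun r => expR (e r)) (expR (e r) * e' r).
  exact: is_derive1_comp (is_derive_expR _) (de r).
have dk r : is_derive r (1:R) k (u' r - u 0 * (expR (e r) * e' r)).
  by apply: is_deriveB; apply: is_deriveZ.
have de' : is_derive (0:R) (1:R) e' (p^-1 * (v'' / v 0 - (v' 0 / v 0) ^+ 2)).
  have v00 : v 0 != 0 by rewrite gt_eqF.
  have hV : is_derive (0:R) (1:R) (fun r => (v r)^-1) (- (v 0) ^- 2 *: v' 0).
    by apply: is_deriveV.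
  have := is_deriveZ p^-1 (is_deriveM dv' hV).
  move=> h; apply: (is_derive_eq h); congr (_ * _).
  change (v' 0 * (- v 0 ^- 2 * v' 0) + (v 0)^-1 * v'' = v'' / v 0 - (v' 0 / v 0) ^+ 2).
  by field.
have dk' : is_derive (0:R) (1:R) (fun r => u' r - u 0 * (expR (e r) * e' r))
    (u'' - u 0 * (expR (e 0) * (p^-1 * (v'' / v 0 - (v' 0 / v 0) ^+ 2))
      + e' 0 * (expR (e 0) * e' 0))).
  apply: is_deriveB; apply: is_deriveZ; exact: is_deriveM.
have e0 : e 0 = 0 by rewrite /e subrr mulr0.
have kmax r : k r <= k 0 by rewrite /k e0 expR0 mulr1 subrr subr_le0.
have := second_derive_max dk dk' kmax.
rewrite e0 expR0 !mul1r subr_le0 => /le_trans; apply.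
by rewrite le_eqVlt; apply/orP; left; apply/eqP; rewrite /e'; ring.
Qed.

End Touching.

(** * A Harnack inequality by doubling of the space variable *)

(** Besides boundedness, only what the comparison arguments use: plain
continuity takes the place of Hoelder conditions, so the class is stable under
linear combinations without estimates. *)
Definition bounded_solution {R : realType} {d : nat} (s : R) (Q : R -> 'M[R]_d)
    (b : R -> 'rV[R]_d -> 'rV[R]_d) (u : R -> 'rV[R]_d -> R) : Prop :=
  [/\ slab_smooth s u,
      forall t x, s < t -> derive1 (u^~ x) t = opA Q b t (u t) x &
      exists M : R, forall t x, s <= t -> `|u t x| <= M].

Lemma slab_smooth_slice (R : realType) d (s : R) (w : R -> 'rV[R]_d -> R) :
  slab_smooth s w -> continuous (w s).
Proof.
move=> [cw _ _] z.
rewrite [X in continuous_at z X](_ : w s = (fun z : R * 'rV[R]_d => w (Num.max s z.1) z.2)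
  \o (fun x => (s, x))); last by apply/funext => x /=; rewrite maxxx.
apply: continuous_comp; last exact: cw.
have h : continuous (fun x : 'rV[R]_d => (s, x)).
  by apply: continuous_pair; [exact: cst_continuous|move=> ?; exact: cvg_id].
exact: h.
Qed.

Lemma dot_line (R : realType) d (z v : 'rV[R]_d) (r : R) :
  dot (z + r *: v) (z + r *: v) - dot z z = 2 * dot z v * r + dot v v * (r * r).
Proof. rewrite dotDl !dotDr !dotZl !dotZr (dotC v z); ring. Qed.

Lemma dotNr (R : realType) d (z v : 'rV[R]_d) : dot z (- v) = - dot z v.
Proof. by rewrite -scaleN1r dotZr mulN1r. Qed.

Lemma ler_pMexpR (R : realType) (a e : R) : 0 < a -> (a <= a * expR e) = (0 <= e).
Proof. by move=> a0; rewrite -{1}[a]mulr1 ler_pM2l// -expR0 ler_expR. Qed.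

Section Harnack.
Context {R : realType} {d : nat}.
Variables (s : R) (Q : R -> 'M[R]_d) (b : R -> 'rV[R]_d -> 'rV[R]_d).
Variables (eta0 p : R).
Hypothesis Qsym : forall t, s < t -> (Q t)^T = Q t.
Hypothesis eta0_gt0 : 0 < eta0.
Hypothesis Qell : forall t, s < t -> forall v : 'rV[R]_d,
  eta0 * dot v v <= dot (mxapp (Q t) v) v.
Hypothesis bmono : forall t, s < t -> forall x y : 'rV[R]_d,
  dot (x - y) (b t x - b t y) <= 0.
Hypothesis p_gt1 : 1 < p.

Lemma elliptic_posdef t : s < t -> forall v : 'rV[R]_d, v != 0 ->
  0 < dot (mxapp (Q t) v) v.
Proof.
move=> st v v0; apply: lt_le_trans (Qell st v).
rewrite mulr_gt0// lt_neqAle dot_ge0 andbT eq_sym.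
by apply: contra v0 => /eqP/dot_eq0/eqP.
Qed.

Let kappa := (1 - p^-1) * eta0.

Lemma kappa_gt0 : 0 < kappa.
Proof. by rewrite mulr_gt0// subr_gt0 invf_lt1// (lt_trans ltr01). Qed.

(** The solution of c' = - 4 kappa c^2 with c(s) = 1/eta. *)
Let c (eta t : R) := (4 * kappa * (t - s) + eta)^-1.

Let p_gt0 : 0 < p. Proof. exact: lt_trans p_gt1. Qed.

Lemma c_gt0 eta t : 0 < eta -> s <= t -> 0 < c eta t.
Proof.
move=> e0 st; rewrite invr_gt0 ltr_wpDl// mulr_ge0 ?subr_ge0// mulr_ge0//.
exact: ltW kappa_gt0.
Qed.

Lemma is_derive_c eta t : 0 < eta -> s <= t ->
  is_derive t (1:R) (c eta) (- (4 * kappa * c eta t ^+ 2)).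
Proof.
move=> e0 st; have := c_gt0 e0 st; rewrite invr_gt0 => c0.
pose g t := 4 * kappa * (t - s) + eta.
have dg : is_derive t (1:R) g (4 * kappa).
  have := is_deriveD (is_deriveZ (4 * kappa) (is_deriveB (is_derive_id t (1:R))
    (is_derive_cst s t (1:R)))) (is_derive_cst eta t (1:R)).
  by rewrite subr0 addr0 => h; apply: (is_derive_eq h); exact: mulr1.
have gt0 : g t != 0 by rewrite gt_eqF.
apply: (is_derive_eq (is_deriveV gt0 dg)).
change (- g t ^- 2 * (4 * kappa) = - (4 * kappa * ((g t)^-1) ^+ 2)).
by rewrite exprVn; ring.
Qed.

Lemma coupled_algebra (u v0 c0 TU TV QZ bx by' Z : R) :
  0 < u -> 0 < v0 -> 0 <= c0 ->
  p / u * TU - v0^-1 * TV + (1 - p^-1) * (2 * c0) ^+ 2 * QZ <= 0 ->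
  eta0 * Z <= QZ -> bx - by' <= 0 ->
  p * ((TU + u * (p^-1 * c0 * 2 * bx)) / u) - (TV + v0 * (c0 * 2 * by')) / v0 <=
  - (4 * kappa * c0 ^+ 2) * Z.
Proof.
move=> Ux Vy c00 T0 Qz bz.
have p0 : p != 0 by rewrite gt_eqF.
have U0 : u != 0 by rewrite gt_eqF.
have V0 : v0 != 0 by rewrite gt_eqF.
have -> : p * ((TU + u * (p^-1 * c0 * 2 * bx)) / u) - (TV + v0 * (c0 * 2 * by')) / v0
   = (p / u * TU - v0^-1 * TV) + 2 * c0 * (bx - by').
  by field; rewrite U0 V0 p0.
have k1 : 0 <= (1 - p^-1) * (2 * c0) ^+ 2.
  by rewrite mulr_ge0 ?sqr_ge0// subr_ge0 invf_le1// ltW.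
have h1 : (1 - p^-1) * (2 * c0) ^+ 2 * (eta0 * Z) <= (1 - p^-1) * (2 * c0) ^+ 2 * QZ.
  by rewrite ler_wpM2l.
have h2 : 2 * c0 * (bx - by') <= 0 by rewrite mulr_ge0_le0// mulr_ge0.
have -> : - (4 * kappa * c0 ^+ 2) * Z = - ((1 - p^-1) * (2 * c0) ^+ 2 * (eta0 * Z)).
  by rewrite /kappa; ring.
lra.
Qed.

(** The quadratic form p/u hU - hV/v0 + (1 - 1/p) (2 c0)^2 z z^T is
nonpositive: this is the hypothesis with the squares of <z,v> collected. Its
trace against Q is therefore nonpositive as well. *)
Lemma coupled_trace t (hU hV : 'M[R]_d) (u v0 c0 : R) (z : 'rV[R]_d) :
  s < t -> 0 < u -> 0 < v0 ->
  (forall v, dot (mxapp hU v) v <= u * ((p^-1 * (c0 * 2 * dot z v)) ^+ 2 +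
      p^-1 * (dot (mxapp hV v) v / v0 - (c0 * 2 * dot z v) ^+ 2))) ->
  p / u * \tr (Q t *m hU) - v0^-1 * \tr (Q t *m hV)
   + (1 - p^-1) * (2 * c0) ^+ 2 * dot (mxapp (Q t) z) z <= 0.
Proof.
move=> st Ux Vy hUV.
have p0 : p != 0 by rewrite gt_eqF.
have U0 : u != 0 by rewrite gt_eqF.
have V0 : v0 != 0 by rewrite gt_eqF.
(* The form of which the trace against Q is to be bounded. *)
pose M : 'M[R]_d := (p / u) *: hU - (v0)^-1 *: hV +
  ((1 - p^-1) * (2 * c0) ^+ 2) *: (z^T *m z).
have Mle (v : 'rV[R]_d) : (v *m M *m v^T) 0 0 <= 0.
  have -> : (v *m M *m v^T) 0 0 = p / u * dot (mxapp hU v) v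
      - v0^-1 * dot (mxapp hV v) v + (1 - p^-1) * (2 * c0) ^+ 2 * dot z v ^+ 2.
    have -> : dot z v ^+ 2 = (v *m (z^T *m z) *m v^T) 0 0.
      by rewrite mulmxA -mulmxA mxE big_ord1 !mulmx_dot dotC -expr2.
    rewrite !dot_mxapp /M !mulmxDr !mulmxDl mulmxN mulNmx -!scalemxAr -!scalemxAl.
    move: (v *m hU *m v^T) (v *m hV *m v^T) (v *m (z^T *m z) *m v^T) => A B C.
    by rewrite !mxE.
  have := hUV v; move: (dot (mxapp hU v) v) (dot (mxapp hV v) v).
  move=> hU' hV'; rewrite -ler_pdivrMl// => h.
  have : p * (u^-1 * hU') <= p * ((p^-1 * (c0 * 2 * dot z v)) ^+ 2 + p^-1 * (hV' / v0 - (c0 * 2 * dot z v) ^+ 2)).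
    by rewrite ler_pM2l.
  have -> : p * ((p^-1 * (c0 * 2 * dot z v)) ^+ 2 + p^-1 * (hV' / v0 - (c0 * 2 * dot z v) ^+ 2)) =
     hV' / v0 - (1 - p^-1) * (2 * c0) ^+ 2 * dot z v ^+ 2.
    by field; rewrite p0.
  rewrite mulrA (mulrC v0^-1); lra.
have trM : \tr (Q t *m M) <= 0.
  apply: (trace_posdef_mul_le0 (Qsym st)) Mle => w w0.
  by rewrite -dot_mxapp; exact: elliptic_posdef.
have trME : \tr (Q t *m M) = p / u * \tr (Q t *m hU)
   - (v0)^-1 * \tr (Q t *m hV)
   + (1 - p^-1) * (2 * c0) ^+ 2 * dot (mxapp (Q t) z) z.
  rewrite /M.
  rewrite !mulmxDr mulmxN -!scalemxAr !mxtraceD [\tr (- _)]linearN/= !mxtraceZ.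
  congr (_ + _ * _); rewrite mxtrace_mulC -mulmxA mxtrace_mulC dot_mxapp.
  by rewrite /mxtrace big_ord1.
by rewrite -trME.
Qed.

(** The hypothesis says that U(x') V(y')^(-1/p) exp(- c0 |x'-y'|^2 / p) is
maximal at (x,y). Varying x' and y' separately gives both gradients as
multiples of z = x - y. Moving both points by the same vector leaves
|x'-y'|^2 unchanged, so the second-order condition compares the two Hessians
alone. What remains is the square of the gradient of ln V, which produces the
negative multiple of <Q z, z>, and the drifts, which enter through
<z, b(x) - b(y)> <= 0. *)
Lemma coupled_generator_le t (U V : 'rV[R]_d -> R) x y (c0 : R) :
  s < t -> 0 <= c0 -> class_C2 U -> class_C2 V -> (forall z, 0 < V z) -> 0 < U x ->
  (forall x' y', U x' <= U x *
    expR (p^-1 * (ln (V y') - ln (V y) + c0 * (dot (x' - y') (x' - y')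
      - dot (x - y) (x - y))))) ->
  p * (opA Q b t U x / U x) - opA Q b t V y / V y <=
  - (4 * kappa * c0 ^+ 2) * dot (x - y) (x - y).
Proof.
move=> st c00 U2 V2 Vpos Ux H.
set z := x - y.
have gU v : dot (grad U x) v = U x * (p^-1 * c0 * 2 * dot z v).
  have := @derive_touch_exp _ (fun r => U (x + r *: v))
    (fun r => dot (grad U (x + r *: v)) v) (p^-1 * c0 * 2 * dot z v) (p^-1 * c0 * dot v v)
    (fun r => class_C2_line x v r U2).
  rewrite scale0r addr0; apply => r.
  have := H (x + r *: v) y; rewrite subrr add0r addrAC -/z dot_line.
  by congr (_ <= _ * expR _); ring.
have gV v : dot (grad V y) v = V y * (c0 * 2 * dot z v).
  have := @derive_touch_ln _ (fun r => V (y + r *: v))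
    (fun r => dot (grad V (y + r *: v)) v) (c0 * 2 * - dot z v) (c0 * dot v v)
    (fun r => class_C2_line y v r V2) (fun r => Vpos _).
  rewrite scale0r addr0 => ->; first by ring.
  move=> r; have := H x (y + r *: v).
  rewrite ler_pMexpR// pmulr_rge0 ?invr_gt0//.
  have -> : x - (y + r *: v) = z + r *: (- v) by rewrite opprD scalerN addrA.
  rewrite dot_line !dotNr (dotC (- v)) dotNr.
  lra.
have hUV v : dot (mxapp (hessian U x) v) v <=
    U x * ((p^-1 * (c0 * 2 * dot z v)) ^+ 2 +
      p^-1 * (dot (mxapp (hessian V y) v) v / V y - (c0 * 2 * dot z v) ^+ 2)).
  have dU := class_C2_line2 x v 0 U2; have dV := class_C2_line2 y v 0 V2.
  have := derive2_touch_powR p_gt0 (fun r => class_C2_line x v r U2) dU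
    (fun r => class_C2_line y v r V2) dV (fun r => Vpos _).
  rewrite !scale0r !addr0 gV [V y * _]mulrC mulfK ?gt_eqF//; apply => r.
  have := H (x + r *: v) (y + r *: v).
  by rewrite opprD addrACA subrr addr0 subrr mulr0 addr0.
have p0 : p != 0 by rewrite gt_eqF.
have U0 : U x != 0 by rewrite gt_eqF.
have V0 : V y != 0 by rewrite gt_eqF.
have T0 := coupled_trace st Ux (Vpos y) hUV.
have bz := bmono st x y; rewrite -/z dotBr in bz.
rewrite /opA ![dot (b t _) _]dotC gU gV.
have Qz := Qell st z.
exact: (coupled_algebra Ux (Vpos y) c00 T0 Qz bz).
Qed.

(** The contradiction at a touching point. Maximality in time gives
p UT/u >= VT/v - KZ Z, where - KZ Z is the contribution of c'; the generators
and the strict inequalities give p UT/u < VT/v - KZ Z. *)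
Lemma touching_algebra (u v UT VT AU AV KZ Z : R) : 0 < u -> 0 < v ->
  UT < AU -> AV < VT -> p * (AU / u) - AV / v <= - KZ * Z ->
  0 <= UT - u * (p^-1 * (VT / v - KZ * Z)) -> False.
Proof.
move=> u0 v0 hU hV gen; rewrite leNgt => /negP; apply; rewrite subr_lt0.
apply: (lt_le_trans hU); rewrite -ler_pdivrMl// ler_pdivlMl// [_^-1 * AU]mulrC.
suff : AV / v <= VT / v by move: gen; rewrite mulNr; lra.
by rewrite ler_pM2r ?invr_gt0// ltW.
Qed.

(** Doubling of variables for strict sub- and supersolutions. The conditions
outside the ball of radius rho confine the maximum of
U(t,x) V(t,y)^(-1/p) exp(- c |x-y|^2 / p) to a compact set. *)
Lemma harnack_strict (T rho M eta : R) (U V : R -> 'rV[R]_d -> R) : 0 < eta ->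
  slab_smooth s U -> slab_smooth s V ->
  (forall t x, s < t -> derive1 (U^~ x) t < opA Q b t (U t) x) ->
  (forall t x, s < t -> opA Q b t (V t) x < derive1 (V^~ x) t) ->
  (forall t y, s <= t -> 0 < V t y) ->
  (forall t x, s <= t -> ~ enorm x <= rho -> U t x <= 0) ->
  0 < M -> (forall t x, s <= t -> U t x <= M) ->
  (forall t y, s <= t -> ~ enorm y <= rho -> p * ln M <= ln (V t y)) ->
  (forall x y, 0 < U s x ->
     p * ln (U s x) <= ln (V s y) + eta^-1 * dot (x - y) (x - y)) ->
  forall t x y, s <= t <= T -> 0 < U t x ->
     p * ln (U t x) <= ln (V t y) + c eta t * dot (x - y) (x - y).
Proof.
move=> e0 [cU dU U2] [cV dV V2] eqU eqV Vpos Uout M0 UM Vout init t1 x1 y1 st1 U1.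
pose E t x y := p^-1 * (ln (V t y) + c eta t * dot (x - y) (x - y)).
pose H t x y := U t x * expR (- E t x y).
have HE t x y : 0 < U t x ->
    (p * ln (U t x) <= ln (V t y) + c eta t * dot (x - y) (x - y)) = (H t x y <= 1).
  move=> Ut; rewrite -ler_pdivlMl// /H expRN ler_pdivrMr ?expR_gt0// mul1r.
  by rewrite -ler_expR lnK.
rewrite HE// leNgt; apply/negP => H1.
pose B := [set x : 'rV[R]_d | enorm x <= rho].
pose K := (`[s, T]%classic `*` B) `*` B.
have cK : compact K.
  by apply: compact_setX; [apply: compact_setX; [exact: segment_compact|]|];
    exact: compact_enorm.
have HU t x y : 1 < H t x y -> 0 < U t x.
  move=> h; have : 0 < H t x y by rewrite (lt_trans _ h).
  by rewrite /H pmulr_lgt0// expR_gt0.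
have inK t x y : s <= t <= T -> 1 < H t x y -> K (t, x, y).
  move=> /[dup] stT /andP[st _] h; have Ut := HU _ _ _ h.
  split; first split; first by rewrite /= in_itv.
    by apply: contrapT => /(Uout _ _ st); rewrite leNgt Ut.
  apply: contrapT => /(Vout _ _ st) hy; move: h; rewrite ltNge -HE// => /negP; apply.
  apply: (le_trans _ (le_trans hy _)).
    by rewrite ler_pM2l// ler_ln ?posrE// UM.
  by rewrite lerDl mulr_ge0 ?dot_ge0// ltW// c_gt0.
have smax r : s <= Num.max s r by rewrite le_max lexx.
have cont : continuous (fun z : (R * 'rV[R]_d) * 'rV[R]_d => H (Num.max s z.1.1) z.1.2 z.2).
  have c11 : continuous (fun z : (R * 'rV[R]_d) * 'rV[R]_d => z.1.1).
    move=> z; apply: (@continuous_comp _ _ _ fst fst); exact: cvg_fst.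
  have c12 : continuous (fun z : (R * 'rV[R]_d) * 'rV[R]_d => z.1.2).
    by move=> z; apply: (@continuous_comp _ _ _ fst snd); [exact: cvg_fst|exact: cvg_snd].
  have c2 : continuous (fun z : (R * 'rV[R]_d) * 'rV[R]_d => z.2).
    by move=> z; exact: cvg_snd.
  have cc : continuous (fun z : (R * 'rV[R]_d) * 'rV[R]_d => c eta (Num.max s z.1.1)).
    move=> z; apply: (@continuous_comp _ _ _ (fun z => Num.max s z.1.1) (c eta)).
      by apply: continuous_max; [exact: cvg_cst|exact: c11].
    apply/differentiable_continuous/derivable1_diffP.
    exact: (@ex_derive _ _ _ _ _ _ _ (is_derive_c e0 (smax z.1.1))).
  have cd : continuous (fun z : (R * 'rV[R]_d) * 'rV[R]_d => dot (z.1.2 - z.2) (z.1.2 - z.2)).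
    have cB : continuous (fun z : (R * 'rV[R]_d) * 'rV[R]_d => z.1.2 - z.2).
      by move=> z; apply: cvgB; [exact: c12|exact: c2].
    exact: continuous_dot.
  have cl : continuous (fun z : (R * 'rV[R]_d) * 'rV[R]_d => ln (V (Num.max s z.1.1) z.2)).
    move=> z; apply: (@continuous_comp _ _ _ (fun z => V (Num.max s z.1.1) z.2) (@ln R)).
      apply: (@continuous_comp _ _ _ (fun z : (R * 'rV[R]_d) * 'rV[R]_d => (z.1.1, z.2)) (fun z => V (Num.max s z.1) z.2)).
        by apply: continuous_pair; [exact: c11|exact: c2].
      exact: cV.
    by apply: continuous_ln; exact: Vpos.
  move=> z; apply: cvgM.
    apply: (@continuous_comp _ _ _ fst (fun z => U (Num.max s z.1) z.2)); first exact: cvg_fst.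
    exact: cU.
  apply: (@continuous_comp _ _ _ (fun z => - E (Num.max s z.1.1) z.1.2 z.2) expR); last exact: continuous_expR.
  apply: cvgN; apply: cvgM; first exact: cvg_cst.
  by apply: cvgD; [exact: cl|apply: cvgM; [exact: cc|exact: cd]].
have clamp t : s <= t -> Num.max s t = t by move=> st; exact/max_idPr.
have [|[[t0 x0] y0]] := compact_EVT_max _ cK (continuous_subspaceT cont).
  by exists (t1, x1, y1); exact: inK.
rewrite inE /= => -[[/=]]; rewrite in_itv/= => /[dup] st0 /andP[s0 t0T] x0rho y0rho Hmax.
have {}Hmax t x y : s <= t <= T -> 1 < H t x y -> H t x y <= H t0 x0 y0.
  move=> st wt; have := Hmax (t, x, y); rewrite inE => /(_ (inK _ _ _ st wt)) /=.
  by rewrite !clamp//; case/andP: st.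
have H0 : 1 < H t0 x0 y0 by apply: lt_le_trans (Hmax _ _ _ st1 H1).
have {}Hmax t x y : s <= t <= T -> H t x y <= H t0 x0 y0.
  move=> st; have [wt|wt] := ltP 1 (H t x y); first exact: Hmax.
  exact: le_trans wt (ltW H0).
have U0 := HU _ _ _ H0.
have cs : c eta s = eta^-1 by rewrite /c subrr mulr0 add0r.
have st0' : s < t0.
  rewrite lt_neqAle s0 andbT; apply/eqP => Et; move: H0; rewrite ltNge -HE// -Et.
  by rewrite cs init// Et.
have touch t x y : s <= t <= T ->
    U t x <= U t0 x0 * expR (E t x y - E t0 x0 y0).
  move=> st; have := Hmax t x y st; rewrite /H -ler_pdivlMr ?expR_gt0//.
  by rewrite -expRN opprK -mulrA -expRD addrC.
have gen : p * (opA Q b t0 (U t0) x0 / U t0 x0) - opA Q b t0 (V t0) y0 / V t0 y0 <=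
    - (4 * kappa * c eta t0 ^+ 2) * dot (x0 - y0) (x0 - y0).
  apply: (coupled_generator_le st0' (ltW (c_gt0 e0 s0)) (U2 _ st0') (V2 _ st0') (fun z => Vpos _ z s0) U0).
  move=> x' y'; apply: (le_trans (touch t0 x' y' st0)).
  rewrite ler_pM2l// ler_expR le_eqVlt; apply/orP; left; apply/eqP.
  by rewrite /E -mulrBr opprD addrACA -mulrBr.
pose f t := U t x0 - U t0 x0 * expR (E t x0 y0 - E t0 x0 y0).
have dE : is_derive t0 (1:R) (fun t => E t x0 y0 - E t0 x0 y0)
    (p^-1 * (derive1 (V^~ y0) t0 / V t0 y0 - (4 * kappa * c eta t0 ^+ 2) * dot (x0 - y0) (x0 - y0))).
  have dV0 := derivableP (dV _ y0 st0').
  have dl := is_derive1_comp (is_derive1_ln (Vpos _ y0 s0)) dV0.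
  have dc := is_deriveZ (dot (x0 - y0) (x0 - y0)) (is_derive_c e0 s0).
  have := is_deriveB (is_deriveZ p^-1 (is_deriveD dl dc)) (is_derive_cst (E t0 x0 y0) t0 (1:R)).
  set F := (X in is_derive _ _ X _).
  have -> : F = (fun t => E t x0 y0 - E t0 x0 y0).
    by apply/funext => t; rewrite /F /E; congr (_ * (_ + _) - _); exact: mulrC.
  move=> h; apply: (is_derive_eq h); rewrite subr0 -derive1E.
  change (p^-1 * ((V t0 y0)^-1 * derive1 (V^~ y0) t0 + dot (x0 - y0) (x0 - y0) * - (4 * kappa * c eta t0 ^+ 2)) =
    p^-1 * (derive1 (V^~ y0) t0 / V t0 y0 - 4 * kappa * c eta t0 ^+ 2 * dot (x0 - y0) (x0 - y0))).
  by rewrite mulrN [X in _ * (X - _) = _]mulrC [X in _ * (_ - X) = _]mulrC.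
have df := is_deriveB (derivableP (dU _ x0 st0'))
  (is_deriveZ (U t0 x0) (is_derive1_comp (is_derive_expR _) dE)).
have f0 : f t0 = 0 by rewrite /f subrr expR0 mulr1 subrr.
have hT : 0 <= derive1 (U^~ x0) t0 - U t0 x0 * (p^-1 * (derive1 (V^~ y0) t0 / V t0 y0
    - (4 * kappa * c eta t0 ^+ 2) * dot (x0 - y0) (x0 - y0))).
  apply: (@left_max_derive_ge0 _ f _ _ _ st0'); last first.
    move=> r sr rt; rewrite f0 subr_le0; apply: touch.
    by rewrite (ltW sr)/= (le_trans rt).
  by apply: (is_derive_eq df); rewrite subrr expR0 mul1r !derive1E.
exact: (touching_algebra U0 (Vpos _ y0 s0) (eqU _ x0 st0') (eqV _ y0 st0') gen hT).
Qed.

Variables (phi : 'rV[R]_d -> R) (a : R).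
Hypothesis phi2 : class_C2 phi.
Hypothesis phi_infty : tends_to_infty phi.
Hypothesis phi_ge1 : forall x, 1 <= phi x.
Hypothesis phi_le : forall t, s < t -> forall x, opA Q b t phi x <= a.
Hypothesis a_gt0 : 0 < a.

(** Strict inequality on the diagonal gives the inequality off the diagonal
once the penalty 1/eta is large: pairs (x,y) that violate it without penalty
form a compact set disjoint from the diagonal, so |x-y|^2 has there a positive
minimum. *)
Lemma initial_separation (rho M e : R) (f V0 : 'rV[R]_d -> R) : 0 < e -> 0 < M ->
  continuous f -> continuous V0 -> (forall y, e <= V0 y) -> (forall x, f x <= M) ->
  (forall x, ~ enorm x <= rho -> f x <= 0) ->
  (forall y, ~ enorm y <= rho -> p * ln M <= ln (V0 y)) ->
  (forall x, 0 < f x -> p * ln (f x) < ln (V0 x)) ->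
  exists2 eta, 0 < eta & forall x y, 0 < f x ->
    p * ln (f x) <= ln (V0 y) + eta^-1 * dot (x - y) (x - y).
Proof.
move=> e0 M0 cf cV Ve fM fout Vout diag.
have Vpos y : 0 < V0 y by apply: lt_le_trans (Ve y).
pose D (z : 'rV[R]_d * 'rV[R]_d) := f z.1 - expR (p^-1 * ln (V0 z.2)).
have cD : continuous D.
  move=> z; apply: cvgB.
    by apply: (@continuous_comp _ _ _ fst f); [exact: cvg_fst|exact: cf].
  apply: (@continuous_comp _ _ _ (fun z => p^-1 * ln (V0 z.2)) expR); last exact: continuous_expR.
  apply: cvgM; first exact: cvg_cst.
  apply: (@continuous_comp _ _ _ (fun z => V0 z.2) (@ln R)); last exact: continuous_ln.
  by apply: (@continuous_comp _ _ _ snd V0); [exact: cvg_snd|exact: cV].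
have DE x y : 0 < f x -> (D (x, y) <= 0) = (p * ln (f x) <= ln (V0 y)).
  by move=> fx; rewrite /D/= subr_le0 -ler_pdivlMl// -[in LHS](lnK fx) ler_expR.
pose B := [set x : 'rV[R]_d | enorm x <= rho].
pose S := (B `*` B) `&` D @^-1` [set r | 0 <= r].
have cS : compact S.
  apply: (@compact_closedI _ (B `*` B)); first by apply: compact_setX; exact: compact_enorm.
  by apply: closed_comp => [z _|]; [exact: cD|exact: closed_ge].
have inS x y : 0 < f x -> ~~ (p * ln (f x) <= ln (V0 y)) -> S (x, y).
  move=> fx; rewrite -DE// -ltNge => Dxy; split; last exact: ltW.
  split => /=.
    by apply: contrapT => /fout; rewrite leNgt fx.
  apply: contrapT => /Vout hy; move: Dxy; rewrite ltNge DE// => /negP; apply.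
  by apply: le_trans hy; rewrite ler_pM2l// ler_ln ?posrE// fM.
(* Without violating pairs any eta will do. *)
have [S0|/set0P/negP] := pselect (S !=set0); last first.
  move=> /negPn/eqP S0; exists 1 => // x y fx.
  rewrite invr1 mul1r; apply: (@le_trans _ _ (ln (V0 y))); last by rewrite lerDl dot_ge0.
  by apply/negPn/negP => /(inS _ _ fx); rewrite S0.
have cd : continuous (fun z : 'rV[R]_d * 'rV[R]_d => dot (z.1 - z.2) (z.1 - z.2)).
  have cB : continuous (fun z : 'rV[R]_d * 'rV[R]_d => z.1 - z.2).
    by move=> z; apply: cvgB; [exact: cvg_fst|exact: cvg_snd].
  exact: continuous_dot.
have [[x0 y0]] := compact_EVT_min S0 cS (continuous_subspaceT cd).
rewrite inE => -[_ /= D0] mmin.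
set m := dot (x0 - y0) (x0 - y0) in mmin.
have m0 : 0 < m.
  rewrite lt_neqAle dot_ge0 andbT eq_sym; apply/eqP => /dot_eq0/eqP.
  rewrite subr_eq0 => /eqP xy; move: D0; rewrite xy leNgt => /negP; apply.
  have [fy|fy] := ltP 0 (f y0); last by rewrite /D subr_lt0 (le_lt_trans fy)// expR_gt0.
  by rewrite /D/= subr_lt0 -[ltLHS](lnK fy) ltr_expR ltr_pdivlMl// diag.
(* ln (V0 y) >= ln e and p ln (f x) <= p ln M, so a penalty of at least k
   settles every pair. *)
pose k := `|p * ln M - ln e| + 1.
have k0 : 0 < k by rewrite ltr_wpDl.
exists (m / k); first by rewrite divr_gt0.
move=> x y fx; apply/negPn/negP => h.
have xyS : S (x, y).
  apply: (inS _ _ fx); apply: contra h => h; apply: (le_trans h).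
  by rewrite lerDl mulr_ge0 ?dot_ge0// invr_ge0 divr_ge0// ltW.
move/negP: h; apply.
have mxy : m <= dot (x - y) (x - y) by have := mmin (x, y); rewrite inE; exact.
apply: (@le_trans _ _ (ln e + k)).
  apply: (@le_trans _ _ (p * ln M)); first by rewrite ler_pM2l// ler_ln ?posrE.
  by rewrite -lerBlDl (le_trans (ler_norm _))// lerDl.
apply: lerD; first by rewrite ler_ln ?posrE.
by rewrite invf_div mulrAC -[leLHS]mulr1 -mulrA ler_pM2l// ler_pdivlMr// mul1r.
Qed.

Let pen (t : R) := (a + 1) * (t - s).

Let pen_ge0 t : s <= t -> 0 <= pen t.
Proof. by move=> st; rewrite mulr_ge0// ?subr_ge0// addr_ge0// ltW. Qed.

Lemma solution_ge0 v : bounded_solution s Q b v -> (forall x, 0 <= v s x) ->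
  forall t x, s <= t -> 0 <= v t x.
Proof.
move=> [sv ev [M vM]] v0 t x st.
pose w t x := (-1) * v t x + 0 + 0 * phi x.
have wE r y : w r y = - v r y by rewrite /w mulN1r mul0r !addr0.
suff : w t x <= 0 by rewrite wE oppr_le0.
apply: (@max_principle _ _ s Q b Qsym elliptic_posdef phi a phi2 phi_infty phi_ge1 phi_le t M w a_gt0).
- by apply: (slab_smooth_lin (-1) sv phi2) => r; exact: derivable_cst.
- by move=> r y /andP[sr _]; rewrite wE lerNl (le_trans _ (lerNnormlW (vM r y sr))).
- by move=> y; rewrite wE oppr_le0.
- move=> r y /andP[sr rt] _.
  case: sv => _ dv v2.
  rewrite /w (opA_lin _ _ _ _ _ _ _ (v2 _ sr) phi2).
  rewrite (@derive1_lin _ _ (-1) (cst 0) (cst 0) _ _ _ _ (dv _ y sr) (derivable_cst _ _ _) (derivable_cst _ _ _)).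
  by rewrite !derive1_cst !mul0r !addr0 ev.
- by rewrite st lexx.
Qed.

(** Adding a multiple of phi + (a + 1) (t - s) turns a solution into a strict
sub- or supersolution, according to the sign of the multiple. *)
Lemma penalize k (u : R -> 'rV[R]_d -> R) : bounded_solution s Q b u ->
  let U := fun t x => 1 * u t x + k * pen t + k * phi x in
  [/\ slab_smooth s U,
    forall t x, U t x = u t x + k * (phi x + pen t) &
    forall t x, s < t -> derive1 (U^~ x) t - opA Q b t (U t) x =
      k * (a + 1 - opA Q b t phi x)].
Proof.
move=> [su eu _] U.
have dp t : derivable (fun t => k * pen t) t 1 by exact: derivable_pen.
split.
- by apply: (slab_smooth_lin 1 su phi2) => // t; exact: derivable_cst.
- by move=> t x; rewrite /U; ring.
- move=> t x st; case: su => _ du u2.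
  rewrite /U (opA_lin _ _ _ _ _ _ _ (u2 _ st) phi2).
  rewrite (derive1_lin 1 (phi x) (du _ x st) (dp t) (@derivable_cst _ _ _ k t 1)).
  by rewrite derive1_pen derive1_cst eu//; ring.
Qed.

(** The penalized u is negative and the penalized v large far away, and they
satisfy strict inequalities, initially and in the interior; so
[harnack_strict] applies with some eta > 0, and
c(t) <= 1 / (4 kappa (t - s)) whatever eta is. *)
Lemma harnack_penalized (u v : R -> 'rV[R]_d -> R) (e : R) : 0 < e ->
  bounded_solution s Q b u -> bounded_solution s Q b v ->
  (forall x, `|u s x| `^ p <= v s x) ->
  forall t x y, s < t -> 0 < u t x - e * (phi x + pen t) ->
    p * ln (u t x - e * (phi x + pen t)) <=
    ln (v t y + e * (phi y + pen t)) + (4 * kappa * (t - s))^-1 * dot (x - y) (x - y).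
Proof.
move=> e0 su sv uv t x y st.
have v_ge0 : forall t x, s <= t -> 0 <= v t x.
  by apply: solution_ge0 => // z; apply: le_trans (uv z); exact: powR_ge0.
pose U t x := 1 * u t x + (- e) * pen t + (- e) * phi x.
have [sU UE eqU] : [/\ slab_smooth s U,
    forall t x, U t x = u t x + (- e) * (phi x + pen t) &
    forall t x, s < t -> derive1 (U^~ x) t - opA Q b t (U t) x =
      (- e) * (a + 1 - opA Q b t phi x)] by exact: (penalize (- e) su).
pose V t x := 1 * v t x + (e) * pen t + (e) * phi x.
have [sV VE eqV] : [/\ slab_smooth s V,
    forall t x, V t x = v t x + (e) * (phi x + pen t) &
    forall t x, s < t -> derive1 (V^~ x) t - opA Q b t (V t) x =
      (e) * (a + 1 - opA Q b t phi x)] by exact: (penalize (e) sv).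
rewrite -VE -mulNr -UE => Upos.
case: su => _ _ [M0 uM0]; pose M := Num.max 1 M0.
have M1 : 0 < M by rewrite lt_max ltr01.
have uM r z : s <= r -> u r z <= M.
  by move=> sr; rewrite (le_trans (ler_norm _))// (le_trans (uM0 _ _ sr))// le_max lexx orbT.
have phi_gt0 z : 0 < phi z by apply: lt_le_trans (phi_ge1 z).
have P0 r z : s <= r -> 0 < phi z + pen r by move=> sr; rewrite ltr_wpDr// pen_ge0.
have VleP r z : s <= r -> e * phi z <= V r z.
  move=> sr; rewrite VE -[leLHS]add0r lerD// ?v_ge0//.
  by rewrite ler_pM2l// lerDl pen_ge0.
have UleP r z : s <= r -> U r z <= u r z - e * phi z.
  move=> sr; rewrite UE lerD2l mulNr lerN2 ler_pM2l// lerDl pen_ge0//.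
have UM r z : s <= r -> U r z <= M.
  move=> sr; rewrite (le_trans (UleP _ _ sr))// (le_trans _ (uM _ z sr))// gerDl oppr_le0.
  by rewrite mulr_ge0// ltW.
have Vpos r z : s <= r -> e <= V r z.
  by move=> sr; apply: le_trans (VleP _ z sr); rewrite ler_pMr.
have [rho1 _ Hrho1] := tends_to_infty_ball (M / e) phi_infty.
have [rho2 _ Hrho2] := tends_to_infty_ball (expR (p * ln M) / e) phi_infty.
pose rho := Num.max rho1 rho2.
have Uout r z : s <= r -> ~ enorm z <= rho -> U r z <= 0.
  move=> sr zrho; apply: (le_trans (UleP _ _ sr)); rewrite subr_le0.
  apply: (le_trans (uM _ _ sr)); rewrite mulrC -ler_pdivrMr//; apply: Hrho1.
  by move=> h; apply: zrho; rewrite le_max h.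
have Vout r z : s <= r -> ~ enorm z <= rho -> p * ln M <= ln (V r z).
  move=> sr zrho; rewrite -[leLHS]expRK ler_ln ?posrE ?expR_gt0//; last first.
    exact: lt_le_trans (Vpos _ _ sr).
  apply: le_trans (VleP _ _ sr); rewrite [leRHS]mulrC -ler_pdivrMr//; apply: Hrho2.
  by move=> h; apply: zrho; rewrite le_max h orbT.
have [eta eta0' init] : exists2 eta, 0 < eta & forall x y, 0 < U s x ->
    p * ln (U s x) <= ln (V s y) + eta^-1 * dot (x - y) (x - y).
  apply: (@initial_separation rho M e) => //; [exact: slab_smooth_slice sU|exact: slab_smooth_slice sV| | | | |].
  - by move=> z; exact: Vpos.
  - by move=> z; exact: UM.
  - by move=> z; exact: Uout.
  - by move=> z; exact: Vout.
  - move=> z Uz.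
    have uz : U s z < u s z.
      by apply: (le_lt_trans (UleP _ z (lexx s))); rewrite gtrDl oppr_lt0 mulr_gt0.
    have uz0 := lt_trans Uz uz.
    apply: (@lt_le_trans _ _ (p * ln (u s z))); first by rewrite ltr_pM2l// ltr_ln.
    rewrite -ln_powR ler_ln ?posrE ?powR_gt0//; last exact: lt_le_trans (Vpos _ _ (lexx s)).
    have := uv z; rewrite gtr0_norm// => /le_trans; apply.
    by rewrite VE lerDl mulr_ge0// ltW// P0.
have st' : s <= t <= t by rewrite (ltW st) lexx.
have H := @harnack_strict t rho M eta U V eta0' sU sV _ _ _ Uout M1 UM Vout init t x y st' Upos.
apply: (le_trans (H _ _ _)).
- move=> r z sr; have := eqU r z sr => /eqP; rewrite subr_eq => /eqP ->.
  rewrite gtrDr mulNr oppr_lt0 mulr_gt0// subr_gt0.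
  by apply: (le_lt_trans (phi_le sr z)); rewrite ltrDl.
- move=> r z sr; have := eqV r z sr => /eqP; rewrite subr_eq => /eqP ->.
  rewrite ltrDr mulr_gt0// subr_gt0.
  by apply: (le_lt_trans (phi_le sr z)); rewrite ltrDl.
- by move=> r z sr; exact: lt_le_trans (Vpos _ z sr).
rewrite lerD2l ler_wpM2r ?dot_ge0//.
have k0 : 0 < 4 * kappa * (t - s) by rewrite mulr_gt0 ?subr_gt0// mulr_gt0// kappa_gt0.
by rewrite /c lef_pV2 ?posrE ?addr_gt0// lerDl ltW.
Qed.

(** The dimension-free Harnack inequality of F.-Y. Wang, obtained from
[harnack_penalized] when the penalization tends to 0. *)
Lemma harnack (u v : R -> 'rV[R]_d -> R) :
  bounded_solution s Q b u -> bounded_solution s Q b v ->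
  (forall x, `|u s x| `^ p <= v s x) ->
  forall t x y, s < t -> 0 < u t x ->
    u t x `^ p <= v t y * expR ((4 * kappa * (t - s))^-1 * dot (x - y) (x - y)).
Proof.
move=> su sv uv t x y st ut; rewrite leNgt; apply/negP => h.
have v0 : 0 <= v t y.
  apply: solution_ge0 (ltW st) => // z; apply: le_trans (uv z); exact: powR_ge0.
set E := expR _ in h.
have E0 : 0 < E by exact: expR_gt0.
have vE0 : 0 <= v t y * E by rewrite mulr_ge0// ltW.
(* A value strictly between both sides; e below is so small that the
   penalized inequality still contradicts it. *)
pose al := (v t y * E + u t x `^ p) / 2.
have [al1 al2] : v t y * E < al /\ al < u t x `^ p by rewrite /al; split; lra.
have al0 : 0 < al by exact: le_lt_trans al1.
pose u1 := expR (p^-1 * ln al).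
have u1u : u1 < u t x.
  rewrite -[ltRHS]lnK ?posrE// ltr_expR ltr_pdivrMl// -ln_powR ltr_ln ?posrE//.
  by rewrite powR_gt0.
have av : v t y < al / E by rewrite ltr_pdivlMr.
pose W := (phi x + pen t) + (phi y + pen t).
have phi_gt0 z : 0 < phi z by apply: lt_le_trans (phi_ge1 z).
have P0 z : 0 < phi z + pen t by rewrite ltr_wpDr// pen_ge0// ltW.
have W0 : 0 < W by rewrite addr_gt0.
pose e := Num.min (u t x - u1) (al / E - v t y) / (2 * W).
have m0 : 0 < Num.min (u t x - u1) (al / E - v t y) by rewrite lt_min !subr_gt0 u1u.
have e0 : 0 < e by rewrite divr_gt0// mulr_gt0.
have eW : e * W = Num.min (u t x - u1) (al / E - v t y) / 2.
  by rewrite /e; field; rewrite gt_eqF.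
have ele z : z = x \/ z = y -> e * (phi z + pen t) < Num.min (u t x - u1) (al / E - v t y).
  move=> zxy; apply: (@lt_trans _ _ (e * W)).
    by rewrite ltr_pM2l//; case: zxy => ->; rewrite /W; [rewrite ltrDl|rewrite ltrDr].
  by rewrite eW; lra.
have ux : u1 < u t x - e * (phi x + pen t).
  by have := ele x (or_introl erefl); rewrite lt_min => /andP[]; lra.
have vy : v t y + e * (phi y + pen t) < al / E.
  by have := ele y (or_intror erefl); rewrite lt_min => /andP[_]; lra.
have u10 : 0 < u1 by exact: expR_gt0.
have := @harnack_penalized u v e e0 su sv uv t x y st (lt_trans u10 ux).
apply/negP; rewrite -ltNge.
apply: (@lt_trans _ _ (ln al)); last first.
  rewrite -ltr_pdivrMl// -[ltLHS]expRK ltr_ln ?posrE ?expR_gt0//.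
  exact: lt_trans ux.
have V0 : 0 < v t y + e * (phi y + pen t) by rewrite ltr_wpDl// mulr_gt0.
rewrite -[X in _ + X < _]expRK -/E -lnM ?posrE//.
have VE0 := mulr_gt0 V0 E0.
by rewrite ltr_ln ?posrE// -ltr_pdivlMr.
Qed.

End Harnack.

(** * Exponentials of the squared norm, monotone drifts, classical solutions *)

Lemma continuous_mul (R : realType) (T : topologicalType) (f g : T -> R) :
  continuous f -> continuous g -> continuous (fun x => f x * g x).
Proof. by move=> cf cg x; exact: (cvgM (cf x) (cg x)). Qed.

Lemma continuous_add (R : realType) (T : topologicalType) (f g : T -> R) :
  continuous f -> continuous g -> continuous (fun x => f x + g x).
Proof. by move=> cf cg x; exact: (cvgD (cf x) (cg x)). Qed.

Section Regularity.
Context {R : realType} {d : nat}.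
Implicit Types (x y v : 'rV[R]_d).

Lemma is_derive_coord i x v : is_derive x v (fun x : 'rV[R]_d => x 0 i) (v 0 i).
Proof.
apply/is_derive_line0.
have := is_deriveD (is_derive_cst (x 0 i) (0:R) (1:R)) (is_deriveZ (v 0 i) (is_derive_id (0:R) (1:R))).
set F := (X in is_derive _ _ X _).
have -> : F = (fun r => (x + r *: v) 0 i).
  by apply/funext => r; rewrite !mxE mulrC.
by move=> h; apply: (is_derive_eq h); rewrite add0r; exact: mulr1.
Qed.

Lemma dot_delta x i : dot x (delta_mx 0 i) = x 0 i.
Proof.
rewrite /dot (bigD1 i)//= big1 ?addr0; last first.
  by move=> j ji; rewrite mxE eqxx/= (negPf ji) mulr0.
by rewrite mxE !eqxx mulr1.
Qed.

Lemma is_derive_phi_exp lam x v :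
  is_derive x v (phi_exp lam) (2 * lam * dot x v * phi_exp lam x).
Proof.
apply/is_derive_line0.
have hp : is_derive (0:R) (1:R) (fun r => lam * dot x x + (2 * lam * dot x v) * r + (lam * dot v v) * (r * r))
    (2 * lam * dot x v).
  have d1 := is_derive_id (0:R) (1:R).
  have := is_deriveD (is_deriveD (is_derive_cst (lam * dot x x) (0:R) (1:R)) (is_deriveZ (2 * lam * dot x v) d1))
     (is_deriveZ (lam * dot v v) (is_deriveM d1 d1)).
  move=> h; apply: (is_derive_eq h).
  change (0 + (2 * lam * dot x v) * 1 + lam * dot v v * (0 * 1 + 0 * 1) = 2 * lam * dot x v).
  ring.
have := is_derive1_comp (is_derive_expR _) hp.
have -> : expR \o (fun r => lam * dot x x + (2 * lam * dot x v) * r + (lam * dot v v) * (r * r))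
   = (fun r => phi_exp lam (x + r *: v)).
  apply/funext => r /=; rewrite /phi_exp enorm2; congr expR.
  have := dot_line x v r; move/eqP; rewrite subr_eq => /eqP ->; ring.
by move=> h; apply: (is_derive_eq h); rewrite !mulr0 !addr0 mulrC /phi_exp enorm2.
Qed.

Lemma continuous_phi_exp lam : continuous (@phi_exp R d lam).
Proof.
move=> x; apply: (@continuous_comp _ _ _ (fun x => lam * enorm x ^+ 2) expR); last exact: continuous_expR.
have c2 : continuous (fun x : 'rV[R]_d => lam * enorm x ^+ 2).
  apply: (@continuous_mul _ _ (cst lam) (fun x => enorm x ^+ 2)); first exact: cst_continuous.
  by apply: (@continuous_mul _ _ (@enorm R d) (@enorm R d)); exact: continuous_enorm.
exact: c2.
Qed.

Lemma phi_exp_gt0 lam x : 0 < phi_exp lam x.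
Proof. exact: expR_gt0. Qed.

Lemma class_C2_phi_exp lam : class_C2 (@phi_exp R d lam).
Proof.
have p1 i : partial i (phi_exp lam) = (fun x : 'rV[R]_d => 2 * lam * x 0 i * phi_exp lam x).
  apply/funext => x; have [_ E] := is_derive_phi_exp lam x (delta_mx 0 i).
  by rewrite dot_delta in E; exact: E.
have d2 i x v : is_derive x v (fun x : 'rV[R]_d => 2 * lam * x 0 i * phi_exp lam x)
   (2 * lam * x 0 i * (2 * lam * dot x v * phi_exp lam x) + phi_exp lam x * (2 * lam * v 0 i)).
  exact: is_deriveM (is_deriveZ (2 * lam) (is_derive_coord i x v)) (is_derive_phi_exp lam x v).
have p2 i j : partial j (partial i (phi_exp lam)) = (fun x : 'rV[R]_d => 2 * lam * x 0 i * (2 * lam * x 0 j * phi_exp lam x) + phi_exp lam x * (2 * lam * (delta_mx 0 j : 'rV[R]_d) 0 i)).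
  rewrite p1; apply/funext => x; have [_ E] := d2 i x (delta_mx 0 j).
  by rewrite dot_delta in E; exact: E.
have ck (k : R) : continuous (fun _ : 'rV[R]_d => k) by exact: cst_continuous.
have cl i : continuous (fun x : 'rV[R]_d => 2 * lam * x 0 i).
  by apply: continuous_mul; [exact: ck|move=> x; exact: coord_continuous].
have c1 i : continuous (fun x : 'rV[R]_d => 2 * lam * x 0 i * phi_exp lam x).
  by apply: continuous_mul; [exact: cl|exact: continuous_phi_exp].
split.
- by move=> i x; have [] := is_derive_phi_exp lam x (delta_mx 0 i).
- by move=> i j x; rewrite p1; have [] := d2 i x (delta_mx 0 j).
- exact: continuous_phi_exp.
- by move=> i; rewrite p1; exact: c1.
- move=> i j; rewrite p2; apply: continuous_add; first exact: continuous_mul.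
  by apply: continuous_mul; [exact: continuous_phi_exp|exact: ck].
Qed.

(** Mean value theorem for r -> <v, b(t, y + r v)> with v = x - y, whose
derivative is <Jb v, v> <= 0. *)
Lemma drift_monotone (I : set R) (b : R -> 'rV[R]_d -> 'rV[R]_d) t r0 :
  (forall i, has_partials (fun x => b t x 0 i)) ->
  (forall i j, continuous (partial j (fun x => b t x 0 i))) ->
  r0 <= 0 ->
  (forall x xi, dot (mxapp (jacob (b t) x) xi) xi <= r0 * enorm xi ^+ 2) ->
  forall x y, dot (x - y) (b t x - b t y) <= 0.
Proof.
move=> b1 cb1 r0_le jac x y; set v := x - y.
pose f (r : R) := dot v (b t (y + r *: v)).
pose f' (r : R) := dot (mxapp (jacob (b t) (y + r *: v)) v) v.
have df r : is_derive r (1:R) f (f' r).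
  have -> : f = \sum_(i < d) (fun r : R => v 0 i *: b t (y + r *: v) 0 i).
    by rewrite fct_sumE.
  have -> : f' r = \sum_(i < d) v 0 i *: dot (grad (fun x => b t x 0 i) (y + r *: v)) v.
    apply: eq_bigr => i _; rewrite !mxE mulrC; congr (_ * _).
    by apply: eq_bigr => j _; rewrite !mxE mulrC.
  apply: is_derive_sum => i; apply: is_deriveZ.
  apply: (@is_derive_line _ _ (fun x => b t x 0 i) y v r _).1.
  by apply: is_derive_grad => // j; exact: cb1.
have cf : continuous f.
  by move=> r; apply/differentiable_continuous/derivable1_diffP/ex_derive.
have [r _] := MVT (@ltr01 R) (fun r _ => df r) (continuous_subspaceT cf).
have yv : y + v = x by rewrite addrC subrK.
rewrite /f scale1r scale0r addr0 subr0 mulr1 yv dotBr => ->.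
by rewrite (le_trans (jac _ _))// mulr_le0_ge0// sqr_ge0.
Qed.

Lemma parabolic_hoelder_continuous (theta : R) (I : set R) u t :
  0 < theta -> I t -> parabolic_hoelder_loc theta I u ->
  continuous (u t : 'rV[R]_d -> R).
Proof.
move=> th0 It /(_ t t) H x.
have tI : `[t, t] `<=` I by move=> r /=; rewrite in_itv/= -eq_le => /eqP <-.
have {H}[C H] := H (enorm x + 1) tI.
have tt : t \in `[t, t] by rewrite in_itv/= lexx.
have FF : Filter (nbhs x) by exact: nbhs_filter.
apply: (iffRL (@cvgrPdist_le R R^o _ (nbhs x) FF (u t) (u t x))) => /= e e0.
have C0 : 0 < `|C| + 1 by rewrite ltr_wpDl.
pose dl := (e / (`|C| + 1)) `^ theta^-1.
have dl0 : 0 < dl by rewrite powR_gt0// divr_gt0.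
have cx : enorm (x - y) @[y --> x] --> (0 : R).
  have -> : (0 : R) = enorm (x - x) by rewrite subrr /enorm /dot big1 ?sqrtr0// => i _; rewrite mxE mul0r.
  apply: (@continuous_comp _ _ _ (fun y => x - y) (@enorm R d)); last exact: continuous_enorm.
  by apply: cvgB; [exact: cvg_cst|exact: cvg_id].
near=> y.
have yd : enorm (x - y) < dl.
  rewrite -[ltLHS](ger0_norm (enorm_ge0 _)) -normrN -[X in `|X|]add0r.
  by near: y; move: (iffLR (@cvgrPdist_lt R R^o _ (nbhs x) FF _ _) cx _ dl0).
have yr : enorm y <= enorm x + 1.
  rewrite -lerBlDl (le_trans (ler_norm _))// distrC ltW//; near: y.
  exact: (iffLR (@cvgrPdist_lt R R^o _ (nbhs x) FF _ _) (@continuous_enorm R d x) _ ltr01).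
apply: (le_trans (H t t tt tt x y _ yr)); first by rewrite lerDl.
rewrite subrr normr0 powR0; last by rewrite mulf_neq0// gt_eqF.
rewrite add0r (@le_trans _ _ ((`|C| + 1) * enorm (x - y) `^ theta))//.
  by rewrite ler_wpM2r ?powR_ge0// (le_trans (ler_norm _))// lerDl.
rewrite -ler_pdivlMl// mulrC.
have -> : e / (`|C| + 1) = dl `^ theta.
  by rewrite /dl -powRrM mulVf ?gt_eqF// powRr1// ltW// divr_gt0.
by rewrite ge0_ler_powR ?nnegrE ?enorm_ge0// ltW.
Unshelve. all: by end_near. Qed.

Lemma classical_bounded_solution (Q : R -> 'M[R]_d) b (theta s : R) f u :
  0 < theta ->
  bounded_classical_solution Q b theta s f u -> bounded_solution s Q b u.
Proof.
move=> th0 [cu [M uM] [du u2 [hu _] hu1 hu2] eu _].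
split; last by exists M.
  split; first exact: continuous_clamp.
    by move=> t x st; apply: du; rewrite /= in_itv/= st.
  move=> t st; have It : `]s, +oo[%classic t by rewrite /= in_itv/= st.
  have [ut1 ut2] := u2 t It.
  split=> //.
  - exact: parabolic_hoelder_continuous hu.
  - by move=> i; exact: (parabolic_hoelder_continuous th0 It (hu1 i)).
  - by move=> i j; exact: (parabolic_hoelder_continuous th0 It (hu2 i j)).
by move=> t x st; exact: eu.
Qed.

End Regularity.

(** * Decay of solutions in finite time *)

Section Decay.
Context {R : realType} {d : nat}.
Variables (s : R) (Q : R -> 'M[R]_d) (b : R -> 'rV[R]_d -> 'rV[R]_d).
Hypothesis Qsym : forall t, s < t -> (Q t)^T = Q t.
Hypothesis Qpos : forall t, s < t -> forall v : 'rV[R]_d, v != 0 ->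
  0 < dot (mxapp (Q t) v) v.
Variables (phi : 'rV[R]_d -> R) (a : R).
Hypothesis phi2 : class_C2 phi.
Hypothesis phi_infty : tends_to_infty phi.
Hypothesis phi_ge1 : forall x, 1 <= phi x.
Hypothesis phi_le : forall t, s < t -> forall x, opA Q b t phi x <= a.
Hypothesis a_gt0 : 0 < a.

Lemma slab_smooth_later r (u : R -> 'rV[R]_d -> R) : s <= r -> slab_smooth s u -> slab_smooth r u.
Proof.
move=> sr [cu du u2]; split; last 2 first.
- by move=> t x rt; exact: du (le_lt_trans sr rt).
- by move=> t rt; exact: u2 (le_lt_trans sr rt).
have h : continuous (fun z : R * 'rV[R]_d => (Num.max r z.1, z.2)).
  apply: continuous_pair; last by move=> z; exact: cvg_snd.
  by move=> z; apply: continuous_max; [exact: cvg_cst|exact: cvg_fst].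
have -> : (fun z : R * 'rV[R]_d => u (Num.max r z.1) z.2) =
    (fun z => u (Num.max s z.1) z.2) \o (fun z : R * 'rV[R]_d => (Num.max r z.1, z.2)).
  by apply/funext => z /=; rewrite maxA (max_r sr).
by move=> z; apply: continuous_comp; [exact: h|exact: cu].
Qed.

Variable psi : 'rV[R]_d -> R.
Hypothesis psi2 : class_C2 psi.
Hypothesis psi_gt0 : forall x, 0 < psi x.
Variables (Y1 : R) (u : R -> 'rV[R]_d -> R).
Hypothesis u_sol : bounded_solution s Q b u.

(** The right-hand side is al + be y(t), where y solves y' = - m (y - Z) with
y(r) = psi. It is a supersolution where psi >= Y1, and elsewhere it is at least
al, hence at least u. *)
Lemma decay_step (r al be m Z : R) : s <= r -> 0 <= m -> 0 <= Z -> 0 <= be ->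
  (forall t x, r < t -> Y1 <= psi x -> opA Q b t psi x <= - (m * (psi x - Z))) ->
  (forall t x, r <= t -> psi x < Y1 -> u t x <= al) ->
  (forall x, u r x <= al + be * psi x) ->
  forall t x, r <= t ->
    u t x <= al + be * (Z + expR (- m * (t - r)) * (psi x - Z)).
Proof.
move=> sr m0 Z0 be0 Apsi uin ur t1 x1 rt1.
case: u_sol => su eu [M uM].
have sur := slab_smooth_later sr su.
pose ex t := expR (- m * (t - r)).
have dex t : is_derive t (1:R) ex (- m * ex t).
  have hl := is_deriveZ (- m) (is_deriveB (is_derive_id t (1:R)) (is_derive_cst r t (1:R))).
  have := is_derive1_comp (is_derive_expR _) hl.
  move=> h; apply: (is_derive_eq h).
  change (ex t * (- m * (1 - 0)) = - m * ex t); ring.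
pose ca t := - (al + be * Z) + (be * Z) * ex t.
pose cb t := (- be) * ex t.
have dca t : is_derive t (1:R) ca (- (m * be * Z * ex t)).
  have := is_deriveD (is_derive_cst (- (al + be * Z)) t (1:R)) (is_deriveZ (be * Z) (dex t)).
  move=> h; apply: (is_derive_eq h).
  change (0 + (be * Z) * (- m * ex t) = - (m * be * Z * ex t)); ring.
have dcb t : is_derive t (1:R) cb (m * be * ex t).
  have := is_deriveZ (- be) (dex t).
  move=> h; apply: (is_derive_eq h).
  change ((- be) * (- m * ex t) = m * be * ex t); ring.
pose w t x := 1 * u t x + ca t + cb t * psi x.
have wE t x : w t x = u t x - (al + be * (Z + ex t * (psi x - Z))).
  by rewrite /w /ca /cb; ring.
have ex01 t : r <= t -> 0 < ex t <= 1.
  move=> rt; rewrite expR_gt0/= -expR0 ler_expR mulNr oppr_le0 mulr_ge0// subr_ge0//.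
have Vge t x : r <= t -> 0 <= be * (Z + ex t * (psi x - Z)).
  move=> rt; have /andP[e0 e1] := ex01 t rt.
  rewrite mulr_ge0//; have -> : Z + ex t * (psi x - Z) = Z * (1 - ex t) + ex t * psi x by ring.
  by rewrite addr_ge0// mulr_ge0// ?subr_ge0// ltW.
suff : w t1 x1 <= 0 by rewrite wE subr_le0.
apply: (@max_principle _ _ r Q b _ _ phi a phi2 phi_infty phi_ge1 _ t1 (M - al) w a_gt0).
- by move=> t rt; exact: Qsym (le_lt_trans sr rt).
- by move=> t rt; exact: Qpos (le_lt_trans sr rt).
- by move=> t rt; exact: phi_le (le_lt_trans sr rt).
- apply: (slab_smooth_lin 1 sur psi2) => t.
    exact: (@ex_derive _ _ _ _ _ _ _ (dca t)).
  exact: (@ex_derive _ _ _ _ _ _ _ (dcb t)).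
- move=> t x /andP[rt _]; rewrite wE opprD addrA.
  rewrite (@le_trans _ _ (u t x - al))//; first by rewrite gerDl oppr_le0 Vge.
  by rewrite lerD2r (le_trans (ler_norm _))// uM// (le_trans sr).
- move=> x; rewrite wE subr_le0 (le_trans (ur x))// /ex subrr mulr0 expR0 mul1r.
  by rewrite addrC [Z + _]addrC subrK addrC.
- move=> t x /andP[rt _] wpos; have st := le_lt_trans sr rt.
  have psiY : Y1 <= psi x.
    rewrite leNgt; apply/negP => h; move: wpos; rewrite wE subr_gt0 ltNge => /negP; apply.
    by rewrite (le_trans (uin _ _ (ltW rt) h))// lerDl Vge// ltW.
  have := Apsi t x rt psiY.
  case: sur => _ du u2'.
  rewrite /w (opA_lin _ _ _ _ _ _ _ (u2' _ rt) psi2).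
  rewrite (derive1_lin 1 (psi x) (du _ x rt) (@ex_derive _ _ _ _ _ _ _ (dca t)) (@ex_derive _ _ _ _ _ _ _ (dcb t))).
  rewrite !derive1E !mul1r -derive1E (eu _ _ st).
  have [_ ->] := dca t; have [_ ->] := dcb t.
  move: (opA Q b t psi x) (opA Q b t (u t) x) => P U h.
  have /andP[e0 _] := ex01 t (ltW rt).
  have : be * ex t * P <= be * ex t * - (m * (psi x - Z)).
    by rewrite ler_wpM2l// mulr_ge0// ltW.
  rewrite /cb; nra.
- by rewrite rt1 lexx.
Qed.

(** Stage n applies [decay_step] at level 2^n Z0 during the time that divides
the coefficient of psi by 3. That coefficient is then K0 3^-n and stage n adds
K0 3^-n (2/3) 2^n Z0 to the constant: these terms sum up to
2 K0 Z0 (1 - (2/3)^N). *)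
Lemma decay_iterate (r K1 K0 Z0 : R) (m tau : nat -> R) : s <= r -> 0 <= K1 -> 0 <= K0 ->
  0 < Z0 -> (forall n, 0 < m n) -> (forall n, 0 < tau n) ->
  (forall n, expR (- m n * tau n) = 3^-1) ->
  (forall n t x, r < t -> Y1 <= psi x -> opA Q b t psi x <= - (m n * (psi x - 2 ^+ n * Z0))) ->
  (forall t x, r <= t -> psi x < Y1 -> u t x <= K1) ->
  (forall x, u r x <= K0 * psi x) ->
  forall N x, u (r + \sum_(k < N) tau k) x <=
    K1 + K0 * (2 * Z0) * (1 - (2 / 3) ^+ N) + K0 * 3 ^- N * psi x.
Proof.
move=> sr K10 K00 Z00 m0 tau0 mtau Apsi uin ur; elim=> [|N IH] x.
  rewrite big_ord0 addr0 !expr0 subrr mulr0 addr0 invr1 mulr1.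
  by rewrite (le_trans (ur x))// lerDr.
rewrite big_ord_recr/= addrA; set rN := r + _ in IH *.
have rrN : r <= rN by rewrite lerDl sumr_ge0// => k _; rewrite ltW.
have p23 : (2 / 3 : R) ^+ N <= 1 by rewrite exprn_ile1//; lra.
have := @decay_step rN (K1 + K0 * (2 * Z0) * (1 - (2 / 3) ^+ N)) (K0 * 3 ^- N) (m N) (2 ^+ N * Z0)
  (le_trans sr rrN) (ltW (m0 N)) _ _ _ _ IH (rN + tau N) x.
have -> : rN + tau N - rN = tau N by rewrite addrAC subrr add0r.
rewrite mtau => H.
apply: (le_trans (H _ _ _ _ _)).
- by rewrite mulr_ge0// ltW.
- by rewrite mulr_ge0// invr_ge0 exprn_ge0.
- by move=> t y rt; apply: Apsi; exact: le_lt_trans rt.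
- move=> t y rt hy; rewrite (le_trans (uin _ _ (le_trans rrN rt) hy))// lerDl.
  by rewrite !mulr_ge0// ?subr_ge0// ltW.
- by rewrite lerDl ltW.
rewrite le_eqVlt; apply/orP; left; apply/eqP.
rewrite !exprS expr_div_n; field.
by rewrite expf_neq0.
Qed.

(** All the stages together last at most del, and after them the bound persists
because psi itself is a supersolution where it is large. As N tends to
infinity the coefficient of psi tends to 0, pointwise in x. *)
Lemma decay_bound (r del K1 K0 Z0 : R) (m tau : nat -> R) : s <= r -> 0 <= K1 -> 0 <= K0 ->
  0 < Z0 -> (forall n, 0 < m n) -> (forall n, 0 < tau n) ->
  (forall n, expR (- m n * tau n) = 3^-1) ->
  (forall N, \sum_(k < N) tau k <= del) ->
  (forall n t x, r < t -> Y1 <= psi x -> opA Q b t psi x <= - (m n * (psi x - 2 ^+ n * Z0))) ->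
  (forall t x, r < t -> Y1 <= psi x -> opA Q b t psi x <= 0) ->
  (forall t x, r <= t -> psi x < Y1 -> u t x <= K1) ->
  (forall x, u r x <= K0 * psi x) ->
  forall t x, r + del <= t -> u t x <= K1 + K0 * (2 * Z0).
Proof.
move=> sr K10 K00 Z00 m0 tau0 mtau sumtau Apsi Apsi0 uin ur t x rt.
have step N : u t x <= K1 + K0 * (2 * Z0) + K0 * 3 ^- N * psi x.
  have := decay_iterate sr K10 K00 Z00 m0 tau0 mtau Apsi uin ur N.
  set rN := r + _ => IH.
  have rrN : r <= rN by rewrite lerDl sumr_ge0// => k _; rewrite ltW.
  have p23 : (2 / 3 : R) ^+ N <= 1 by rewrite exprn_ile1//; lra.
  have A0 : 0 <= K0 * (2 * Z0) by rewrite mulr_ge0// mulr_ge0// ltW.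
  have p0 : 0 <= (2 / 3 : R) ^+ N by rewrite exprn_ge0//; lra.
  have rNt : rN <= t by rewrite (le_trans _ rt)// lerD2l.
  (* With m = Z = 0 the step only propagates the bound reached at time rN. *)
  have := @decay_step rN (K1 + K0 * (2 * Z0) * (1 - (2 / 3) ^+ N)) (K0 * 3 ^- N) 0 0
    (le_trans sr rrN) (lexx _) (lexx _) _ _ _ IH t x rNt.
  rewrite oppr0 mul0r expR0 mul1r add0r addr0 => H.
  apply: (le_trans (H _ _ _)).
  - by rewrite mulr_ge0// invr_ge0 exprn_ge0.
  - by move=> t' y rt' hy; rewrite mul0r oppr0; apply: Apsi0 hy; exact: le_lt_trans rt'.
  - move=> t' y rt' hy; rewrite (le_trans (uin _ _ (le_trans rrN rt') hy))// lerDl.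
    by rewrite mulr_ge0// subr_ge0.
  rewrite lerD2r lerD2l -[leRHS]mulr1 ler_wpM2l//; lra.
apply/ler_addgt0Pr => e e0; apply: (le_trans (step (Num.bound (K0 * psi x / e)))).
rewrite lerD2l; set N := Num.bound _.
have N3 : (N%:R : R) <= 3 ^+ N.
  by rewrite -natrX ler_nat ltnW// ltn_expl.
have hN : K0 * psi x / e < N%:R by apply: archi_boundP; rewrite divr_ge0// ?mulr_ge0// ltW.
rewrite mulrAC ler_pdivrMr ?exprn_gt0// [leRHS]mulrC -ler_pdivrMr//.
by rewrite (le_trans (ltW hN)).
Qed.

End Decay.

(** * Time steps extracted from the growth function *)

Section GrowthFunction.
Context {R : realType}.
Implicit Types h : R -> R.
Local Notation mu := (@lebesgue_measure R).

(** F is the integral of 1/|g| from c. *)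
Lemma inv_antiderivative (g : R -> R) (c : R) :
  mu.-integrable `]c, +oo[ (fun y => ((g y)^-1)%:E) ->
  exists F : R -> R, exists B : R,
   [/\ forall y, F y <= B,
       forall y z, c <= y -> y <= z -> F y <= F z &
       forall y z A, c <= y -> y <= z -> 0 < A ->
         (forall w, y < w <= z -> g w != 0 /\ `|g w| <= A) ->
         (z - y) / A <= F z - F y].
Proof.
move=> ig.
pose f (y : R) := (`|(g y)^-1|%:E).
have ig' : mu.-integrable `]c, +oo[ f by exact: integrable_abse ig.
have f0 y : (0 <= f y)%E by rewrite lee_fin.
have mcoo : measurable (`]c, +oo[%classic : set R) by exact: measurable_itv.
have sub z : `]c, z] `<=` `]c, +oo[ by move=> y /=; rewrite !in_itv/= => /andP[-> _].
have igz z : mu.-integrable `]c, z] f.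
  by apply: (@integrableS _ _ _ mu `]c, +oo[%classic) => //; exact: ig'.
have igf z : (\int[mu]_(y in `]c, z]) f y)%E \is a fin_num by exact: integrable_fin_num.
have igoo : (\int[mu]_(y in `]c, +oo[) f y)%E \is a fin_num by exact: integrable_fin_num.
pose F z := fine (\int[mu]_(y in `]c, z]) f y)%E.
have split y z : c <= y -> y <= z ->
    (\int[mu]_(x in `]c, z]) f x = \int[mu]_(x in `]c, y]) f x + \int[mu]_(x in `]y, z]) f x)%E.
  move=> cy yz.
  have E : `]c, z]%classic = `]c, y] `|` `]y, z] :> set R.
    apply/seteqP; split => x /=; rewrite !in_itv/=.
      by move=> /andP[cx xz]; have [xy|xy] := leP x y; [left|right]; rewrite ?cx ?xy ?xz.
    move=> [/andP[cx xy]|/andP[yx xz]]; first by rewrite cx (le_trans xy).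
    by rewrite xz (le_lt_trans cy).
  rewrite E ge0_integral_setU//.
  - by rewrite -E; exact: (measurable_int mu (igz z)).
  - apply/disj_setPS => x [/=]; rewrite !in_itv/= => /andP[_ xy] /andP[yx _].
    by move: xy; rewrite leNgt yx.
have iyz y z : c <= y -> y <= z -> (\int[mu]_(x in `]y, z]) f x)%E \is a fin_num.
  move=> cy yz; have := igf z; rewrite (split y z)// fin_numD => /andP[_]; exact.
have FE y z : c <= y -> y <= z -> F z = F y + fine (\int[mu]_(x in `]y, z]) f x)%E.
  by move=> cy yz; rewrite /F (split y z)// fineD// iyz.
exists F, (fine (\int[mu]_(y in `]c, +oo[) f y)%E); split.
- move=> y; apply: fine_le => //; apply: ge0_subset_integral => //.
  exact: (measurable_int mu ig').
- by move=> y z cy yz; rewrite (FE _ _ cy yz) lerDl fine_ge0// integral_ge0.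
- move=> y z A cy yz A0 gA; rewrite (FE _ _ cy yz).
  rewrite addrAC subrr add0r -lee_fin fineK; last exact: iyz.
  have -> : ((z - y) / A)%:E = (\int[mu]_(x in `]y, z]) (A^-1)%:E)%E.
    rewrite integral_cst//.
    rewrite [X in (_ * X)%E]lebesgue_measure_itv/= lte_fin.
    case: ltgtP yz => // [yz _|-> _]; first by rewrite -EFinB -EFinM mulrC.
    by rewrite subrr mul0r mule0.
  apply: ge0_le_integral => //.
  + by move=> x _; rewrite lee_fin invr_ge0 ltW.
  + apply: (measurable_funS _ _ (measurable_int mu (igz z))); first exact: measurable_itv.
    by move=> x /=; rewrite !in_itv/= => /andP[yx ->]; rewrite (le_lt_trans cy).
  + move=> x; rewrite /= in_itv/= => /gA[g0 gx].
    by rewrite lee_fin normfV lef_pV2 ?posrE// normr_gt0.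
Qed.

(** Convexity between 0 and y, at the point Z: once |h 0| is subtracted, h lies
below 0 at the origin and h(y)/y is nondecreasing. *)
Lemma convex_star (h : R -> R) Z y :
  convex_function (`[0, +oo[ : set R^o) (h : R^o -> R^o) -> 0 < Z -> Z <= y ->
  y * (h Z - `|h 0|) <= Z * (h y - `|h 0|).
Proof.
move=> ch Z0 Zy.
have y0 : 0 < y by exact: lt_le_trans Zy.
have t0 : 0 <= Z / y by rewrite divr_ge0// ltW.
have t1 : Z / y <= 1 by rewrite ler_pdivrMr// mul1r.
pose t : {i01 R} := Itv01 t0 t1.
have in0 (x : R) : 0 <= x -> (x : R^o) \in (`[0, +oo[%classic : set R^o).
  by move=> x0; rewrite inE /= in_itv/= x0.
have : h (Z / y * y + (1 - Z / y) * 0) <= Z / y * h y + (1 - Z / y) * h 0.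
  exact: ch t y 0 (in0 _ (ltW y0)) (in0 _ (lexx 0)).
rewrite mulr0 addr0 divfK ?gt_eqF// => H.
have : y * h Z <= y * (Z / y * h y + (1 - Z / y) * h 0) by rewrite ler_pM2l.
have -> : y * (Z / y * h y + (1 - Z / y) * h 0) = Z * h y + (y - Z) * h 0.
  by field; rewrite gt_eqF.
have : (y - Z) * h 0 <= (y - Z) * `|h 0| by rewrite ler_wpM2l ?subr_ge0 ?ler_norm.
lra.
Qed.

(** With h1 = h - |h 0|, take m_n = h1(Z_n) / Z_n for Z_n = 2^n Z0. By
[convex_star], h(y) >= m_n y for y >= Z_n, and below Z_n the claim holds since
m_n (y - Z_n) is negative. If Z0 is so large that h1(Z_n) >= h(Z_n) / 2, then
tau_n = ln 3 / m_n is at most 2 ln 3 Z_n / h(Z_n), which by monotonicity of h is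
at most 4 ln 3 times the integral of 1/h over [Z_n / 2, Z_n]; these intervals
are adjacent, so the sum of the tau_n is controlled by the tail of the
integral. *)
Lemma admissible_h_schedule (h : R -> R) (del : R) : admissible_h h -> 0 < del ->
  exists (Z0 : R) (m tau : nat -> R),
    [/\ 0 < Z0, (forall n, 0 < m n) /\ (forall n, 0 < tau n),
        forall n, expR (- m n * tau n) = 3^-1,
        forall N, \sum_(k < N) tau k <= del &
        forall y, Z0 <= y -> 0 <= h y /\ forall n, m n * (y - 2 ^+ n * Z0) <= h y].
Proof.
move=> [ch hmono [c0 [c00 hne0 ih]]] del0.
have [F [B [FB Fmono Fgrow]]] := inv_antiderivative ih.
have ln3 : 0 < ln 3 :> R by rewrite ln_gt0//; lra.
(* The tail of the integral of 1/h that makes the tau_n sum up to del. *)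
pose e := del / (4 * ln 3).
have e0 : 0 < e by rewrite divr_gt0// mulr_gt0.
pose c := c0 + 1.
have c0c : c0 < c by rewrite ltrDl.
have c_gt0 : 0 < c by exact: le_lt_trans c0c.
have hc0 : 0 < `|h c| by rewrite normr_gt0 hne0.
have hle y z : 0 <= y -> y <= z -> h y <= h z.
  by move=> y0 yz; apply: hmono => //; rewrite in_itv/= ?y0// (le_trans y0).
pose S := sup [set F y | y in [set y | c <= y]].
have hS : has_sup [set F y | y in [set y | c <= y]].
  split; first by exists (F c), c => //=.
  by exists B => _ [y _ <-].
have [_ [y0 /= cy0 <-] Fy0] := sup_adherent e0 hS.
have tail y z : y0 <= y -> y <= z -> F z - F y <= e.
  move=> y0y yz; have cy : c0 <= y by rewrite (le_trans (ltW c0c))// (le_trans cy0).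
  have : F z <= S by apply: sup_upper_bound => //; exists z => //=; rewrite (le_trans cy0)// (le_trans y0y).
  have : F y0 <= F y by apply: Fmono => //; rewrite (le_trans (ltW c0c)).
  by move: Fy0; rewrite -/S; lra.
(* h may be negative near c, hence the maximum with |h c| in this bound of |h|
   on ]y, 2 y]. *)
have grow y : y0 <= y -> y / Num.max (h (2 * y)) `|h c| <= F (2 * y) - F y.
  move=> y0y; have cy := le_trans cy0 y0y.
  have yy : 2 * y - y = y by lra.
  have y_gt0 : 0 < y by exact: lt_le_trans cy.
  rewrite -{1}yy; apply: Fgrow.
  - exact: le_trans (ltW c0c) cy.
  - lra.
  - by rewrite lt_max hc0 orbT.
  - move=> w /andP[yw w2].
    have cw : c < w by exact: le_lt_trans yw.
    split; first by apply: hne0; exact: lt_trans cw.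
    rewrite ler_norml; apply/andP; split; last first.
      by rewrite le_max hle// ltW// (lt_trans c_gt0).
    rewrite lerNl (@le_trans _ _ (- h c))//.
      by rewrite lerN2 hle// ltW.
    by rewrite le_max -normrN ler_norm orbT.
(* Beyond y1 the quotient y / max(h(2y), |h c|) is at most e although
   y >= 2 e K, so the maximum exceeds K >= |h c|: it is h(2y), and
   h(2y) - |h 0| >= h(2y) / 2. *)
pose K := Num.max `|h c| (2 * `|h 0|).
have K0 : 0 < K by rewrite lt_max hc0.
pose y1 := Num.max y0 (2 * e * K).
have hbig y : y1 <= y -> 0 < y /\ y / h (2 * y) <= F (2 * y) - F y /\ 2 * `|h 0| <= h (2 * y) /\ 0 < h (2 * y).
  rewrite ge_max => /andP[y0y eKy].
  have y_gt0 : 0 < y by rewrite (lt_le_trans _ y0y)// (lt_le_trans c_gt0).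
  have h1 := grow y y0y.
  have h2 := tail y (2 * y) y0y ltac:(lra).
  set A := Num.max _ _ in h1.
  have A0 : 0 < A by rewrite lt_max hc0 orbT.
  have KA : K < A.
    have : y / A <= e by lra.
    rewrite ler_pdivrMr// => h3.
    have : e * (2 * K) <= e * A by apply: le_trans h3; rewrite mulrCA mulrA.
    rewrite ler_pM2l//; lra.
  have AE : A = h (2 * y).
    rewrite /A /Num.max; case: ifP => // h3; exfalso; move: KA; rewrite /A /Num.max h3.
    by rewrite ltNge /K le_max lexx.
  rewrite AE in KA A0 h1; do !split => //.
  by rewrite (le_trans _ (ltW KA))// le_max lexx orbT.
pose Z n := 2 ^+ n * (2 * y1).
have Zy1 n : y1 <= 2 ^+ n * y1.
  rewrite -{1}[y1]mul1r ler_wpM2r//; last by rewrite exprn_ege1//; lra.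
  by have [/ltW] := hbig y1 (lexx _).
have ZE n : Z n = 2 * (2 ^+ n * y1) by rewrite /Z mulrCA.
have hZ n : 2 * `|h 0| <= h (Z n) /\ 0 < h (Z n).
  by have [_ [_]] := hbig _ (Zy1 n); rewrite ZE.
have Z_gt0 n : 0 < Z n.
  by have [h1 _] := hbig _ (Zy1 n); rewrite ZE mulr_gt0.
pose h1 y := h y - `|h 0|.
have h1Z n : h (Z n) / 2 <= h1 (Z n) by have [] := hZ n; rewrite /h1; lra.
have h1Z_gt0 n : 0 < h1 (Z n).
  by apply: lt_le_trans (h1Z n); have [_ ?] := hZ n; rewrite divr_gt0.
pose m n := h1 (Z n) / Z n.
have m0 n : 0 < m n by rewrite divr_gt0.
pose tau n := ln 3 / m n.
have tau_le n : tau n <= 4 * ln 3 * (F (2 ^+ n.+1 * y1) - F (2 ^+ n * y1)).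
  have [_ [g1 _]] := hbig _ (Zy1 n); have [_ hZn] := hZ n.
  have -> : 2 ^+ n.+1 * y1 = 2 * (2 ^+ n * y1) by rewrite exprS mulrA.
  apply: le_trans (_ : 4 * ln 3 * (2 ^+ n * y1 / h (Z n)) <= _); last first.
    by rewrite ler_pM2l ?mulr_gt0// ZE.
  have wE : 2 ^+ n * y1 = Z n / 2 by rewrite ZE mulrAC divff// mul1r.
  have -> : 4 * ln 3 * (2 ^+ n * y1 / h (Z n)) = ln 3 * (Z n * (h (Z n) / 2)^-1).
    by rewrite wE; field; rewrite gt_eqF.
  rewrite /tau /m invf_div.
  rewrite ler_pM2l// ler_pM2l// lef_pV2 ?posrE//.
  by rewrite divr_gt0.
have h1mono y z : 0 <= y -> y <= z -> h1 y <= h1 z.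
  by move=> y0' yz; rewrite lerD2r hle.
exists (2 * y1), m, tau; split.
- by have := Z_gt0 0%N; rewrite /Z expr0 mul1r.
- by split=> // n; rewrite divr_gt0.
- move=> n; rewrite /tau mulNr mulrC divfK ?gt_eqF//.
  by rewrite expRN lnK// posrE.
- move=> N; apply: (@le_trans _ _ (4 * ln 3 * (F (2 ^+ N * y1) - F y1))).
    elim: N => [|N IH]; first by rewrite big_ord0 expr0 mul1r subrr mulr0.
    rewrite big_ord_recr/=; have := tau_le N; move: IH; lra.
  apply: (@le_trans _ _ (4 * ln 3 * e)); last by rewrite /e mulrC divfK// gt_eqF// mulr_gt0.
  by rewrite ler_pM2l ?mulr_gt0//; apply: tail => //; rewrite le_max lexx.
- move=> y Zy.
  have Z00 : 0 < 2 * y1 by have := Z_gt0 0%N; rewrite /Z expr0 mul1r.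
  have y_gt0 : 0 < y by exact: lt_le_trans Zy.
  have h1h z : h1 z <= h z by rewrite gerDl oppr_le0.
  have h1y : 0 <= h1 y.
    apply: (le_trans (ltW (h1Z_gt0 0%N))); apply: h1mono.
      exact: ltW.
    by rewrite /Z expr0 mul1r.
  split; first exact: le_trans (h1h y).
  move=> n; apply: le_trans (h1h y); rewrite -/(Z n).
  have [yZ|Zy'] := leP y (Z n).
    by rewrite (le_trans _ h1y)// mulr_ge0_le0 ?subr_le0// ltW.
  apply: (@le_trans _ _ (m n * y)).
    by rewrite ler_pM2l// gerDl oppr_le0 ltW.
  rewrite /m mulrAC ler_pdivrMr// [leLHS]mulrC [leRHS]mulrC.
  exact: convex_star (ltW Zy').
Qed.

End GrowthFunction.

(** * Density of bounded continuous functions in Lp *)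

Lemma ler_dist_max (R : realDomainType) (a b c e : R) :
  `|Num.max a b - Num.max c e| <= `|a - c| + `|b - e|.
Proof.
have h1 := ler_norm (a - c); have h2 := ler_norm (b - e).
have h3 := ler_norm (- (a - c)); have h4 := ler_norm (- (b - e)).
have n1 := normr_ge0 (a - c); have n2 := normr_ge0 (b - e).
rewrite !normrN in h3 h4; rewrite ler_norml.
by case: (leP a b) => ab; case: (leP c e) => ce; apply/andP; split; lra.
Qed.

Section LpApproximation.
Import HBNNSimple.
Context {R : realType} {d : nat}.
Variable mu : probability (borelRd R d) R.
Variable p : R.
Hypothesis p_ge1 : 1 <= p.
Local Notation T := (borelRd R d).

Let p_gt0 : 0 < p. Proof. exact: lt_le_trans p_ge1. Qed.

Lemma continuous_measurable_borelRd (F : 'rV[R]_d -> R) :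
  continuous F -> measurable_fun [set: T] (F : T -> R).
Proof.
move=> cF; apply: (measurability _ (RGenOInfty.measurableE R)).
move=> _ [_ [x ->] <-]; rewrite setTI.
apply: sub_sigma_algebra => /=.
by move/continuousP: cF; apply; exact: interval_open.
Qed.

Lemma Lnorm_le (f : T -> R) (N : R) : 0 <= N ->
  (\int[mu]_x (`|f x| `^ p)%:E <= (N `^ p)%:E)%E ->
  (Lnorm mu p%:E (EFin \o f) <= N%:E)%E.
Proof.
move=> N0 H.
have -> : N%:E = (((N `^ p)%:E) `^ p^-1)%E :> \bar R.
  by rewrite poweR_EFin -powRrM mulfV ?gt_eqF// powRr1.
rewrite unlock; apply: gt0_ler_poweR => //.
- by rewrite invr_ge0 ltW.
- by rewrite in_itv/= integral_ge0// ?leey// => x _; exact: poweR_ge0.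
- by rewrite in_itv/= lee_fin powR_ge0 leey.
Qed.

Lemma Lnorm_le_powR (f : T -> R) (N : R) : 0 <= N ->
  (Lnorm mu p%:E (EFin \o f) <= N%:E)%E ->
  (\int[mu]_x (`|f x| `^ p)%:E <= (N `^ p)%:E)%E.
Proof.
move=> N0 H.
have -> : (\int[mu]_x (`|f x| `^ p)%:E = (Lnorm mu p%:E (EFin \o f)) `^ p)%E.
  by rewrite poweR_Lnorm// gt_eqF.
rewrite -poweR_EFin; apply: gt0_ler_poweR => //.
- exact: ltW.
- by rewrite in_itv/= Lnorm_ge0 leey.
- by rewrite in_itv/= lee_fin N0 leey.
Qed.

Lemma Lnorm_bounded (f : T -> R) (M : R) : 0 <= M ->
  measurable_fun setT f -> (forall x, `|f x| <= M) ->
  (Lnorm mu p%:E (EFin \o f) <= M%:E)%E.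
Proof.
move=> M0 mf fM; apply: Lnorm_le => //.
apply: (@le_trans _ _ (\int[mu]_x (cst (M `^ p)%:E x))%E); last first.
  by rewrite integral_cst//= probability_setT mule1.
apply: ge0_le_integral => //.
- apply/measurable_EFinP; apply: (measurableT_comp (measurable_powR p)).
  exact: measurableT_comp.
- by move=> x _; rewrite lee_fin ge0_ler_powR ?nnegrE// ltW.
Qed.

Lemma Cb_measurable (F : 'rV[R]_d -> R) : class_Cb F -> measurable_fun [set: T] (F : T -> R).
Proof. by move=> [cF _]; exact: continuous_measurable_borelRd. Qed.

Lemma LfunE (f : T -> R) : f \in Lfun mu p%:E <->
  measurable_fun setT f /\ (Lnorm mu p%:E (EFin \o f) < +oo)%E.
Proof.
split; first by move=> /andP[]; rewrite !inE.
by move=> [mf lf]; apply/andP; rewrite !inE.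
Qed.

Lemma Cb_Lfun (F : 'rV[R]_d -> R) : class_Cb F -> (F : T -> R) \in Lfun mu p%:E.
Proof.
move=> Fb; apply/LfunE; split; first exact: Cb_measurable.
have [_ [M FM]] := Fb.
apply: (@le_lt_trans _ _ (`|M|)%:E); last by rewrite ltry.
apply: Lnorm_bounded => //; first exact: Cb_measurable.
by move=> x; rewrite (le_trans (FM x))// ler_norm.
Qed.

Lemma le_Lnorm (f g : T -> R) : measurable_fun setT f -> measurable_fun setT g ->
  (forall x, `|f x| <= `|g x|) ->
  (Lnorm mu p%:E (EFin \o f) <= Lnorm mu p%:E (EFin \o g))%E.
Proof.
move=> mf mg fg; rewrite unlock; apply: gt0_ler_poweR => //.
- by rewrite invr_ge0 ltW.
- by rewrite in_itv/= integral_ge0// ?leey// => x _; exact: poweR_ge0.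
- by rewrite in_itv/= integral_ge0// ?leey// => x _; exact: poweR_ge0.
have mp (h : T -> R) : measurable_fun setT h -> measurable_fun setT (fun x => `|(EFin \o h) x| `^ p)%E.
  move=> mh; apply/measurable_EFinP; apply: (measurableT_comp (measurable_powR p)).
  exact: measurableT_comp.
apply: ge0_le_integral => //; [by move=> x _; exact: poweR_ge0|exact: mp|exact: mp|].
by move=> x _; rewrite lee_fin ge0_ler_powR ?nnegrE// ltW.
Qed.

Definition Cb_approximable (f : T -> R) : Prop :=
  measurable_fun setT f /\ forall e : R, 0 < e -> exists F : 'rV[R]_d -> R,
    class_Cb F /\ (Lnorm mu p%:E (EFin \o (F \- f)%R) <= e%:E)%E.

Lemma Cb_approximable_Cb (F : 'rV[R]_d -> R) : class_Cb F -> Cb_approximable F.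
Proof.
move=> Fb; split; first exact: Cb_measurable.
move=> e e0; exists F; split => //; apply: Lnorm_bounded; first exact: ltW.
  by apply: measurable_funB; exact: Cb_measurable.
by move=> x; rewrite /= subrr normr0 ltW.
Qed.

Lemma Cb_add (F G : 'rV[R]_d -> R) : class_Cb F -> class_Cb G -> class_Cb (F \+ G).
Proof.
move=> [cF [M FM]] [cG [N GN]]; split.
  by move=> x; exact: (cvgD (cF x) (cG x)).
by exists (M + N) => x; rewrite (le_trans (ler_normD _ _))// lerD.
Qed.

Lemma Cb_scale k (F : 'rV[R]_d -> R) : class_Cb F -> class_Cb (fun x => k * F x).
Proof.
move=> [cF [M FM]]; split.
  by move=> x; exact: (cvgM (@cst_continuous _ _ k x) (cF x)).
by exists (`|k| * M) => x; rewrite normrM ler_wpM2l.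
Qed.

Lemma Cb_max (F G : 'rV[R]_d -> R) : class_Cb F -> class_Cb G ->
  class_Cb (fun x => Num.max (F x) (G x)).
Proof.
move=> [cF [M FM]] [cG [N GN]]; split.
  by move=> x; exact: (continuous_max (cF x) (cG x)).
exists (Num.max M N) => x; rewrite /Num.max; case: ifP => _; case: ifP => MN.
- exact: GN.
- by rewrite (le_trans (GN x))// leNgt MN.
- by rewrite (le_trans (FM x))// ltW.
- exact: FM.
Qed.

Lemma Lnorm_triangle (f g h : T -> R) (a b : R) :
  measurable_fun setT f -> measurable_fun setT g -> measurable_fun setT h ->
  (forall x, `|h x| <= `|f x| + `|g x|) ->
  (Lnorm mu p%:E (EFin \o f) <= a%:E)%E -> (Lnorm mu p%:E (EFin \o g) <= b%:E)%E ->
  (Lnorm mu p%:E (EFin \o h) <= (a + b)%:E)%E.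
Proof.
move=> mf mg mh hfg fa gb.
have mn (k : T -> R) : measurable_fun setT k -> measurable_fun setT (fun x => `|k x|).
  by move=> mk; exact: measurableT_comp.
apply: (@le_trans _ _ (Lnorm mu p%:E (EFin \o ((fun x => `|f x|) \+ (fun x => `|g x|))%R))).
  apply: le_Lnorm => //; first by apply: measurable_funD; exact: mn.
  by move=> x; rewrite [leRHS]ger0_norm// addr_ge0.
apply: (le_trans (minkowski_EFin _ (mn _ mf) (mn _ mg) p_ge1)).
have nE (k : T -> R) : Lnorm mu p%:E (EFin \o (fun x => `|k x|)) = Lnorm mu p%:E (EFin \o k).
  by rewrite -[RHS]Lnorm_abse.
by rewrite !nE EFinD leeD.
Qed.

Lemma Cb_approximable_add f g :
  Cb_approximable f -> Cb_approximable g -> Cb_approximable (f \+ g).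
Proof.
move=> [mf Hf] [mg Hg]; split; first exact: measurable_funD.
move=> e e0; have e20 : 0 < e / 2 by rewrite divr_gt0.
have [F [Fb FN]] := Hf _ e20; have [G [Gb GN]] := Hg _ e20.
exists (F \+ G); split; first exact: Cb_add.
rewrite (splitr e); apply: (Lnorm_triangle _ _ _ _ FN GN).
- by apply: measurable_funB => //; exact: Cb_measurable.
- by apply: measurable_funB => //; exact: Cb_measurable.
- apply: measurable_funB; last exact: measurable_funD.
  by apply: measurable_funD; exact: Cb_measurable.
- by move=> x /=; rewrite opprD addrACA ler_normD.
Qed.

Lemma Cb_approximable_max f g :
  Cb_approximable f -> Cb_approximable g ->
  Cb_approximable (fun x => Num.max (f x) (g x)).
Proof.
move=> [mf Hf] [mg Hg]; split; first exact: measurable_maxr.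
move=> e e0; have e20 : 0 < e / 2 by rewrite divr_gt0.
have [F [Fb FN]] := Hf _ e20; have [G [Gb GN]] := Hg _ e20.
exists (fun x => Num.max (F x) (G x)); split; first exact: Cb_max.
rewrite (splitr e); apply: (Lnorm_triangle _ _ _ _ FN GN).
- by apply: measurable_funB => //; exact: Cb_measurable.
- by apply: measurable_funB => //; exact: Cb_measurable.
- apply: measurable_funB; last exact: measurable_maxr.
  by apply: measurable_maxr; exact: Cb_measurable.
- by move=> x /=; exact: ler_dist_max.
Qed.

Lemma Cb_approximable_scale k f : Cb_approximable f -> Cb_approximable (fun x => k * f x).
Proof.
move=> [mf Hf]; split; first exact: measurable_funM.
move=> e e0; have k0 : 0 < `|k| + 1 by rewrite ltr_wpDl.
have [F [Fb FN]] := Hf (e / (`|k| + 1)) ltac:(by rewrite divr_gt0).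
exists (fun x => k * F x); split; first exact: Cb_scale.
have mFf : measurable_fun [set: T] ((F : T -> R) \- f) by apply: measurable_funB => //; exact: Cb_measurable.
have e1 : 0 <= e / (`|k| + 1) by rewrite divr_ge0// ltW.
apply: Lnorm_le; first exact: ltW.
have := Lnorm_le_powR e1 FN.
move=> H.
apply: (@le_trans _ _ (\int[mu]_x (((`|k| + 1) `^ p)%:E * (`|((F : T -> R) \- f)%R x| `^ p)%:E))%E).
  apply: ge0_le_integral => //.
  - apply/measurable_EFinP; apply: (measurableT_comp (measurable_powR p)).
    apply: measurableT_comp => //; apply: measurable_funB; apply: measurable_funM => //.
    exact: Cb_measurable.
  - apply/measurable_EFinP; apply: measurable_funM => //.
    apply: (measurableT_comp (measurable_powR p)); exact: measurableT_comp.
  - move=> x _; rewrite -EFinM lee_fin -powRM ?(ltW k0)//.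
    rewrite ge0_ler_powR ?nnegrE ?(ltW p_gt0) ?mulr_ge0 ?(ltW k0)//= -mulrBr normrM.
    by rewrite ler_wpM2r// lerDl.
rewrite ge0_integralZl_EFin ?powR_ge0//; last first.
  apply/measurable_EFinP; apply: (measurableT_comp (measurable_powR p)).
  exact: measurableT_comp.
apply: le_trans (lee_wpmul2l _ H) _; first by rewrite lee_fin powR_ge0.
by rewrite -EFinM -powRM// ?(ltW k0)// mulrC divfK// gt_eqF.
Qed.

Lemma Cb_approximable_lim f : measurable_fun setT f ->
  (forall e : R, 0 < e -> exists2 g, Cb_approximable g &
     (Lnorm mu p%:E (EFin \o (g \- f)%R) <= e%:E)%E) ->
  Cb_approximable f.
Proof.
move=> mf H; split => // e e0; have e20 : 0 < e / 2 by rewrite divr_gt0.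
have [g [mg Hg] gf] := H _ e20.
have [F [Fb FN]] := Hg _ e20.
exists F; split => //; rewrite (splitr e); apply: (Lnorm_triangle _ _ _ _ FN gf).
- by apply: measurable_funB => //; exact: Cb_measurable.
- exact: measurable_funB.
- by apply: measurable_funB => //; exact: Cb_measurable.
- by move=> x /=; apply: le_trans (ler_normD _ _); rewrite addrA subrK.
Qed.

Lemma dominated_Lnorm (f_ : nat -> T -> R) (f g : T -> R) :
  (forall n, measurable_fun setT (f_ n)) -> measurable_fun setT f ->
  g \in Lfun mu p%:E ->
  (forall n x, `|f_ n x - f x| <= g x) ->
  (forall x, f_ n x @[n --> \oo] --> f x) ->
  forall e : R, 0 < e -> exists n, (Lnorm mu p%:E (EFin \o (f_ n \- f)%R) <= e%:E)%E.
Proof.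
move=> mf_ mf gL fg cf e e0.
have gi := Lfun_integrable p_ge1 gL.
pose h n x := (`|f_ n x - f x| `^ p)%:E.
have mh n : measurable_fun setT (h n).
  apply/measurable_EFinP; apply: (measurableT_comp (measurable_powR p)).
  by apply: measurableT_comp => //; exact: measurable_funB.
have ch x : h n x @[n --> \oo] --> (0%E : \bar R).
  apply/fine_cvgP; split; first exact: nearW.
  apply/cvgrPdist_le => /= a a0.
  have b0 : 0 < a `^ p^-1 by rewrite powR_gt0.
  have /cvgrPdist_le/(_ _ b0) := cf x.
  apply: filterS => n; rewrite distrC => hn.
  rewrite sub0r normrN ger0_norm ?powR_ge0//.
  have -> : a = (a `^ p^-1) `^ p by rewrite -powRrM mulVf ?gt_eqF// powRr1// ltW.
  by rewrite ge0_ler_powR ?nnegrE ?powR_ge0// ltW.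
have ae1 : {ae mu, forall x, setT x -> h ^~ x @ \oo --> (cst 0%E : T -> \bar R) x}.
  by apply: aeW => x _; exact: ch.
have ae2 : {ae mu, forall x n, setT x -> (`|h n x| <= (`|g x| `^ p)%:E)%E}.
  apply: aeW => x n _; rewrite gee0_abs ?lee_fin ?powR_ge0//.
  by rewrite ge0_ler_powR ?nnegrE ?(ltW p_gt0)// (le_trans (fg n x))// ler_norm.
have [_ _] := @dominated_convergence _ _ _ mu setT measurableT h (cst 0%E)
  (fun x => (`|g x| `^ p)%:E) mh (measurable_cst _) ae1 gi ae2.
rewrite integral0 => /fine_cvgP[fin_ ] /cvgrPdist_le.
have ep : 0 < e `^ p by rewrite powR_gt0.
move=> /(_ _ ep) c0.
near \oo => n.
exists n; apply: Lnorm_le; first exact: ltW.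
have fn : (\int[mu]_x h n x)%E \is a fin_num by near: n.
rewrite -[leLHS]fineK// lee_fin.
have : `|0 - fine (\int[mu]_x h n x)%E| <= e `^ p by near: n.
by rewrite sub0r normrN => /(le_trans (ler_norm _)).
Unshelve. all: by end_near. Qed.

Lemma Cb_cst (k : R) : class_Cb (fun _ : 'rV[R]_d => k).
Proof. by split; [exact: cst_continuous|exists `|k|]. Qed.

Lemma Cb_approximable_ext (f g : T -> R) : f =1 g -> Cb_approximable f -> Cb_approximable g.
Proof. by move=> /funext ->. Qed.

(** The functions min (1, n dist(x, U^c)) increase to the indicator of U. *)
Lemma Cb_approximable_open (U : set 'rV[R]_d) : open U ->
  Cb_approximable (\1_U : T -> R).
Proof.
move=> oU.
have mU : measurable (U : set T) by exact: sub_sigma_algebra.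
have m1 : measurable_fun setT (\1_U : T -> R) by exact: measurable_indic.
have [[y0 Uy0]|/set0P/negP/negPn/eqP UC0] := pselect (~` U !=set0); last first.
  apply: (Cb_approximable_ext _ (Cb_approximable_Cb (Cb_cst 1))) => x.
  by rewrite indicE mem_set//; apply: contrapT => nUx; have : (~` U) x by []; rewrite UC0.
pose S x := [set `|x - y| | y in ~` U].
pose g (x : 'rV[R]_d) : R := inf (S x).
have lbS x : lbound (S x) 0 by move=> _ [y _ <-]; exact: normr_ge0.
have hS x : has_inf (S x) by split; [exists `|x - y0|, y0|exists 0; exact: lbS].
have g0 x : 0 <= g x by apply: lb_le_inf; [exact: (hS x).1|exact: lbS].
have glip x z : g x <= `|x - z| + g z.
  rewrite -lerBlDl; apply: lb_le_inf; first exact: (hS z).1.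
  move=> _ [y Uy <-]; rewrite lerBlDl; apply: (@le_trans _ _ `|x - y|).
    by apply: ge_inf; [exact: (hS x).2|exists y].
  by rewrite -(subrK z x) -addrA (le_trans (ler_normD _ _))// subrK.
have cg : continuous g.
  move=> x; have FF : Filter (nbhs x) by exact: nbhs_filter.
  apply: (iffRL (@cvgrPdist_le R R^o _ (nbhs x) FF g (g x))) => e e0.
  apply: filterS (nbhsx_ballx x _ e0) => z.
  rewrite -ball_normE /ball_/= => /ltW xz.
  rewrite ler_norml; have := glip x z; have := glip z x; rewrite distrC.
  by move=> h1 h2; apply/andP; split; lra.
have gU x : U x -> 0 < g x.
  move=> Ux; have /nbhs_ballP[e /= e0 eU] : nbhs x U by apply: open_nbhs_nbhs.
  apply: (lt_le_trans e0); apply: lb_le_inf; first exact: (hS x).1.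
  move=> _ [y Uy <-]; rewrite leNgt; apply/negP => xy; apply: Uy; apply: eU.
  by rewrite -ball_normE.
have gnU x : ~ U x -> g x = 0.
  move=> Ux; apply/eqP; rewrite eq_le g0 andbT.
  by apply: ge_inf; [exact: (hS x).2|exists x => //; rewrite subrr normr0].
pose f_ n x := Num.min 1 (n%:R * g x).
have f01 n x : 0 <= f_ n x <= 1.
  by rewrite /f_ le_min ler01 mulr_ge0//= ge_min lexx.
have fb n : class_Cb (f_ n).
  split; last by exists 1 => x; have /andP[h1 h2] := f01 n x; rewrite ger0_norm.
  have cn : continuous (fun x => n%:R * g x).
    by move=> x; exact: (cvgM (@cst_continuous _ _ (n%:R : R) x) (cg x)).
  by move=> x; exact: (continuous_min (@cst_continuous _ _ (1 : R) x) (cn x)).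
apply: Cb_approximable_lim => // e e0.
have H1 n : measurable_fun [set: T] (f_ n : T -> R) by exact: Cb_measurable.
have H2 n (x : T) : `|f_ n x - \1_U x| <= cst (1 : R) x.
  have /andP[h1 h2] := f01 n x; rewrite /cst indicE ler_norml.
  by case: (x \in U) => /=; apply/andP; split; lra.
have H3 (x : T) : f_ n x @[n --> \oo] --> (\1_U x : R).
  rewrite indicE; have [Ux|nUx] := pselect (U x).
    rewrite mem_set//=; apply: cvg_near_cst.
    near=> n; rewrite /f_; apply/min_idPl.
    rewrite -ler_pdivrMr ?gU// mul1r; near: n.
    exact: nbhs_infty_ger.
  rewrite memNset//=; apply: cvg_near_cst.
  by apply: nearW => n; rewrite /f_ gnU// mulr0; apply/min_idPr; exact: ler01.
have [n Hn] := @dominated_Lnorm f_ (\1_U) (cst 1) H1 m1 (Cb_Lfun (Cb_cst 1)) H2 H3 e e0.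
by exists (f_ n) => //; exact: Cb_approximable_Cb.
Unshelve. all: by end_near. Qed.

(** The measurable sets whose indicators are approximable form a
sigma-algebra: complements by linearity, countable unions as bounded limits
of maxima. *)
Lemma Cb_approximable_indic (A : set T) : measurable A -> Cb_approximable (\1_A : T -> R).
Proof.
pose C := [set A : set T | measurable A /\ Cb_approximable (\1_A : T -> R)].
suff H : @measurable _ T `<=` C by move=> /H[].
apply: smallest_sub; last first.
  move=> U oU; split; last exact: Cb_approximable_open.
  exact: sub_sigma_algebra.
split.
- split; first exact: measurable0.
  apply: (Cb_approximable_ext _ (Cb_approximable_Cb (Cb_cst 0))) => x.
  by rewrite indicE in_set0.
- move=> A' [mA HA]; split; first by apply: measurableD.
  have := Cb_approximable_add (Cb_approximable_Cb (Cb_cst 1)) (Cb_approximable_scale (-1) HA).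
  apply: Cb_approximable_ext => x /=.
  by rewrite setTD !indicE in_setC; case: (x \in A') => /=; ring.
- move=> F HF.
  pose UF : set T := \bigcup_k F k; rewrite -/UF.
  have mF : measurable UF by apply: bigcupT_measurable => k; have [] := HF k.
  split => //.
  (* The indicators of the finite unions. *)
  pose m := fix m (n : nat) : T -> R :=
    if n is k.+1 then fun x => Num.max (m k x) (\1_(F k) x) else fun=> 0.
  have mapp n : Cb_approximable (m n).
    elim: n => [|n IH]; first exact: (Cb_approximable_Cb (Cb_cst 0)).
    by apply: Cb_approximable_max => //; have [] := HF n.
  have m01 n x : 0 <= m n x <= 1.
    elim: n => [|n /andP[h0 h1]] /=; first by rewrite lexx ler01.
    by rewrite le_max h0/= ge_max h1/= indicE lern1 leq_b1.
  have min_ n x k : (k < n)%N -> F k x -> m n x = 1.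
    move=> kn Fkx; apply/eqP; rewrite eq_le; have /andP[_ ->] := m01 n x.
    elim: n kn => // n IH; rewrite ltnS leq_eqVlt => /predU1P[<-|kn] /=.
      by rewrite le_max indicE mem_set//= lexx orbT.
    by rewrite le_max; apply/orP; left; exact: IH.
  have mout n x : ~ UF x -> m n x = 0.
    move=> nF; elim: n => //= n ->.
    by rewrite indicE memNset ?maxxx// => Fn; apply: nF; exists n.
  have mI : measurable_fun [set: T] (\1_UF : T -> R) by exact: measurable_indic.
  apply: Cb_approximable_lim => //.
  move=> e e0.
  have H2 n (x : T) : `|m n x - \1_UF x| <= cst (1 : R) x.
    have /andP[h1 h2] := m01 n x; rewrite /cst indicE ler_norml.
    by case: (x \in _) => /=; apply/andP; split; lra.
  have H3 (x : T) : m n x @[n --> \oo] --> (\1_UF x : R).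
    rewrite indicE; have [[k _ Fk]|nF] := pselect (UF x).
      rewrite mem_set/=; last by exists k.
      apply: cvg_near_cst; near=> n.
      by apply: (min_ _ _ k) => //; near: n; exact: nbhs_infty_gt.
    rewrite memNset//=; apply: cvg_near_cst.
    by apply: nearW => n; exact: mout.
  have [n Hn] := @dominated_Lnorm m (\1_UF) (cst 1) (fun n => (mapp n).1)
    mI (Cb_Lfun (Cb_cst 1)) H2 H3 e e0.
  by exists (m n).
Unshelve. all: by end_near. Qed.

Lemma Cb_approximable_nnsfun (h : {nnsfun T >-> R}) : Cb_approximable h.
Proof.
have E x : h x = \sum_(y <- finmap.enum_fset (fset_set (range h))) (y * \1_(h @^-1` [set y]) x).
  by rewrite {1}(fimfunE h x) fsbig_finite.
apply: (Cb_approximable_ext (fun x => esym (E x))).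
elim: (finmap.enum_fset (fset_set (range h))) {E} => [|y r IH].
  apply: (Cb_approximable_ext _ (Cb_approximable_Cb (Cb_cst 0))) => x.
  by rewrite big_nil.
have h1 : Cb_approximable (fun x => y * \1_(h @^-1` [set y]) x).
  apply: Cb_approximable_scale; apply: Cb_approximable_indic.
  by rewrite -[X in measurable X]setTI; exact: measurable_funP.
apply: (Cb_approximable_ext _ (Cb_approximable_add h1 IH)) => x.
by rewrite big_cons.
Qed.

Lemma Cb_approximable_Lfun_ge0 (f : T -> R) : f \in Lfun mu p%:E ->
  (forall x, 0 <= f x) -> Cb_approximable f.
Proof.
move=> fL f0; have [mf _] := (LfunE f).1 fL.
have mEf : measurable_fun setT (EFin \o f) by exact/measurable_EFinP.
apply: Cb_approximable_lim => // e e0.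
pose h := nnsfun_approx measurableT mEf.
have hf x : h n x @[n --> \oo] --> f x.
  have := @cvg_nnsfun_approx _ _ _ _ measurableT _ mEf (fun x _ => f0 x) x I.
  by move=> /fine_cvgP[_].
have hle n x : h n x <= f x.
  have hnd : nondecreasing_seq (fun n => h n x).
    by move=> a b ab; have /lefP := nd_nnsfun_approx measurableT mEf ab; exact.
  have := nondecreasing_cvgn_le hnd (cvgP _ (hf x)) n.
  by rewrite (cvg_lim _ (hf x)).
have H1 n : measurable_fun setT (h n) by exact: measurable_funP.
have H2 n (x : T) : `|h n x - f x| <= f x.
  rewrite ler0_norm ?subr_le0// opprB gerDl oppr_le0.
  exact: fun_ge0.
have [n Hn] := @dominated_Lnorm (fun n => h n) f f H1 mf fL H2 hf e e0.
by exists (h n) => //; exact: Cb_approximable_nnsfun.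
Qed.

Lemma Cb_approximable_Lfun (f : T -> R) : f \in Lfun mu p%:E -> Cb_approximable f.
Proof.
move=> fL; have [mf lf] := (LfunE f).1 fL.
have part (g : T -> R) : measurable_fun setT g -> (forall x, `|g x| <= `|f x|) ->
    g \in Lfun mu p%:E.
  by move=> mg gf; apply/LfunE; split => //; exact: le_lt_trans (le_Lnorm mg mf gf) lf.
have m0 : measurable_fun [set: T] (fun _ : T => 0 : R) by exact: measurable_cst.
have mN : measurable_fun [set: T] (fun x : T => - f x) by exact: measurableT_comp.
have H1 : Cb_approximable (fun x => Num.max (f x) 0).
  apply: Cb_approximable_Lfun_ge0; last by move=> x; rewrite le_max lexx orbT.
  apply: part; first exact: measurable_maxr.
  by move=> x; case: (leP (f x) 0) => h; rewrite ?normr0.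
have H2 : Cb_approximable (fun x => Num.max (- f x) 0).
  apply: Cb_approximable_Lfun_ge0; last by move=> x; rewrite le_max lexx orbT.
  apply: part; first exact: measurable_maxr.
  by move=> x; case: (leP (- f x) 0) => h; rewrite ?normr0 ?normrN.
apply: (Cb_approximable_ext _ (Cb_approximable_add H1 (Cb_approximable_scale (-1) H2))) => x /=.
by case: (leP (f x) 0) => h1; case: (leP (- f x) 0) => h2; lra.
Qed.

Lemma Cb_dense_Lfun (f : T -> R) : f \in Lfun mu p%:E ->
  exists F : nat -> 'rV[R]_d -> R, forall n, class_Cb (F n) /\
    (Lnorm mu p%:E (EFin \o (F n \- f)%R) <= (n.+1%:R^-1)%:E)%E.
Proof.
move=> /Cb_approximable_Lfun[_ H].
have inv n : (0 : R) < n.+1%:R^-1 by rewrite invr_gt0 ltr0n.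
exists (fun n => sval (cid (H _ (inv n)))) => n.
exact: svalP (cid (H _ (inv n))).
Qed.

End LpApproximation.

(** * Ultracontractive estimates *)

Section Solutions.
Context {R : realType} {d : nat}.
Implicit Types (u v : R -> 'rV[R]_d -> R).

Lemma bounded_solution_lin s (Q : R -> 'M[R]_d) b k l u v :
  bounded_solution s Q b u -> bounded_solution s Q b v ->
  bounded_solution s Q b (fun t x => k * u t x + l * v t x).
Proof.
move=> [[cu du u2] eu [M uM]] [[cv dv v2] ev [N vN]].
have E t : (fun x => k * u t x + l * v t x) = (fun x => k * u t x + 0 + l * v t x).
  by apply/funext => x; rewrite addr0.
split; first split.
- move=> z; have ck (a : R) : (fun _ : R * 'rV[R]_d => a) @ z --> a by exact: cvg_cst.
  exact: (cvgD (cvgM (ck k) (cu z)) (cvgM (ck l) (cv z))).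
- move=> t x st.
  have := is_deriveD (is_deriveZ k (derivableP (du t x st))) (is_deriveZ l (derivableP (dv t x st))).
  by move=> h; exact: (@ex_derive _ _ _ _ _ _ _ h).
- by move=> t st; rewrite E; exact: (class_C2_lin k 0 l (u2 t st) (v2 t st)).
- move=> t x st; rewrite E (opA_lin _ _ _ _ _ _ _ (u2 t st) (v2 t st)) -eu// -ev//.
  have := is_deriveD (is_deriveZ k (derivableP (du t x st))) (is_deriveZ l (derivableP (dv t x st))).
  by move=> -[_ h]; rewrite !derive1E; exact: h.
- exists (`|k| * M + `|l| * N) => t x st.
  rewrite (le_trans (ler_normD _ _))// !normrM lerD// ler_wpM2l//.
    exact: uM.
  exact: vN.
Qed.

Lemma bounded_solution_continuous s (Q : R -> 'M[R]_d) b u t :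
  bounded_solution s Q b u -> s < t -> continuous (u t).
Proof. by move=> [[_ _ u2] _ _] st; have [] := u2 t st. Qed.

Lemma dot_diff_le (x y : 'rV[R]_d) :
  dot (x - y) (x - y) <= 2 * enorm x ^+ 2 + 2 * enorm y ^+ 2.
Proof.
rewrite !enorm2; have := dot_ge0 (x + y).
have dotNl (z w : 'rV[R]_d) : dot (- z) w = - dot z w by rewrite dotC dotNr dotC.
rewrite !dotDl !dotDr !dotNl !dotNr (dotC y x); lra.
Qed.

(** The power is differentiable away from 0; at a zero of f continuity is a
direct estimate. *)
Lemma continuous_norm_powR (p : R) (f : 'rV[R]_d -> R) : 0 < p ->
  continuous f -> continuous (fun x => `|f x| `^ p).
Proof.
move=> p0 cf x; have FF : Filter (nbhs x) by exact: nbhs_filter.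
have cn : `|f y| @[y --> x] --> `|f x| by exact: cvg_norm (cf x).
have [fx0|fx0] := eqVneq (f x) 0.
  apply: (iffRL (@cvgrPdist_le R R^o _ (nbhs x) FF (fun x => `|f x| `^ p) _)) => e e0.
  have b0 : 0 < e `^ p^-1 by rewrite powR_gt0.
  apply: filterS ((iffLR (@cvgrPdist_le R R^o _ (nbhs x) FF _ _) cn) _ b0) => y.
  rewrite fx0 !normr0 powR0 ?gt_eqF// !sub0r !normrN normr_id => h.
  rewrite ger0_norm ?powR_ge0//.
  have -> : e = (e `^ p^-1) `^ p by rewrite -powRrM mulVf ?gt_eqF// powRr1// ltW.
  by rewrite ge0_ler_powR ?nnegrE ?powR_ge0// ltW.
have fx : 0 < `|f x| by rewrite normr_gt0.
apply: (@continuous_comp _ _ _ (fun x => `|f x|) (fun r => r `^ p)); first exact: cn.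
apply/differentiable_continuous/derivable1_diffP.
exact: (@ex_derive _ _ _ _ _ _ _ (is_derive1_powR p fx)).
Qed.

Lemma Cb_norm_powR (p : R) (f : 'rV[R]_d -> R) : 0 < p -> class_Cb f ->
  class_Cb (fun x => `|f x| `^ p).
Proof.
move=> p0 [cf [M fM]]; split; first exact: continuous_norm_powR.
exists (`|M| `^ p) => x; rewrite ger0_norm ?powR_ge0//.
by rewrite ge0_ler_powR ?nnegrE ?(ltW p0)// (le_trans (fM x))// ler_norm.
Qed.

End Solutions.

Lemma uniform_cauchy_limit (R : realType) (d : nat) (h : nat -> 'rV[R]_d -> R) (e : nat -> R) :
  (forall n, class_Cb (h n)) -> e n @[n --> \oo] --> (0 : R) ->
  (forall n m x, `|h n x - h m x| <= e n + e m) ->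
  exists2 g, class_Cb g & forall n x, `|h n x - g x| <= e n.
Proof.
move=> hb e_cvg hh.
have e_small a : 0 < a -> \forall n \near \oo, e n <= a.
  move=> a0; have /cvgrPdist_le/(_ _ a0) := e_cvg.
  by apply: filterS => n; rewrite sub0r normrN; exact: le_trans (ler_norm _).
pose g (x : 'rV[R]_d) := limn (fun n => h n x).
have gcvg x : h n x @[n --> \oo] --> g x.
  apply: cauchy_cvg; apply: cauchy_exP => a a0.
  have a3 : 0 < a / 3 by rewrite divr_gt0.
  have [N _ HN] := e_small _ a3.
  exists (h N x); exists N => // n /= Nn.
  rewrite -ball_normE /ball_/=; apply: (le_lt_trans (hh _ _ _)).
  have := HN n Nn; have := HN N (leqnn N); rewrite /=; lra.
have hg n x : `|h n x - g x| <= e n.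
  apply/ler_addgt0Pr => a a0.
  have a2 : 0 < a / 2 by rewrite divr_gt0.
  near \oo => m.
  have em : e m <= a / 2 by near: m; exact: e_small.
  have hm : `|g x - h m x| <= a / 2.
    by near: m; move: (gcvg x) => /cvgrPdist_le; apply.
  have -> : h n x - g x = (h n x - h m x) - (g x - h m x) by ring.
  apply: (le_trans (ler_normB _ _)); have := hh n m x; lra.
exists g => //; split.
  move=> x; have FF : Filter (nbhs x) by exact: nbhs_filter.
  apply: (iffRL (@cvgrPdist_le R R^o _ (nbhs x) FF g (g x))) => a a0.
  have a3 : 0 < a / 3 by rewrite divr_gt0.
  have [N _ HN] := e_small _ a3.
  have eN := HN N (leqnn N).
  apply: filterS ((iffLR (@cvgrPdist_le R R^o _ (nbhs x) FF _ _) ((hb N).1 x)) _ a3) => y hy.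
  have -> : g x - g y = (h N x - h N y) - (h N x - g x) + (h N y - g y) by ring.
  apply: (le_trans (ler_normD _ _)).
  have := ler_normB (h N x - h N y) (h N x - g x); have := hg N x; have := hg N y.
  move: eN hy; rewrite /=; lra.
have [_ [M hM]] := hb 0%N.
exists (M + e 0%N) => x.
have -> : g x = h 0%N x - (h 0%N x - g x) by ring.
apply: (le_trans (ler_normB _ _)); apply: lerD; [exact: hM|exact: hg].
Unshelve. all: by end_near. Qed.

Lemma ereal_cvg0_near (R : realType) (u : nat -> \bar R) : u n @[n --> \oo] --> 0%E ->
  forall a : R, 0 < a -> \forall n \near \oo, (u n <= a%:E)%E.
Proof.
move=> /fine_cvgP[ufin /cvgrPdist_le ucvg] a a0.
near=> n.
have fn : u n \is a fin_num by near: n.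
rewrite -(fineK fn) lee_fin.
have : `|0 - fine (u n)| <= a by near: n; exact: ucvg.
by rewrite sub0r normrN => /(le_trans (ler_norm _)).
Unshelve. all: by end_near. Qed.

Lemma ereal_cvg0_le (R : realType) (u : nat -> \bar R) (v : nat -> R) :
  (forall n, 0 <= u n)%E -> (forall n, u n <= (v n)%:E)%E -> v n @[n --> \oo] --> (0 : R) ->
  u n @[n --> \oo] --> 0%E.
Proof.
move=> u0 uv v0; apply: (@squeeze_cvge _ _ _ _ (cst 0%E) _ (fun n => (v n)%:E)).
- by apply: nearW => n; rewrite u0 uv.
- exact: cvg_cst.
- apply: cvg_EFin; [exact: nearW | exact: v0].
Qed.

Section Ultraboundedness.
Context {R : realType} {d : nat}.
Variables (t0 theta : R) (I : set R).
Hypothesis hI : I = `]t0, +oo[%classic.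
Variables (Q : R -> 'M[R]_d) (b : R -> 'rV[R]_d -> 'rV[R]_d).
Hypothesis hA : standing_assumptions I Q b theta.
Variable (G : R -> R -> ('rV[R]_d -> R) -> 'rV[R]_d -> R).
Hypothesis hG : evolution_operator I Q b theta G.
Variable (mu : R -> probability (borelRd R d) R).
Hypothesis mu_tight : tight_family I mu.
Hypothesis mu_evol : evolution_system_of_measures I G mu.
Hypothesis h_lambda : forall lambda : R, 0 < lambda ->
      exists (rho : R) (h : R -> R),
        [/\ 0 < rho, admissible_h h &
            forall t x, I t -> rho <= enorm x ->
              opA Q b t (phi_exp lambda) x <= - h (phi_exp lambda x)].

Lemma mem_I_later s t : I s -> s <= t -> I t.
Proof. by rewrite hI /= !in_itv/= !andbT => /lt_le_trans; exact. Qed.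

Lemma G_solution s f : I s -> class_Cb f -> bounded_solution s Q b (fun t => G t s f).
Proof.
move=> Is fb; case: hA => /andP[th0 _] _ _ _ _.
exact: (classical_bounded_solution th0 (hG Is fb)).
Qed.

Lemma G_initial s f x : I s -> class_Cb f -> G s s f x = f x.
Proof. by move=> Is fb; have [_ _ _ _] := hG Is fb; exact. Qed.

(** The Lyapunov function is shifted by 1, which keeps A(t) phi <= a and makes
phi >= 1. *)
Lemma standing_data s : I s -> exists (eta0 a : R) (phi : 'rV[R]_d -> R),
  [/\ [/\ 0 < eta0, 0 < a, class_C2 phi, tends_to_infty phi & forall x, 1 <= phi x],
      forall t, s < t -> (Q t)^T = Q t,
      forall t, s < t -> forall v : 'rV[R]_d, eta0 * dot v v <= dot (mxapp (Q t) v) v,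
      forall t, s < t -> forall x y : 'rV[R]_d, dot (x - y) (b t x - b t y) <= 0 &
      forall t, s < t -> forall x, opA Q b t phi x <= a].
Proof.
move=> Is; case: hA => /andP[th0 th1] [_ breg] [Qsym [eta0 [Lam [eta0_gt0 _ Qell]]]]
  [phi [a [gam [phi2 phi0 phi_infty [a0 gam0] phiA]]]] [b1 breg1 [r0 [r00 jac]]].
have It t : s < t -> I t by move=> /ltW; exact: mem_I_later.
exists eta0, a, (fun x => 1 * phi x + 1 + 0 * phi x).
have phiE x : 1 * phi x + 1 + 0 * phi x = phi x + 1 by ring.
split.
- split; [exact: eta0_gt0|exact: a0|exact: (class_C2_lin 1 1 0 phi2 phi2)| |].
    move=> M; have [rho H] := phi_infty M; exists rho => x /H h.
    by rewrite phiE (le_trans h)// lerDl.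
  by move=> x; rewrite phiE lerDr ltW.
- by move=> t /It; exact: Qsym.
- by move=> t /It /Qell H v; have /andP[+ _] := H v; rewrite enorm2.
- move=> t /It It'.
  apply: (@drift_monotone _ _ I b t r0).
  + exact: b1.
  + by move=> i j; exact: (parabolic_hoelder_continuous th0 It' (breg1 i j)).
  + exact: ltW.
  + exact: jac.
- move=> t st x; rewrite (opA_lin _ _ _ _ _ _ _ phi2 phi2) mul1r mul0r addr0.
  rewrite (le_trans (phiA t (It t st) x))// gerDl oppr_le0.
  by rewrite mulr_ge0// ltW.
Qed.

(** Harnack is used with v = G(t,s) |u(s)|^p and integrated in y over a ball of
mu_t-mass at least 1/2. On it |x-y|^2 <= 2 |x|^2 + 2 rho^2, and invariance
replaces the integral of v(t) by that of |u(s)|^p. The constant K depends on p, cb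
and rho only, hence is uniform in s and t. *)
Lemma integrated_harnack (p cb : R) : 1 < p -> 0 < cb ->
  forall eta0 : R, 0 < eta0 ->
  (forall s t, I s -> s < t -> forall v : 'rV[R]_d, eta0 * dot v v <= dot (mxapp (Q t) v) v) ->
  exists2 K, 0 < K & forall s t u N, I s -> s < t ->
    (4 * ((1 - p^-1) * eta0) * (t - s))^-1 <= cb ->
    bounded_solution s Q b u -> class_Cb (u s) -> 0 <= N ->
    (\int[mu s]_x (`|u s x| `^ p)%:E <= (N `^ p)%:E)%E ->
    forall x, u t x <= K * N * phi_exp (2 * cb / p) x.
Proof.
move=> p1 cb0 eta0 eta0_gt0 Qell.
have p0 : 0 < p by exact: lt_trans p1.
have [|rho [rho0 Hrho]] := mu_tight (_ : 0 < 2^-1); first by rewrite invr_gt0.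
pose A := 2 * expR (2 * cb * rho ^+ 2).
have A0 : 0 < A by rewrite mulr_gt0// expR_gt0.
exists (A `^ p^-1); first by rewrite powR_gt0.
move=> s t u N Is st hc su cu N0 uN x.
have [ut|ut] := leP (u t x) 0.
  by rewrite (le_trans ut)// mulr_ge0 ?(ltW (phi_exp_gt0 _ _))// mulr_ge0// powR_ge0.
have It := mem_I_later Is (ltW st).
have [e1 [a [phi [[_ a0 phi2 phi_infty phi1] Qsym _ bmono phiA]]]] := standing_data Is.
pose g y := `|u s y| `^ p.
have gb : class_Cb g by exact: Cb_norm_powR.
pose v t := G t s g.
have sv : bounded_solution s Q b v by exact: G_solution.
have vs y : v s y = g y by exact: G_initial.
have H y : u t x `^ p <= v t y * expR (cb * dot (x - y) (x - y)).
  have := @harnack _ _ s Q b eta0 p Qsym eta0_gt0 (fun t' st' => Qell s t' Is st') bmono p1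
    phi a phi2 phi_infty phi1 phiA a0 u v su sv _ t x y st ut.
  move=> /(_ (fun z => _)) h; apply: le_trans (h _) _; first by move=> z; rewrite vs lexx.
  have v0 : 0 <= v t y.
    apply: (@solution_ge0 _ _ s Q b eta0 Qsym eta0_gt0 (fun t' st' => Qell s t' Is st')
      phi a phi2 phi_infty phi1 phiA a0 v sv _ t y (ltW st)).
    by move=> z; rewrite vs powR_ge0.
  by rewrite ler_wpM2l// ler_expR ler_wpM2r// dot_ge0.
have vint : (\int[mu t]_y (v t y)%:E <= (N `^ p)%:E)%E.
  by rewrite (mu_evol It Is st gb); exact: uN.
pose B : set (borelRd R d) := [set y : 'rV[R]_d | enorm y < rho].
have mB : measurable B.
  apply: sub_sigma_algebra.
  apply: (@open_comp _ _ (@enorm R d) [set y | y < rho]); last exact: open_lt.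
  by move=> y _; exact: continuous_enorm.
pose k := u t x `^ p * expR (- (cb * (2 * enorm x ^+ 2 + 2 * rho ^+ 2))).
have k0 : 0 <= k by rewrite mulr_ge0 ?powR_ge0// ltW// expR_gt0.
have v0 y : 0 <= v t y.
  have := H y; rewrite -ler_pdivrMr ?expR_gt0//; apply: le_trans.
  by rewrite divr_ge0 ?powR_ge0// ltW// expR_gt0.
have mv : measurable_fun [set: borelRd R d] (v t : borelRd R d -> R).
  by apply: continuous_measurable_borelRd; exact: bounded_solution_continuous sv st.
have kB y : B y -> k <= v t y.
  move=> yB; rewrite /k expRN ler_pdivrMr ?expR_gt0// (le_trans (H y))//.
  rewrite ler_wpM2l// ler_expR ler_wpM2l ?(ltW cb0)//.
  apply: (le_trans (dot_diff_le _ _)); rewrite lerD2l ler_wpM2l//.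
  by rewrite ler_sqr ?nnegrE ?enorm_ge0 ?(ltW rho0)// ltW.
have half : k / 2 <= N `^ p.
  rewrite -lee_fin; apply: le_trans vint.
  apply: (@le_trans _ _ (\int[mu t]_(y in B) (k%:E))%E).
    rewrite integral_cst// EFinM lee_wpmul2l ?lee_fin//.
    have := Hrho t It; apply: le_trans; rewrite lee_fin; lra.
  apply: (@le_trans _ _ (\int[mu t]_(y in B) (v t y)%:E)%E).
    apply: ge0_le_integral => //.
    by apply/measurable_EFinP; apply: measurable_funS mv.
  apply: ge0_subset_integral => //; first exact/measurable_EFinP.
  by move=> y _; rewrite lee_fin.
have key : u t x `^ p <= (A `^ p^-1 * N * phi_exp (2 * cb / p) x) `^ p.
  rewrite powRM ?mulr_ge0 ?powR_ge0 ?(ltW (phi_exp_gt0 _ _))// powRM ?powR_ge0//.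
  rewrite -powRrM mulVf ?gt_eqF// powRr1 ?(ltW A0)//.
  have -> : phi_exp (2 * cb / p) x `^ p = expR (2 * cb * enorm x ^+ 2).
    by rewrite /phi_exp -expRM; congr expR; field; rewrite gt_eqF.
  have : u t x `^ p * expR (- (cb * (2 * enorm x ^+ 2 + 2 * rho ^+ 2))) <= 2 * N `^ p.
    by move: half; rewrite -/k; lra.
  rewrite expRN ler_pdivrMr ?expR_gt0// => h; apply: (le_trans h).
  rewrite /A le_eqVlt; apply/orP; left; apply/eqP.
  have -> : cb * (2 * enorm x ^+ 2 + 2 * rho ^+ 2) = 2 * cb * rho ^+ 2 + 2 * cb * enorm x ^+ 2 by ring.
  by rewrite expRD; ring.
rewrite leNgt; apply/negP => h; move: key; rewrite leNgt => /negP; apply.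
rewrite gt0_ltr_powR// ?nnegrE; last exact: ltW.
by rewrite !mulr_ge0 ?powR_ge0 ?(ltW (phi_exp_gt0 _ _)).
Qed.

(** [integrated_harnack] up to time s + del/2, then [decay_bound] during
the time del/2 that remains; lower bounds follow by applying this to - u. *)
Lemma ultracontractive_estimate (p del : R) : 1 < p -> 0 < del ->
  exists2 B, 0 < B & forall s t u N, I s -> s + del <= t ->
    bounded_solution s Q b u -> class_Cb (u s) -> 0 <= N ->
    (\int[mu s]_x (`|u s x| `^ p)%:E <= (N `^ p)%:E)%E ->
    forall x, `|u t x| <= B * N.
Proof.
move=> p1 del0.
have [_ _ [_ [eta0 [Lam [eta0_gt0 _ Qell0]]]] _ _] := hA.
have Qell s t : I s -> s < t -> forall v : 'rV[R]_d, eta0 * dot v v <= dot (mxapp (Q t) v) v.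
  move=> Is st v; have /andP[+ _] := Qell0 t (mem_I_later Is (ltW st)) v.
  by rewrite enorm2.
have p0 : 0 < p by exact: lt_trans p1.
pose kap := (1 - p^-1) * eta0.
have kap0 : 0 < kap by rewrite mulr_gt0// subr_gt0 invf_lt1.
have d2 : 0 < del / 2 by rewrite divr_gt0.
pose cb := (4 * kap * (del / 2))^-1.
have cb0 : 0 < cb by rewrite invr_gt0 mulr_gt0// mulr_gt0.
have [K K0 HK] := integrated_harnack p1 cb0 eta0_gt0 Qell.
pose lam := 2 * cb / p.
have lam0 : 0 < lam by rewrite divr_gt0// mulr_gt0.
have [rho [h [rho0 hadm Aphi]]] := h_lambda lam0.
have [Z0 [m [tau [Z00 [m0 tau0] mtau sumtau hle]]]] := admissible_h_schedule hadm d2.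
(* {psi >= Y1} lies in {|x| >= rho}, where the hypothesis on h holds, and in
   {psi >= Z0}, where the schedule does. *)
pose Y1 := Num.max Z0 (expR (lam * rho ^+ 2)).
have Y10 : 0 < Y1 by rewrite lt_max Z00.
have Y1rho x : Y1 <= phi_exp lam x -> rho <= enorm (x : 'rV[R]_d) /\ Z0 <= phi_exp lam x.
  rewrite ge_max => /andP[hZ]; rewrite /phi_exp ler_expR ler_pM2l// => hr; split => //.
  by move: hr; rewrite ler_sqr ?nnegrE ?enorm_ge0// ltW.
exists (K * (Y1 + 2 * Z0)); first by rewrite mulr_gt0// addr_gt0// mulr_gt0.
have one_sided s t u N : I s -> s + del <= t ->
    bounded_solution s Q b u -> class_Cb (u s) -> 0 <= N ->
    (\int[mu s]_x (`|u s x| `^ p)%:E <= (N `^ p)%:E)%E ->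
    forall x, u t x <= K * (Y1 + 2 * Z0) * N.
  move=> Is st su cu N0 uN x.
  have [_ [a [phi [[_ a0 phi2 phi_infty phi1] Qsym _ _ phiA]]]] := standing_data Is.
  pose r := s + del / 2.
  have sr : s < r by rewrite ltrDl.
  have It t' : r < t' -> I t' by move=> rt; apply: (mem_I_later Is); rewrite ltW// (lt_trans sr).
  have loc t' y : r <= t' -> u t' y <= K * N * phi_exp lam y.
    move=> rt; have dt : del / 2 <= t' - s by rewrite lerBrDl.
    apply: (HK s t' u N Is (lt_le_trans sr rt)) => //.
    have k4 : 0 < 4 * kap by rewrite mulr_gt0.
    rewrite -/kap /cb lef_pV2 ?posrE ?(mulr_gt0 k4)// ?(lt_le_trans d2)//.
    by rewrite ler_pM2l.
  have KN : 0 <= K * N by rewrite mulr_ge0// ltW.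
  have Apsi t' y : r < t' -> Y1 <= phi_exp lam y ->
      opA Q b t' (phi_exp lam) y <= - h (phi_exp lam y).
    by move=> rt /Y1rho[hr _]; apply: Aphi => //; exact: It.
  have Qpos : forall t', s < t' -> forall v : 'rV[R]_d, v != 0 -> 0 < dot (mxapp (Q t') v) v.
    by move=> t' st' v v0; apply: (elliptic_posdef eta0_gt0 (fun t'' => Qell s t'' Is) st').
  have := @decay_bound _ _ s Q b Qsym Qpos phi a phi2 phi_infty phi1 phiA a0 (phi_exp lam)
    (class_C2_phi_exp lam) (phi_exp_gt0 lam) Y1 u su r (del / 2) (K * N * Y1) (K * N) Z0 m tau
    (ltW sr) (mulr_ge0 KN (ltW Y10)) KN Z00 m0 tau0 mtau sumtau.
  move=> H; apply: (le_trans (H _ _ _ _ t x _)).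
  - move=> n t' y rt hy; apply: (le_trans (Apsi _ _ rt hy)); rewrite lerN2.
    by have [_] := hle _ (Y1rho _ hy).2; exact.
  - move=> t' y rt hy; apply: (le_trans (Apsi _ _ rt hy)); rewrite oppr_le0.
    by have [] := hle _ (Y1rho _ hy).2.
  - by move=> t' y rt hy; rewrite (le_trans (loc t' y rt))// ler_wpM2l// ltW.
  - by move=> y; exact: loc.
  - by rewrite /r -addrA -splitr.
  - by rewrite -mulrDr mulrAC.
move=> s t u N Is st su cu N0 uN x.
rewrite ler_norml; apply/andP; split; last exact: (one_sided s).
rewrite lerNl.
have suN := bounded_solution_lin (-1) 0 su su.
set w := (fun t x => _) in suN.
have wE t' y : w t' y = - u t' y by rewrite /w mulN1r mul0r addr0.
rewrite -wE; apply: (one_sided s t w N Is st suN _ N0 _ x).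
- have -> : w s = (fun y => (-1) * u s y) by apply/funext => y; rewrite wE mulN1r.
  exact: Cb_scale.
- by under eq_integral do rewrite wE normrN.
Qed.

Lemma G_ultracontractive (p del : R) : 1 < p -> 0 < del ->
  exists2 B, 0 < B & forall s t F N, I s -> s + del <= t -> class_Cb F -> 0 <= N ->
    (Lnorm (mu s) p%:E (EFin \o F) <= N%:E)%E -> forall x, `|G t s F x| <= B * N.
Proof.
move=> p1 del0; have [B B0 H] := ultracontractive_estimate p1 del0.
exists B => // s t F N Is st Fb N0 FN x.
have E : G s s F = F by apply/funext => y; exact: G_initial.
apply: (H s t (fun t => G t s F)) => //; [exact: G_solution|by rewrite E|].
by rewrite E; exact: (Lnorm_le_powR (ltW p1)).
Qed.

(** G(t,s) F - G(t,s) F' is itself a bounded solution, with initial value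
F - F'. *)
Lemma G_diff_ultracontractive (p del : R) : 1 < p -> 0 < del ->
  exists2 B, 0 < B & forall s t F F' N, I s -> s + del <= t -> class_Cb F -> class_Cb F' -> 0 <= N ->
    (Lnorm (mu s) p%:E (EFin \o (F \- F')%R) <= N%:E)%E ->
    forall x, `|G t s F x - G t s F' x| <= B * N.
Proof.
move=> p1 del0; have [B B0 H] := ultracontractive_estimate p1 del0.
exists B => // s t F F' N Is st Fb Fb' N0 FN x.
have sw := bounded_solution_lin 1 (-1) (G_solution Is Fb) (G_solution Is Fb').
set w := (fun t x => _) in sw.
have wE t' y : w t' y = G t' s F y - G t' s F' y by rewrite /w mul1r mulN1r.
have ws : w s = F \- F' by apply/funext => y; rewrite wE !G_initial.
rewrite -wE; apply: (H s t w N Is st sw _ N0 _ x).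
  have -> : w s = F \+ (fun y => (-1) * F' y) by rewrite ws; apply/funext => y /=; rewrite mulN1r.
  by apply: Cb_add => //; exact: Cb_scale.
by rewrite ws; exact: (Lnorm_le_powR (ltW p1)).
Qed.

Lemma Lp_extension_Cb (p t s : R) f : 1 < p -> I t -> I s -> s < t ->
  f \in Lfun (mu s) p%:E -> exists2 g, class_Cb g & Lp_extension G mu p t s f g.
Proof.
move=> p1 It Is st fL; have p1' := ltW p1.
have ts : 0 < t - s by rewrite subr_gt0.
have [B B0 HB] := G_diff_ultracontractive p1 ts.
have [F HF] := Cb_dense_Lfun p1' fL.
have mf := ((LfunE (mu s) p f).1 fL).1.
pose e n : R := n.+1%:R^-1.
have e0 n : 0 < e n by rewrite invr_gt0 ltr0n.
have Fb n : class_Cb (F n) by have [] := HF n.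
have FL n : (Lnorm (mu s) p%:E (EFin \o (F n \- f)%R) <= (e n)%:E)%E by have [] := HF n.
have mF n : measurable_fun setT (F n : borelRd R d -> R) by exact: Cb_measurable.
have GF n m x : `|G t s (F n) x - G t s (F m) x| <= B * e n + B * e m.
  rewrite -mulrDr; apply: (HB s t (F n) (F m) (e n + e m) Is) => //; first by rewrite addrC subrK.
    by rewrite addr_ge0// ltW.
  apply: (Lnorm_triangle p1' _ _ _ _ (FL n) (FL m)); [exact: measurable_funB|exact: measurable_funB|exact: measurable_funB|].
  move=> x'; apply: le_trans (ler_normB _ _).
  by rewrite /= opprB addrA subrK.
have e_cvg : e n @[n --> \oo] --> (0 : R) by exact: cvg_harmonic.
have Be_cvg : B * e n @[n --> \oo] --> (0 : R).
  by rewrite -(mulr0 B); apply: cvgM => //; exact: cvg_cst.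
have Gb n : class_Cb (G t s (F n)).
  have sG := G_solution Is (Fb n).
  split; first exact: (bounded_solution_continuous sG st).
  by have [_ _ [M HM]] := sG; exists M => x; apply: HM; exact: ltW.
have [g gb hg] := uniform_cauchy_limit Gb Be_cvg GF.
exists g => //; split => //; first exact: Cb_Lfun.
exists F; split => //.
- by apply: (@ereal_cvg0_le _ _ e) => // n; exact: Lnorm_ge0.
- apply: (@ereal_cvg0_le _ _ (fun n => B * e n)) => [n|n|//]; first exact: Lnorm_ge0.
  apply: Lnorm_bounded => //; first by rewrite mulr_ge0// ltW.
    by apply: measurable_funB; exact: Cb_measurable.
  by move=> x; exact: hg.
Qed.

(** If |f|_p <= 1, approximations of f have norm at most 1 + eta / B, so their
images are bounded by B + eta; hence (|g| - (B + eta))^+ is a limit of 0 in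
L^p. *)
Lemma Lp_extension_bound (p t s B : R) f g : 1 < p -> I t -> I s -> s < t -> 0 < B ->
  (forall F N, class_Cb F -> 0 <= N -> (Lnorm (mu s) p%:E (EFin \o F) <= N%:E)%E ->
    forall x, `|G t s F x| <= B * N) ->
  Lp_extension G mu p t s f g -> (Lnorm (mu s) p%:E (EFin \o f) <= 1)%E ->
  (Lnorm (mu t) +oo%E (EFin \o g) <= B%:E)%E.
Proof.
move=> p1 It Is st B0 HB [fL gL [F [Fb Ff Fg]]] f1; have p1' := ltW p1.
have mf := ((LfunE (mu s) p f).1 fL).1.
have mg := ((LfunE (mu t) p g).1 gL).1.
have mF n : measurable_fun setT (F n : borelRd R d -> R) by exact: Cb_measurable.
have mG n : measurable_fun setT (G t s (F n) : borelRd R d -> R).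
  apply: continuous_measurable_borelRd.
  exact: (bounded_solution_continuous (G_solution Is (Fb n)) st).
rewrite unlock /= probability_setT lte01.
apply/lee_addgt0Pr => eta eta0; apply/ess_supP.
(* The excess of |g| over B + eta. *)
pose w x : R := Num.max (`|g x| - (B + eta)) 0.
have mw : measurable_fun [set: borelRd R d] (w : borelRd R d -> R).
  apply: measurable_maxr => //; apply: measurable_funB => //.
  exact: measurableT_comp.
have w0 : Lnorm (mu t) p%:E (EFin \o w) = 0%E.
  apply/eqP; rewrite eq_le Lnorm_ge0 andbT; apply/lee_addgt0Pr => a a0; rewrite add0e.
  have eB : 0 < eta / B by rewrite divr_gt0.
  near \oo => n.
  have Fn : (Lnorm (mu s) p%:E (EFin \o (F n \- f)%R) <= (eta / B)%:E)%E.
    by near: n; exact: ereal_cvg0_near Ff _ eB.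
  have Gn : (Lnorm (mu t) p%:E (EFin \o (G t s (F n) \- g)%R) <= a%:E)%E.
    by near: n; exact: ereal_cvg0_near Fg _ a0.
  have FN : (Lnorm (mu s) p%:E (EFin \o F n) <= (eta / B + 1)%:E)%E.
    apply: (Lnorm_triangle p1' _ _ _ _ Fn f1) => //; first exact: measurable_funB.
    by move=> x; apply: le_trans (ler_normD _ _); rewrite /= subrK.
  have GN x : `|G t s (F n) x| <= B + eta.
    have eN : 0 <= eta / B + 1 by rewrite addr_ge0// ltW.
    have -> : B + eta = B * (eta / B + 1) by field; rewrite gt_eqF.
    exact: HB FN x.
  apply: le_trans Gn; apply: (le_Lnorm _ p1') => //; first exact: measurable_funB.
  move=> x; rewrite /w /=.
  have := ler_normB (G t s (F n) x) (G t s (F n) x - g x); rewrite opprB addrC subrK => h1.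
  have h2 := GN x; have h3 := normr_ge0 (G t s (F n) x - g x).
  case: (leP (`|g x| - (B + eta)) 0) => h4; first by rewrite normr0.
  rewrite gtr0_norm//; lra.
have pe : (0 < p%:E)%E by rewrite lte_fin (lt_trans _ p1).
have := Lnorm_eq0_eq0 (iffRL (measurable_EFinP _ _) mw) pe w0.
apply: filterS => x h0; have {h0} h : w x = 0 by apply: EFin_inj; exact: h0.
rewrite -EFinD lee_fin -subr_le0.
by apply: (@le_trans _ _ (w x)); [rewrite /w le_max lexx|rewrite h].
Unshelve. all: by end_near. Qed.

(** C(r) is the infimum of the constants valid for all t >= s + r, plus 1/r. The
infimum is nonincreasing in r; the summand 1/r makes C strictly decreasing and
unbounded at 0, and leaves room for a constant below C(r) that is actually
valid. *)
Lemma ultrabounded_G : ultrabounded I G mu.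
Proof.
move=> p p1; split.
  move=> t s It Is st f fL; have [g gb gext] := Lp_extension_Cb p1 It Is st fL.
  exists g => //; rewrite /Linfty /=; apply/andP; rewrite !inE; split; first exact: Cb_measurable.
  rewrite /finite_norm unlock /= probability_setT lte01.
  have [_ [M gM]] := gb.
  apply: (@le_lt_trans _ _ M%:E); last exact: ltry.
  by apply/ess_supP; apply: aeW => x /=; rewrite lee_fin.
pose V (r : R) : set R := [set B | 0 < B /\ forall s t F N, I s -> s + r <= t -> class_Cb F ->
  0 <= N -> (Lnorm (mu s) p%:E (EFin \o F) <= N%:E)%E -> forall x, `|G t s F x| <= B * N].
have V0 r : 0 < r -> V r !=set0.
  by move=> r0; have [B B0 HB] := G_ultracontractive p1 r0; exists B.
have lbV r : lbound (V r) 0 by move=> B [/ltW].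
have hV r : 0 < r -> has_inf (V r).
  by move=> r0; split; [exact: V0|exists 0; exact: lbV].
have inf0 r : 0 < r -> 0 <= inf (V r) by move=> r0; apply: lb_le_inf; [exact: V0|exact: lbV].
exists (fun r => inf (V r) + r^-1); split.
- by move=> r r0; rewrite ltr_wpDl ?inf0// invr_gt0.
- move=> r1 r2 r10 r12; have r20 := lt_trans r10 r12.
  apply: ler_ltD; last by rewrite ltf_pV2.
  apply: lb_le_inf; first exact: V0.
  move=> B [B0 HB]; apply: ge_inf; first by exists 0; exact: lbV.
  split=> // s t F N Is st; apply: HB => //.
  by rewrite (le_trans _ st)// lerD2l ltW.
- apply/cvgryPge => A; near=> r.
  have r0 : 0 < r by [].
  apply: (@le_trans _ _ (r^-1)); last by rewrite lerDr inf0.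
  apply: (@le_trans _ _ (`|A| + 1)); first by rewrite (le_trans (ler_norm _))// lerDl.
  have A0 : 0 < `|A| + 1 by rewrite ltr_wpDl.
  rewrite -[leLHS]invrK lef_pV2 ?posrE ?invr_gt0//.
  by near: r; apply: nbhs_right_le; rewrite invr_gt0.
- move=> t s It Is st.
  have ts : 0 < t - s by rewrite subr_gt0.
  have [|B [B0 HB] Blt] := @inf_adherent _ (V (t - s)) ((t - s)^-1) _ (hV _ ts).
    by rewrite invr_gt0.
  apply: (@le_trans _ _ B%:E); last by rewrite lee_fin ltW.
  apply: ge_ereal_sup => _ [f [g [fg f1 ->]]].
  apply: (Lp_extension_bound p1 It Is st B0 _ fg f1) => F N Fb N0 FN.
  by apply: HB => //; rewrite addrC subrK.
Unshelve. all: by end_near. Qed.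

End Ultraboundedness.

Theorem theorem4p1 (R : realType) (d : nat) (hd : (0 < d)%N)
    (t0 theta : R) (I : set R) (hI : I = `]t0, +oo[%classic)
    (Q : R -> 'M[R]_d) (b : R -> 'rV[R]_d -> 'rV[R]_d)
    (hA : standing_assumptions I Q b theta)
    (G : R -> R -> ('rV[R]_d -> R) -> 'rV[R]_d -> R)
    (hG : evolution_operator I Q b theta G)
    (mu : R -> probability (borelRd R d) R)
    (mu_tight : tight_family I mu)
    (mu_evol : evolution_system_of_measures I G mu)
    (h_lambda : forall lambda : R, 0 < lambda ->
      exists (rho : R) (h : R -> R),
        [/\ 0 < rho, admissible_h h &
            forall t x, I t -> rho <= enorm x ->
              opA Q b t (phi_exp lambda) x <= - h (phi_exp lambda x)]) :
  ultrabounded I G mu /\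
  forall p : R, 1 < p -> forall t s, I t -> I s -> s < t ->
    maps_Lp_into G mu p t s class_Cb.
Proof.
split; first exact: (ultrabounded_G hI hA hG mu_tight mu_evol h_lambda).
move=> p p1 t s It Is st f fL.
exact: (Lp_extension_Cb hI hA hG mu_tight mu_evol h_lambda p1 It Is st fL).
Qed.
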